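(* In the completely randomized $2^K$ factorial design setup of the context, let $\hat{\mathbb M}$ be the output of the forward screening procedure with $D=K$, and for a fixed weighting vector $f\in\mathbb R^Q$ let $\gamma=f^\top\bar Y$, $\hat\gamma_{\mathrm R}=f[\hat{\mathbb M}]^\top\hat Y$, $\hat v_{\mathrm R}^2=f[\hat{\mathbb M}]^\top\hat V_{\hat Y}f[\hat{\mathbb M}]$. Assume conditions (C1)–(C4) of the context (with $D=K$, and (C4) of the same heredity type as the procedure). Let $f^\star=f[\mathbb M^\star]$ and $v_{\mathrm R}^2=f^{\star\top}V_{\hat Y}f^\star$. Then, as $N\to\infty$, $(\hat\gamma_{\mathrm R}-\gamma)/v_{\mathrm R}\rightsquigarrow\mathcal N(0,1)$. If moreover $\|f^\star\|_\infty=O(Q^{-1})$, then $N(\hat v_{\mathrm R}^2-v_{\mathrm R,\lim}^2)\to0$ in probability, where $v_{\mathrm R,\lim}^2=f^{\star\top}D_{\hat Y}f^\star\ge v_{\mathrm R}^2$.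
   Context: Setup. Let $K\ge 2$, $\mathcal T=\{0,1\}^K$ with $Q=2^K$ elements ordered lexicographically. For $\mathcal K\subseteq[K]$ let $g_{\mathcal K}(z)=\prod_{k\in\mathcal K}(2z_k-1)$, $g_\emptyset=\mathbf 1_Q$; $G$ is the $Q\times Q$ matrix with columns $g_{\mathcal K}$, $\mathcal K\subseteq[K]$. For a set $\mathbb M$ of subsets of $[K]$, $G(\cdot,\mathbb M)$ is the submatrix of columns indexed by $\mathbb M$ and $f[\mathbb M]=Q^{-1}G(\cdot,\mathbb M)G(\cdot,\mathbb M)^\top f$. $N$ units with potential outcomes $Y_i(z)$; $\bar Y(z)=N^{-1}\sum_iY_i(z)$, $S(z,z')=(N-1)^{-1}\sum_i(Y_i(z)-\bar Y(z))(Y_i(z')-\bar Y(z'))$; $\tau_{\mathcal K}=Q^{-1}g_{\mathcal K}^\top\bar Y$; a parent of $\mathcal K$ is a subset of size $|\mathcal K|-1$. Design: fixed $N(z)\ge2$ summing to $N$, assignment uniform over assignments with $N(z)$ units at $z$; $Y_i=Y_i(Z_i)$; $\hat Y(z)$, $\hat S(z,z)$ the sample mean and sample variance (divisor $N(z)-1$) of observed outcomes in arm $z$; $V_{\hat Y}=\mathrm{Cov}(\hat Y)=D_{\hat Y}-N^{-1}S$ with $D_{\hat Y}=\mathrm{diag}(N(z)^{-1}S(z,z))$; $\hat V_{\hat Y}=\mathrm{diag}(N(z)^{-1}\hat S(z,z))$. $\mathbb M^\star_d=\{\mathcal K:|\mathcal K|=d,\tau_{\mathcal K}\ne0\}$,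 $\mathbb M^\star_{1:D}=\bigcup_{d\le D}\mathbb M^\star_d$, and $\mathbb M^\star=\{\emptyset\}\cup\mathbb M^\star_{1:K}$. Forward screening procedure: $\hat{\mathbb M}=\{\emptyset\}$; for $d=1,\dots,D$: let $C_d$ be the $\mathcal K$ with $|\mathcal K|=d$ having at least one parent (weak heredity) or all parents (strong heredity) in $\hat{\mathbb M}$; compute $\hat\tau_{\mathcal K}=Q^{-1}g_{\mathcal K}^\top\hat Y$, $\hat\sigma^2_{\mathcal K}=Q^{-2}g_{\mathcal K}^\top\hat V_{\hat Y}g_{\mathcal K}$; add to $\hat{\mathbb M}$ those $\mathcal K\in C_d$ with $|\hat\tau_{\mathcal K}/\hat\sigma_{\mathcal K}|\ge\Phi^{-1}(1-\min\{\alpha_d/|C_d|,1\}/2)$. Output $\hat{\mathbb M}$. Asymptotics as $N\to\infty$, everything may depend on $N$, constants do not. (C1) $N(z)=c(z)N_0\ge2$ with integer $N_0$ and constants $0<\underline c\le c(z)\le\overline c$. (C2) (i) $|\tau_{\mathcal K}|=\Theta(N^\delta)$ for all $\mathcal K\in\mathbb M^\star_{1:D}$, some $-1/2<\delta\le0$; (ii) $\alpha_d=\Theta(N^{-\delta'})$, some $\delta'>0$; (iii) $\sum_{d\le D}|\mathbb M^\star_d|=\Theta(N^{\delta''})$, some $0\le\delta''<1/3$. (C3) (i) condition number of the correlation matrix of $\hat Y$ at most $\sigma^2$; (ii) $\max_zN^{-1}\sum_i(Y_i(z)-\bar Y(z))^4\le\Delta^4$; (iii) $\max_{i,z}|Y_i(z)-\bar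 Y(z)|/\{\min_zS(z,z)\}^{1/2}\le M$, for constants $\sigma,\Delta,M$. (C4) weak heredity: $\tau_{\mathcal K}\ne0$ only if some parent has nonzero effect; strong heredity: only if all parents have nonzero effects. *)

(* Defs.v *)
From HB Require Import structures.
From mathcomp Require Import all_boot all_order all_algebra.
From mathcomp Require Import all_classical all_reals all_analysis.
Set Implicit Arguments. Unset Strict Implicit. Unset Printing Implicit Defensive.
Import Order.TTheory GRing.Theory Num.Theory Num.Def.
Local Open Scope ring_scope.


Definition trt (K : nat) := {ffun 'I_K -> bool}.

Inductive heredity := Weak | Strong.

Section Defs.
Context {R : realType}.

Definition Phi (t : R) : R := fine (normal_prob 0 1 (`]-oo, t])%classic).
Definition Phi_inv (p : R) : R := inf [set t : R | p <= Phi t]%classic.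

Section Factorial.
Variable K : nat.

Definition Q : R := (2 ^ K)%:R.

Definition g (S : {set 'I_K}) (z : trt K) : R :=
  \prod_(k in S) (2 * (nat_of_bool (z k))%:R - 1).

(* f[M] = Q^-1 G(.,M) G(.,M)^T f *)
Definition fproj (M : {set {set 'I_K}}) (f : trt K -> R) (z : trt K) : R :=
  Q^-1 * \sum_(S in M) g S z * (\sum_(z' : trt K) g S z' * f z').

Definition dotv (u v : trt K -> R) : R := \sum_(z : trt K) u z * v z.
Definition qform (A : trt K -> trt K -> R) (u : trt K -> R) : R :=
  \sum_(z : trt K) \sum_(z' : trt K) u z * A z z' * u z'.

Definition is_eigenvalue (A : trt K -> trt K -> R) (a : R) : Prop :=
  exists v : trt K -> R, (exists z, v z != 0) /\
    forall z, \sum_(z' : trt K) A z z' * v z' = a * v z.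

Definition parent_ok (h : heredity) (M : {set {set 'I_K}}) (S : {set 'I_K}) : bool :=
  match h with
  | Weak => [exists k in S, (S :\ k) \in M]
  | Strong => [forall k in S, (S :\ k) \in M]
  end.

Section Population.
Variable N : nat.
Variable Y : 'I_N -> trt K -> R.

Definition Ybar (z : trt K) : R := N%:R^-1 * \sum_(i < N) Y i z.
Definition Smat (z z' : trt K) : R :=
  (N%:R - 1)^-1 * \sum_(i < N) (Y i z - Ybar z) * (Y i z' - Ybar z').
Definition tau (S : {set 'I_K}) : R := Q^-1 * \sum_(z : trt K) g S z * Ybar z.

Definition Mstar : {set {set 'I_K}} :=
  finset.set0 |: [set S : {set 'I_K} | (S != finset.set0) && (tau S != 0)].
Definition Mstar1 : {set {set 'I_K}} :=
  [set S : {set 'I_K} | (S != finset.set0) && (tau S != 0)].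

Variable Nz : trt K -> nat.

Definition Dmat (z z' : trt K) : R :=
  if z == z' then (Nz z)%:R^-1 * Smat z z else 0.
Definition Vmat (z z' : trt K) : R := Dmat z z' - N%:R^-1 * Smat z z'.
Definition Corr (z z' : trt K) : R :=
  Vmat z z' / Num.sqrt (Vmat z z * Vmat z' z').

Definition assignments : {set {ffun 'I_N -> trt K}} :=
  [set A : {ffun 'I_N -> trt K} | [forall z, #|[set i | A i == z]| == Nz z]].
Definition prob (P : {ffun 'I_N -> trt K} -> bool) : R :=
  #|[set A in assignments | P A]|%:R / #|assignments|%:R.

Section Observed.
Variable A : {ffun 'I_N -> trt K}.
Definition Yhat (z : trt K) : R :=
  (Nz z)%:R^-1 * \sum_(i < N | A i == z) Y i z.
Definition Shat (z : trt K) : R :=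
  ((Nz z)%:R - 1)^-1 * \sum_(i < N | A i == z) (Y i z - Yhat z) ^+ 2.
Definition Vhat (z z' : trt K) : R :=
  if z == z' then (Nz z)%:R^-1 * Shat z else 0.
Definition tauhat (S : {set 'I_K}) : R := Q^-1 * \sum_(z : trt K) g S z * Yhat z.
Definition sighat2 (S : {set 'I_K}) : R := Q^-2 * qform Vhat (g S).

Variable h : heredity.
Variable alpha : nat -> R.

Definition cands (M : {set {set 'I_K}}) (d : nat) : {set {set 'I_K}} :=
  [set S : {set 'I_K} | (#|S| == d) && parent_ok h M S].

Definition screen_step (M : {set {set 'I_K}}) (d : nat) : {set {set 'I_K}} :=
  M :|: [set S in cands M d |
          Phi_inv (1 - minr (alpha d / (#|cands M d|)%:R) 1 / 2)
            <= `|tauhat S / Num.sqrt (sighat2 S)| ].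

Fixpoint screen (D : nat) : {set {set 'I_K}} :=
  match D with
  | 0 => [set finset.set0]
  | d.+1 => screen_step (screen d) d.+1
  end.
End Observed.

Variable h : heredity.
Variable alpha : nat -> R.
Variable f : trt K -> R.

Definition gamma : R := dotv f Ybar.
Definition fMhat (A : {ffun 'I_N -> trt K}) : trt K -> R :=
  fproj (screen A h alpha K) f.
Definition gammaR_hat (A : {ffun 'I_N -> trt K}) : R := dotv (fMhat A) (Yhat A).
Definition vRhat2 (A : {ffun 'I_N -> trt K}) : R := qform (Vhat A) (fMhat A).
Definition fstar : trt K -> R := fproj Mstar f.
Definition vR2 : R := qform Vmat fstar.
Definition vRlim2 : R := qform Dmat fstar.
End Population.
End Factorial.
End Defs.

(* Main.v *)
(** The random assignment is invariant under swapping the treatments of two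
    units. For a centered linear statistic T = sum_i c_i(Z_i) the swapped copy
    T' is an exchangeable partner satisfying the linear regression identity
    exactly, so Stein's method needs only the concentration of the conditional
    mean V of (T' - T)^2. Averaging over the steps of a Fisher-Yates shuffle
    exhibits every swap-Lipschitz function of the assignment as the end point
    of a martingale with bounded increments, which provides this concentration.
    Stein's equation then yields the central limit theorem for T, and
    m'(t) = E[T e^(tT)] <= t E[V e^(tT)] for the moment generating function m
    yields tails P(T > z) <= C exp(- z^2 (1 - o(1)) / 2) with the sharp constant.

    The screening consequently selects the true model with probability tending
    to 1. As long as the lower levels are correct, heredity makes every active
    effect a candidate. An inactive candidate passes its test with probability
    at most (alpha_d / |C_d|)^(1 - o(1)), and the sum over |C_d| <= Q <= N
    candidates still vanishes since alpha_d = O(N^-delta'); this is where the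
    sharp constant is needed. An active one is missed with vanishing
    probability because |tau| is of order N^delta >> (log N / N)^(1/2).
    On the event of correct selection the estimator is the linear statistic
    with weights f^star. As a combination of the |M^star| = o(N^(1/2)) columns
    g_K, f^star satisfies |f^star(z)|^2 <= |M^star| ||f^star||^2 / Q, while the
    condition number bound makes V_Yhat comparable to D_Yhat; together these
    give the Lindeberg smallness that the central limit theorem requires. *)

Require Import Defs.
From HB Require Import structures.
From mathcomp Require Import all_boot all_order all_algebra.
From mathcomp Require Import perm.
From mathcomp Require Import all_classical all_reals all_analysis.
From mathcomp Require Import measurable_realfun.
From mathcomp Require Import ring lra zify.
Set Implicit Arguments. Unset Strict Implicit. Unset Printing Implicit Defensive.
Import Order.TTheory GRing.Theory Num.Theory Num.Def.
Import numFieldTopology.Exports.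
Local Open Scope ring_scope.

(** * Calculus *)

(** The arms may stay as small as two units while their number grows with N, so a single arm mean or
    arm variance need not concentrate; only sums over all arms do. This is why every statistic is
    controlled through its change under one swap.

    Studentization costs little because g_S(z)^2 = 1: all the estimates [sighat2] coincide, and a
    single event controls every denominator.

    The candidate sets are random, which would spoil a union bound. They are compared with the
    candidate sets and critical values computed from the true model, which are deterministic: if
    each of these fixed tests decides correctly, the data-driven procedure runs through exactly the
    same tests.

    K, N and the outcomes all vary along the sequence, so the limit statements rest on finite-sample
    bounds whose constants depend only on the regularity parameters. The scale is L = ln N: critical
    values are O(1 + L), K is at most 2 L, and everything to be beaten is a polynomial in L against
    a positive power of N. *)

Section Calculus.
Context {R : realType}.
Implicit Types (f g df : R -> R) (x : R).

Lemma is_derive1_add f g x (a b : R) : is_derive x (1 : R) f a -> is_derive x (1 : R) g b ->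
  is_derive x (1 : R) (fun y => f y + g y) (a + b).
Proof. by move=> fa gb; exact: is_deriveD. Qed.

Lemma is_derive1_mul f g x (a b : R) : is_derive x (1 : R) f a -> is_derive x (1 : R) g b ->
  is_derive x (1 : R) (fun y => f y * g y) (a * g x + f x * b).
Proof.
move=> fa gb; have H := is_deriveM fa gb.
by apply: (is_derive_eq H); rewrite /GRing.scale /= addrC mulrC.
Qed.

Lemma is_derive1_cst x (a : R) : is_derive x (1 : R) (fun=> a) 0.
Proof. exact: is_derive_cst. Qed.

Lemma is_derive1_id x : is_derive x (1 : R) (fun y => y) 1.
Proof. exact: is_derive_id. Qed.

Lemma is_derive1_opp f x (a : R) : is_derive x (1 : R) f a ->
  is_derive x (1 : R) (fun y => - f y) (- a).
Proof. by move=> fa; exact: is_deriveN. Qed.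

Lemma is_derive1_expR f x (a : R) : is_derive x (1 : R) f a ->
  is_derive x (1 : R) (fun y => expR (f y)) (expR (f x) * a).
Proof. by move=> fa; apply: is_derive1_comp. Qed.

Lemma is_derive1_sum (I : Type) (r : seq I) (P : pred I) (F : I -> R -> R) (d : I -> R) x :
  (forall i, is_derive x (1 : R) (F i) (d i)) ->
  is_derive x (1 : R) (fun y => \sum_(i <- r | P i) F i y) (\sum_(i <- r | P i) d i).
Proof.
move=> Fd; elim: r => [|i r IH].
  rewrite big_nil; apply: (is_derive_eq (f' := 0)) => //.
  by under eq_fun do rewrite big_nil; exact: is_derive1_cst.
rewrite big_cons; under eq_fun do rewrite big_cons.
by case: (P i) => //; exact: is_derive1_add.
Qed.

Lemma is_derive1_continuous f df : (forall x, is_derive x (1 : R) f (df x)) ->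
  continuous f.
Proof.
move=> fd x; apply/differentiable_continuous/derivable1_diffP.
by have [] := fd x.
Qed.

Lemma mean_value f df (a b : R) : (forall x, is_derive x (1 : R) f (df x)) -> a <= b ->
  exists2 c, a <= c <= b & f b - f a = df c * (b - a).
Proof.
move=> fd ab.
have cf : continuous f := is_derive1_continuous fd.
have [c] := @MVT_segment R f df a b ab (fun x _ => fd x) (continuous_subspaceT cf).
by rewrite in_itv /= => cab E; exists c.
Qed.

Lemma derive_ge0_le f df (a b : R) : (forall x, is_derive x (1 : R) f (df x)) -> a <= b ->
  (forall x, a <= x <= b -> 0 <= df x) -> f a <= f b.
Proof.
move=> fd ab d0; have [c cab E] := mean_value fd ab.
by rewrite -subr_ge0 E mulr_ge0 ?d0 // subr_ge0.
Qed.

(** This is tanh u <= u cleared of its denominator; the difference of the two sides vanishes at 0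
    and has derivative u (e^u - e^-u) >= 0. *)
Lemma tanh_le (u : R) : 0 <= u -> expR u - expR (- u) <= u * (expR u + expR (- u)).
Proof.
move=> u0; rewrite -subr_ge0.
pose f (y : R) := y * (expR y + expR (- y)) + - (expR y + - expR (- y)).
pose df (y : R) := y * (expR y - expR (- y)).
have fd y : is_derive y (1 : R) f (df y).
  have dN := is_derive1_expR (is_derive1_opp (is_derive1_id y)).
  have d1 := is_derive1_mul (is_derive1_id y) (is_derive1_add (is_derive_expR y) dN).
  have d2 := is_derive1_opp (is_derive1_add (is_derive_expR y) (is_derive1_opp dN)).
  by apply: (is_derive_eq (is_derive1_add d1 d2)); rewrite /df; ring.
have -> : 0 = f 0 by rewrite /f oppr0; ring.
apply: (derive_ge0_le fd u0) => y /andP[y0 _].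
by rewrite mulr_ge0 // subr_ge0 ler_expR; lra.
Qed.

(* trapezoid bound for the convex function exp *)
Lemma expR_diff_le (x d : R) :
  d * (expR (x + d) - expR x) <= d ^+ 2 * ((expR (x + d) + expR x) / 2).
Proof.
have e1 : expR (x + d) = expR (x + d / 2) * expR (d / 2) by rewrite -expRD; congr expR; lra.
have e2 : expR x = expR (x + d / 2) * expR (- (d / 2)) by rewrite -expRD; congr expR; lra.
have m0 := expR_gt0 (x + d / 2).
suff H : d * (expR (d / 2) - expR (- (d / 2)))
      <= d * (d / 2 * (expR (d / 2) + expR (- (d / 2)))).
  rewrite e1 e2.
  have := ler_wpM2l (ltW m0) H; lra.
have [d0|d0] := leP 0 d.
  by apply: ler_wpM2l => //; apply: tanh_le; lra.
have := @tanh_le (- (d / 2)); rewrite opprK => H.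
by have := H ltac:(lra); nra.
Qed.

End Calculus.

(** * Uniform random assignments *)

Section RandomAssignment.
Context {R : realType} {K N : nat} (Nz : trt K -> nat).

Local Notation asg := {ffun 'I_N -> trt K}.
Local Notation Omega := (@assignments K N Nz).

Definition swap (i j : 'I_N) (A : asg) : asg := [ffun k => A (tperm i j k)].

Definition Ex (F : asg -> R) : R := #|Omega|%:R^-1 * \sum_(A in Omega) F A.

Lemma swapK i j : involutive (swap i j).
Proof. by move=> A; apply/ffunP => k; rewrite !ffunE tpermK. Qed.

Lemma swap_id i A : swap i i A = A.
Proof. by apply/ffunP => k; rewrite !ffunE tperm1 perm1. Qed.

Lemma assignmentsP (A : asg) :
  reflect (forall z, #|[set i | A i == z]| = Nz z) (A \in Omega).
Proof.
rewrite inE; apply: (iffP forallP) => H z; first by apply/eqP; exact: H.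
by apply/eqP; exact: H.
Qed.

Lemma swap_in i j A : (swap i j A \in Omega) = (A \in Omega).
Proof.
have card_swap B z : #|[set k | swap i j B k == z]| = #|[set k | B k == z]|.
  rewrite -(card_imset [set k | B k == z] (@perm_inj _ (tperm i j))).
  apply: eq_card => k; rewrite !inE ffunE; apply/idP/imsetP.
    by move=> H; exists (tperm i j k); rewrite ?inE // tpermK.
  by move=> [l]; rewrite inE => H ->; rewrite tpermK.
by apply/assignmentsP/assignmentsP => H z; rewrite -(H z) card_swap.
Qed.

Lemma Ex_swap i j F : Ex (fun A => F (swap i j A)) = Ex F.
Proof.
rewrite /Ex; congr (_ * _).
rewrite [RHS](reindex_inj (inv_inj (swapK i j))) /=.
by apply: eq_bigl => A; rewrite swap_in.
Qed.

Lemma ExD F G : Ex (fun A => F A + G A) = Ex F + Ex G.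
Proof. by rewrite /Ex big_split mulrDr. Qed.

Lemma ExZ a F : Ex (fun A => a * F A) = a * Ex F.
Proof. by rewrite /Ex -big_distrr /= mulrCA. Qed.

Lemma ExZr a F : Ex (fun A => F A * a) = Ex F * a.
Proof. by rewrite /Ex -big_distrl /= mulrA. Qed.

Lemma ExN F : Ex (fun A => - F A) = - Ex F.
Proof. by rewrite /Ex sumrN mulrN. Qed.

Lemma ExB F G : Ex (fun A => F A - G A) = Ex F - Ex G.
Proof. by rewrite ExD ExN. Qed.

Lemma Ex_sum (I : Type) (r : seq I) (P : pred I) (F : I -> asg -> R) :
  Ex (fun A => \sum_(i <- r | P i) F i A) = \sum_(i <- r | P i) Ex (F i).
Proof. by rewrite /Ex exchange_big /= -big_distrr. Qed.

Lemma eq_Ex F G : (forall A, A \in Omega -> F A = G A) -> Ex F = Ex G.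
Proof. by move=> FG; rewrite /Ex; congr (_ * _); apply: eq_bigr. Qed.

Lemma le_Ex F G : (forall A, A \in Omega -> F A <= G A) -> Ex F <= Ex G.
Proof. by move=> FG; rewrite /Ex ler_wpM2l // ler_sum. Qed.

Lemma Ex_ge0 F : (forall A, A \in Omega -> 0 <= F A) -> 0 <= Ex F.
Proof. by move=> FG; rewrite /Ex mulr_ge0 // sumr_ge0. Qed.

Lemma ler_norm_Ex F : `|Ex F| <= Ex (fun A => `|F A|).
Proof.
rewrite /Ex normrM ger0_norm // ler_wpM2l //.
exact: ler_norm_sum.
Qed.

Lemma prob_Ex (P : pred asg) : prob Nz P = Ex (fun A => (P A)%:R).
Proof.
rewrite /prob /Ex mulrC; congr (_ * _).
rewrite -sum1_card natr_sum big_mkcond [RHS]big_mkcond /=.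
apply: eq_bigr => A _; rewrite inE.
by case: (A \in Omega); case: (P A).
Qed.

Lemma prob_le (P P' : pred asg) :
  (forall A, A \in Omega -> P A -> P' A) -> prob Nz P <= prob Nz P' :> R.
Proof.
move=> PP'; rewrite !prob_Ex; apply: le_Ex => A HA.
rewrite ler_nat; move: (PP' A HA); case: (P A) => //= H.
by rewrite H.
Qed.

Lemma prob_ge0 (P : pred asg) : 0 <= prob Nz P :> R.
Proof. by rewrite prob_Ex; apply: Ex_ge0 => A _. Qed.

Lemma probU (P P' : pred asg) :
  prob Nz (fun A => P A || P' A) <= prob Nz P + prob Nz P' :> R.
Proof.
rewrite !prob_Ex -ExD; apply: le_Ex => A _.
by case: (P A); case: (P' A); rewrite /= -?natrD ler_nat.
Qed.

Lemma prob_bigU (I : finType) (D : pred I) (P : I -> pred asg) :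
  prob Nz (fun A => [exists i, D i && P i A]) <= \sum_(i | D i) prob Nz (P i) :> R.
Proof.
rewrite prob_Ex (eq_bigr _ (fun i _ => prob_Ex (P i))) -Ex_sum.
apply: le_Ex => A _; case: existsP => [[i /andP[Di Pi]]|_]; last first.
  by apply: sumr_ge0.
by rewrite (bigD1 i) //= Pi lerDl sumr_ge0.
Qed.

Section Nonempty.
Hypothesis Nz_sum : (\sum_(z : trt K) Nz z)%N = N.

(** The slots (z, u) with u < [Nz z] number N in total, so the units biject with them; sending a
    unit to the arm of its slot is a valid assignment. *)
Lemma assignments_card_gt0 : (0 < #|Omega|)%N.
Proof.
pose X := {z : trt K & 'I_(Nz z)}.
have cX : #|{: X}| = N.
  by rewrite card_tagged sumnE big_map big_enum -[RHS]Nz_sum; apply: eq_bigr => z _; rewrite card_ord.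
pose e (i : 'I_N) : X := enum_val (cast_ord (esym cX) i).
have e_bij : bijective e.
  exists (fun x : X => cast_ord cX (enum_rank x)) => x; rewrite /e.
    by rewrite enum_valK cast_ordKV.
  by rewrite cast_ordK enum_rankK.
apply/card_gt0P; exists [ffun i => tag (e i)]; apply/assignmentsP => z.
transitivity #|[set x : X | tag x == z]|.
  rewrite -(card_imset _ (bij_inj e_bij)); apply: eq_card => x.
  rewrite !inE; have [e' eK e'K] := e_bij.
  apply/imsetP/idP => [[i + ->]|xz]; first by rewrite inE ffunE.
  by exists (e' x); rewrite ?inE ?ffunE e'K.
rewrite -[RHS]card_ord -(card_imset 'I_(Nz z) 
  (f := fun u => Tagged (fun z => 'I_(Nz z)) u : X)).
  apply: eq_card => x; rewrite !inE; apply/idP/imsetP.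
    by case: x => y u /= /eqP yz; subst y; exists u.
  by move=> [u _ ->].
by move=> u v /eqP; rewrite eq_Tagged => /eqP.
Qed.

Lemma Ex_cst a : Ex (fun=> a) = a.
Proof.
rewrite /Ex sumr_const -[a *+ _]mulr_natl mulrA mulVf ?mul1r //.
by rewrite pnatr_eq0 -lt0n assignments_card_gt0.
Qed.

End Nonempty.

End RandomAssignment.

(** * Concentration under swap-Lipschitz bounds *)

Section ExpBounds.
Context {R : realType}.
Implicit Types x a : R.

(** Both cases invert e^y >= 1 + y: at y = -x when x <= 0, and at y = -x/2, then squared, when 0 < x
    <= 1. *)
Lemma expR_le_quad x : x <= 1 -> expR x <= 1 + x + 2 * x ^+ 2.
Proof.
move=> x1; have [x0|x0] := leP x 0.
  have h1 : 1 - x <= expR (- x) by exact: expR_ge1Dx.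
  have e0 := expR_gt0 x.
  have eE : expR x * expR (- x) = 1 by rewrite expRN mulfV ?gt_eqF.
  have h2 : expR x * (1 - x) <= 1 by rewrite -[leRHS]eE ler_wpM2l // ltW.
  nra.
have h1 : 1 - x / 2 <= expR (- (x / 2)) by exact: expR_ge1Dx.
set e := expR (x / 2).
have e0 : 0 < e := expR_gt0 _.
have eE : e * expR (- (x / 2)) = 1 by rewrite expRN mulfV ?gt_eqF.
have h2 : e * (1 - x / 2) <= 1 by rewrite -[leRHS]eE ler_wpM2l // ltW.
have -> : expR x = e * e by rewrite -expRD; congr expR; lra.
have h3 : (e * (1 - x / 2)) * (e * (1 - x / 2)) <= 1.
  have h0 : 0 <= e * (1 - x / 2) by rewrite mulr_ge0 ?ltW //; lra.
  exact: mulr_ile1.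
have h4 : 1 <= (1 + x + 2 * x ^+ 2) * (1 - x / 2) ^+ 2.
  have : 0 <= x ^+ 2 * ((1 - x) * (5 / 4 - x / 2)).
    by rewrite mulr_ge0 ?sqr_ge0 // mulr_ge0; lra.
  lra.
have p : 0 < (1 - x / 2) ^+ 2 by apply: exprn_gt0; lra.
rewrite -(ler_pM2r p); apply: le_trans h4; apply: le_trans h3.
by rewrite le_eqVlt; apply/orP; left; apply/eqP; ring.
Qed.

(** The linear term disappears when averaged over a centered variable, leaving a factor with no
    first-order part; this is what drives Hoeffding's lemma below. *)
Lemma expR_le_quad_expR x : expR x <= x + expR (2 * x ^+ 2).
Proof.
have h2 := @expR_ge1Dx R (2 * x ^+ 2).
have [x1|x1] := leP x 1.
  have h := expR_le_quad x1; lra.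
have : expR x <= expR (2 * x ^+ 2) by rewrite ler_expR; nra.
by lra.
Qed.

Lemma sum_cst (I : Type) (r : seq I) a : \sum_(l <- r) a = (size r)%:R * a.
Proof. by rewrite big_const_seq count_predT iter_addr_0 mulr_natl. Qed.

Lemma mean_cst (I : Type) (r : seq I) a :
  (0 < size r)%N -> (size r)%:R^-1 * \sum_(l <- r) a = a.
Proof. by move=> r0; rewrite sum_cst mulrA mulVf ?mul1r // pnatr_eq0 -lt0n. Qed.

Lemma mean_expR_le (I : Type) (r : seq I) (u : I -> R) (B : R) :
  let m := (size r)%:R^-1 * \sum_(l <- r) u l in
  (0 < size r)%N -> (forall l, `|u l - m| <= B) ->
  (size r)%:R^-1 * \sum_(l <- r) expR (u l) <= expR m * expR (2 * B ^+ 2).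
Proof.
move=> m r0 uB.
have sr0 : (size r)%:R != 0 :> R by rewrite pnatr_eq0 -lt0n.
rewrite ler_pdivrMl ?ltr0n //.
have -> : \sum_(l <- r) expR (u l) = expR m * \sum_(l <- r) expR (u l - m).
  rewrite big_distrr /=; apply: eq_bigr => l _.
  by rewrite -expRD; congr expR; ring.
rewrite mulrCA ler_wpM2l ?expR_ge0 //.
have -> : (size r)%:R * expR (2 * B ^+ 2)
        = \sum_(l <- r) ((u l - m) + expR (2 * B ^+ 2)).
  rewrite big_split /= sum_cst big_split /= sum_cst /m.
  by field.
apply: ler_sum => l _; apply: (le_trans (expR_le_quad_expR _)).
rewrite lerD2l ler_expR ler_wpM2l //.
by rewrite -[leLHS]real_normK ?num_real // lerXn2r ?nnegrE // (le_trans _ (uB l)).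
Qed.

End ExpBounds.

Section Concentration.
Context {R : realType} {K N : nat} (Nz : trt K -> nat).

Local Notation asg := {ffun 'I_N -> trt K}.
Local Notation Omega := (@assignments K N Nz).
Local Notation Ex := (@Ex R K N Nz).

Definition swap_lip (b : R) (F : asg -> R) :=
  forall A i j, A \in Omega -> `|F (swap i j A) - F A| <= b.

(* Fisher-Yates: averages F over the rearrangements of the positions in s *)
Fixpoint shuffle (s : seq 'I_N) (F : asg -> R) (A : asg) : R :=
  match s with
  | [::] => F A
  | x :: s' => (size s)%:R^-1 * \sum_(l <- s) shuffle s' F (swap x l A)
  end.

(** A swap performed before the shuffle step becomes another swap performed after it, so
    swap-Lipschitz bounds survive the averaging. *)
Lemma swap_conj x l i j (A : asg) :
  swap x l (swap i j A) = swap (tperm x l i) (tperm x l j) (swap x l A).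
Proof.
apply/ffunP => k; rewrite !ffunE; congr (A _).
rewrite [RHS](inj_tperm _ _ _ (@perm_inj _ (tperm x l))).
by rewrite !tpermK.
Qed.

Lemma swap_lip_shuffle s b F : swap_lip b F -> swap_lip b (shuffle s F).
Proof.
move=> Fb; elim: s => [//|x s IH] A i j HA /=.
rewrite -mulrBr -sumrB normrM ger0_norm ?invr_ge0 ?ler0n //.
rewrite ler_pdivrMl ?ltr0n //.
apply: (le_trans (ler_norm_sum _ _ _)).
have -> : (size s).+1%:R * b = \sum_(l <- x :: s) b.
  by rewrite sum_cst.
apply: ler_sum => l _; rewrite swap_conj.
by apply: IH; rewrite swap_in.
Qed.

Lemma Ex_shuffle s F : Ex (shuffle s F) = Ex F.
Proof.
elim: s => [//|x s IH] /=.
rewrite ExZ Ex_sum (eq_bigr (fun=> Ex F)); last first.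
  by move=> l _; rewrite (Ex_swap Nz x l (shuffle s F)).
by rewrite (mean_cst (r := x :: s)).
Qed.

(** Each position of [s] is one martingale step. The values averaged there lie within 2b of their
    mean, being each within b of the unswapped value, so Hoeffding's lemma costs a factor exp(2
    (2b)^2). *)
Lemma shuffle_expR s b F A : swap_lip b F -> A \in Omega ->
  shuffle s (fun A => expR (F A)) A
    <= expR (shuffle s F A) * expR ((size s)%:R * (8 * b ^+ 2)).
Proof.
move=> Fb; elim: s A => [|x s IH] A HA; first by rewrite /= mul0r expR0 mulr1.
rewrite [in leLHS]/=.
pose u l := shuffle s F (swap x l A).
have s0 : (0 < size (x :: s))%N by [].
have lip := @swap_lip_shuffle s b F Fb.
have b0 : 0 <= b by apply: le_trans (Fb A x x HA).
have uB l : `|u l - (size (x :: s))%:R^-1 * \sum_(l <- x :: s) u l| <= 2 * b.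
  have -> : u l = (size (x :: s))%:R^-1 * \sum_(m <- x :: s) u l.
    by rewrite mean_cst.
  rewrite -mulrBr -sumrB normrM ger0_norm ?invr_ge0 ?ler0n //.
  rewrite ler_pdivrMl ?ltr0n //.
  apply: (le_trans (ler_norm_sum _ _ _)).
  have -> : (size s).+1%:R * (2 * b) = \sum_(l <- x :: s) (2 * b).
    by rewrite sum_cst.
  apply: ler_sum => m _.
  have h1 := lip A x l HA; have h2 := lip A x m HA.
  rewrite /u (_ : _ - _ = (shuffle s F (swap x l A) - shuffle s F A)
             - (shuffle s F (swap x m A) - shuffle s F A)); last by ring.
  by apply: (le_trans (ler_normB _ _)); lra.
have := mean_expR_le s0 uB => /= M.
have -> : (size s).+1%:R * (8 * b ^+ 2)
   = 2 * (2 * b) ^+ 2 + (size s)%:R * (8 * b ^+ 2) :> R by rewrite -natr1; ring.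
rewrite expRD mulrA.
apply: le_trans (_ : ((size s).+1%:R^-1 * \sum_(l <- x :: s) expR (u l)) *
    expR ((size s)%:R * (8 * b ^+ 2)) <= _); last first.
  by rewrite ler_wpM2r ?expR_ge0.
rewrite -mulrA ler_wpM2l ?invr_ge0 ?ler0n // big_distrl /=.
by apply: ler_sum => l _; apply: IH; rewrite swap_in.
Qed.

(** Shuffling the positions in [s] forgets how the values there were arranged: fixed arm sizes force
    the same multiset of values on [s], and an inner average depends only on the value brought to
    x. *)
Lemma shuffle_agree s F A B : uniq s -> A \in Omega -> B \in Omega ->
  (forall i, i \notin s -> A i = B i) -> shuffle s F A = shuffle s F B.
Proof.
elim: s A B => [|x s IH] A B; first by move=> _ _ _ AB /=; congr F; apply/ffunP => i; apply: AB.
move=> us HA HB AB; rewrite /=; congr (_ * _).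
have /= /andP[xs us'] := us.
(* The inner average as a function of the value z placed at x. The default 0 is never reached, since
   only values taken by [A] on x :: s are summed. *)
pose psi z := if [pick l in x :: s | A l == z] is Some l
              then shuffle s F (swap x l A) else 0.
have key C D l m : C \in Omega -> D \in Omega ->
    (forall i, i \notin x :: s -> C i = D i) -> l \in x :: s -> m \in x :: s ->
    C l = D m -> shuffle s F (swap x l C) = shuffle s F (swap x m D).
  move=> HC HD CD ls ms E; apply: IH => //; rewrite ?swap_in // => i is_.
  rewrite !ffunE; have [->|ix] := eqVneq i x; first by rewrite !tpermL.
  have ixs : i \notin x :: s by rewrite inE negb_or ix.
  have il : i != l by apply: contraNneq ixs => ->.
  have im : i != m by apply: contraNneq ixs => ->.
  by rewrite !tpermD 1?eq_sym ?CD.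
have perm_AB : perm_eq (map A (x :: s)) (map B (x :: s)).
  apply/allP => z _; apply/eqP.
  have cnt C : C \in Omega -> count_mem z (map C (x :: s)) =
      (Nz z - #|[set i | (C i == z) && (i \notin x :: s)]|)%N.
    move=> /assignmentsP /(_ z) <-.
    rewrite count_map -(cardsID [set i in x :: s] [set i | C i == z]).
    have -> : [set i | C i == z] :\: [set i in x :: s]
            = [set i | (C i == z) && (i \notin x :: s)].
      by apply/setP => i; rewrite !inE andbC.
    rewrite addnK -size_filter -(card_uniqP (filter_uniq _ us)).
    by apply: eq_card => i; rewrite !inE mem_filter /= inE.
  rewrite !cnt //; congr (_ - _)%N; apply: eq_card => i; rewrite [LHS]inE [RHS]inE.
  by case: (boolP (i \notin x :: s)) => H; rewrite ?andbF // AB.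
have eA : \sum_(l <- x :: s) shuffle s F (swap x l A) = \sum_(z <- map A (x :: s)) psi z.
  rewrite big_map; apply: eq_big_seq => l ls; rewrite /psi.
  case: pickP => [m /andP[ms /eqP mE]|/(_ l)]; last by rewrite ls eqxx.
  by apply: key.
have eB : \sum_(l <- x :: s) shuffle s F (swap x l B) = \sum_(z <- map B (x :: s)) psi z.
  rewrite big_map; apply: eq_big_seq => l ls; rewrite /psi.
  have : B l \in map A (x :: s) by rewrite (perm_mem perm_AB) map_f.
  move=> /mapP[m ms mE].
  case: pickP => [m' /andP[ms' /eqP mE']|/(_ m)]; last by rewrite ms mE eqxx.
  by apply/esym/key => //; apply/esym.
by rewrite eA eB (perm_big _ perm_AB).
Qed.

Hypothesis Nz_sum : (\sum_(z : trt K) Nz z)%N = N.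

Lemma shuffle_Ex F A : A \in Omega -> shuffle (enum 'I_N) F A = Ex F.
Proof.
move=> HA; rewrite -(Ex_shuffle (enum 'I_N) F).
rewrite -[LHS](Ex_cst (R := R) Nz_sum); apply: eq_Ex => B HB.
apply: shuffle_agree => //; first exact: enum_uniq.
by move=> i; rewrite mem_enum.
Qed.

Lemma swap_lip_mgf b F t : swap_lip b F ->
  Ex (fun A => expR (t * (F A - Ex F))) <= expR (8 * N%:R * (t * b) ^+ 2).
Proof.
move=> Fb.
pose G A := t * (F A - Ex F).
have Gb : swap_lip (`|t| * b) G.
  move=> A i j HA; rewrite /G -mulrBr normrM ler_wpM2l //.
  by rewrite (_ : _ - _ = F (swap i j A) - F A) ?Fb //; ring.
have G0 : Ex G = 0 by rewrite ExZ ExB (Ex_cst Nz_sum) subrr mulr0.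
have [A HA] := card_gt0P (assignments_card_gt0 Nz_sum).
rewrite -/(G _) -(shuffle_Ex (fun A => expR (G A)) HA).
apply: (le_trans (shuffle_expR (enum 'I_N) Gb HA)).
rewrite shuffle_Ex // G0 expR0 mul1r size_enum_ord ler_expR.
rewrite exprMn [`|t| ^+ 2]real_normK ?num_real // -exprMn.
by rewrite mulrCA mulrA.
Qed.

End Concentration.

Section Tails.
Context {R : realType} {K N : nat} (Nz : trt K -> nat).
Local Notation asg := {ffun 'I_N -> trt K}.
Local Notation Omega := (@assignments K N Nz).
Local Notation Ex := (@Ex R K N Nz).
Hypothesis Nz_sum : (\sum_(z : trt K) Nz z)%N = N.
Hypothesis N_gt0 : (0 < N)%N.

(** The excess over 2 is (e^(x/2) - e^(-x/2))^2. It converts a bound on the moment generating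
    function into one on the variance. *)
Lemma cosh_lb (x : R) : 2 + x ^+ 2 / 4 <= expR x + expR (- x).
Proof.
have half (y : R) : 0 <= y -> y <= expR y - expR (- y).
  move=> y0; have h1 := expR_ge1Dx y.
  have : expR (- y) <= 1 by rewrite -expR0 ler_expR; lra.
  lra.
have sq (y : R) : y ^+ 2 <= (expR y - expR (- y)) ^+ 2.
  have [y0|y0] := leP 0 y; first by have := half _ y0; nra.
  have := half (- y); rewrite opprK => H.
  by have := H ltac:(lra); nra.
have := sq (x / 2).
have e1 : expR x = expR (x / 2) ^+ 2 by rewrite expr2 -expRD; congr expR; lra.
have e2 : expR (- x) = expR (- (x / 2)) ^+ 2 by rewrite expr2 -expRD; congr expR; lra.
have e3 : expR (x / 2) * expR (- (x / 2)) = 1 by rewrite expRN mulfV ?gt_eqF ?expR_gt0.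
by rewrite e1 e2; nra.
Qed.

Lemma swap_lip_tail (b : R) (F : asg -> R) (eps : R) : 0 < b -> 0 < eps -> swap_lip Nz b F ->
  prob Nz (fun A => eps <= `|F A - Ex F|)
    <= 2 * expR (- (eps ^+ 2 / (32 * N%:R * b ^+ 2))).
Proof.
move=> b0 e0 Fb; rewrite prob_Ex.
have N0 : (0 : R) < N%:R by rewrite ltr0n.
(* Minimizer of - t eps + 8 N t^2 b^2. *)
pose t := eps / (16 * N%:R * b ^+ 2).
have den0 : 0 < 16 * N%:R * b ^+ 2 by rewrite !mulr_gt0.
have t0 : 0 < t by rewrite divr_gt0.
have main (A : asg) : ((eps <= `|F A - Ex F|)%R : bool)%:R <=
  expR (- (t * eps)) * (expR (t * (F A - Ex F)) + expR (- t * (F A - Ex F))).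
  have [He|_] := leP eps `|F A - Ex F|; last first.
    by rewrite mulr_ge0 ?addr_ge0 ?expR_ge0.
  rewrite mulrDr -!expRD /=.
  have [w0|w0] := leP 0 (F A - Ex F).
    have h : expR 0 <= expR (- (t * eps) + t * (F A - Ex F)).
      by rewrite ler_expR; rewrite ger0_norm // in He; nra.
    by rewrite expR0 in h; apply: le_trans h _; rewrite lerDl expR_ge0.
  have h : expR 0 <= expR (- (t * eps) + - t * (F A - Ex F)).
    by rewrite ler_expR; rewrite ltr0_norm // in He; nra.
  by rewrite expR0 in h; apply: le_trans h _; rewrite lerDr expR_ge0.
apply: (le_trans (le_Ex (fun A _ => main A))).
rewrite ExZ ExD.
have h1 := swap_lip_mgf Nz_sum t Fb; have h2 := swap_lip_mgf Nz_sum (- t) Fb.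
have h3 : Ex (fun A => expR (t * (F A - Ex F))) + Ex (fun A => expR (- t * (F A - Ex F)))
   <= 2 * expR (8 * N%:R * (t * b) ^+ 2).
  by rewrite mulNr sqrrN in h2; lra.
apply: (le_trans (ler_wpM2l (expR_ge0 _) h3)).
rewrite mulrCA -expRD ler_wpM2l // ler_expR le_eqVlt; apply/orP; left; apply/eqP.
rewrite /t; field.
by rewrite !gt_eqF.
Qed.

Lemma swap_lip_var (b : R) (F : asg -> R) : 0 < b -> swap_lip Nz b F ->
  Ex (fun A => (F A - Ex F) ^+ 2) <= 192 * N%:R * b ^+ 2.
Proof.
move=> b0 Fb.
have N0 : (0 : R) < N%:R by rewrite ltr0n.
have den0 : 0 < 8 * N%:R * b ^+ 2 by rewrite !mulr_gt0.
(* Makes the exponent 8 N (t b)^2 equal to 1. With e <= 4 this leaves t^2 / 4 times the variance at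
   most 6, whence 192 = 6 * 4 * 8. *)
pose t := (Num.sqrt (8 * N%:R * b ^+ 2))^-1.
have t2 : t ^+ 2 = (8 * N%:R * b ^+ 2)^-1 by rewrite exprVn sqr_sqrtr // ltW.
have h1 := swap_lip_mgf Nz_sum t Fb; have h2 := swap_lip_mgf Nz_sum (- t) Fb.
have e1 : 8 * N%:R * (t * b) ^+ 2 = 1.
  by rewrite exprMn t2; field; rewrite !gt_eqF.
have e2 : expR 1 <= 4 :> R by have := @expR_le_quad R 1 (lexx _); lra.
rewrite mulNr sqrrN in h2; rewrite e1 in h1 h2.
have main : Ex (fun A => 2 + t ^+ 2 / 4 * (F A - Ex F) ^+ 2) <=
   Ex (fun A => expR (t * (F A - Ex F)) + expR (- t * (F A - Ex F))).
  apply: le_Ex => A _; have := cosh_lb (t * (F A - Ex F)).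
  by rewrite mulNr exprMn; lra.
rewrite !ExD ExZ (Ex_cst Nz_sum) t2 in main.
have h3 : (8 * N%:R * b ^+ 2)^-1 / 4 * Ex (fun A => (F A - Ex F) ^+ 2) <= 6 by lra.
rewrite -ler_pdivlMl ?divr_gt0 ?invr_gt0 // in h3.
by apply: (le_trans h3); rewrite invfM !invrK; lra.
Qed.

End Tails.

(** * The exchangeable pair generated by a swap *)

Section ExchangeablePair.
Context {R : realType} {K N : nat} (Nz : trt K -> nat).
Local Notation asg := {ffun 'I_N -> trt K}.
Local Notation Omega := (@assignments K N Nz).
Local Notation Ex := (@Ex R K N Nz).
Variable c : 'I_N -> trt K -> R.

Definition linstat (A : asg) : R := \sum_i c i (A i).
Definition swap_diff i j (A : asg) : R :=
  c i (A j) + c j (A i) - c i (A i) - c j (A j).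
(** Averaged over a uniform pair (i, j), the swap has drift - lambda W with lambda = 2/N. The factor
    (4N)^-1 turns the double sum into the conditional mean of (W' - W)^2 divided by 2 lambda, so its
    expectation is the second moment of W. *)
Definition swap_var (A : asg) : R :=
  (4 * N%:R)^-1 * \sum_i \sum_j swap_diff i j A ^+ 2.

Lemma linstat_swap i j A : linstat (swap i j A) = linstat A + swap_diff i j A.
Proof.
have [->|ij] := eqVneq i j; first by rewrite swap_id /swap_diff; ring.
rewrite /linstat (bigD1 i) // (bigD1 j) 1?eq_sym //=.
rewrite [in RHS](bigD1 i) // [in RHS](bigD1 j) 1?eq_sym //=.
rewrite (eq_bigr (fun k => c k (A k))); last first.
  by move=> k /andP[ki kj]; rewrite ffunE tpermD // eq_sym.
rewrite !ffunE tpermL tpermR /swap_diff; ring.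
Qed.

Lemma swap_diff_swap i j A : swap_diff i j (swap i j A) = - swap_diff i j A.
Proof. by rewrite /swap_diff !ffunE tpermL tpermR; ring. Qed.

(** The exact linear regression identity: centering kills the crossed sums, and the two diagonal
    ones each contribute - N W. *)
Lemma sum_swap_diff A : (forall z, \sum_i c i z = 0) ->
  \sum_i \sum_j swap_diff i j A = - (2 * N%:R) * linstat A.
Proof.
move=> c0.
rewrite (eq_bigr (fun i => \sum_j c i (A j) + \sum_j c j (A i)
   - N%:R * c i (A i) - linstat A)); last first.
  move=> i _; rewrite /swap_diff !big_split /= !sumrN sumr_const card_ord.
  by rewrite -[c i (A i) *+ N]mulr_natl.
have h1 : \sum_i \sum_j c i (A j) = 0.
  by rewrite exchange_big big1 // => j _; apply: c0.
have h2 : \sum_i \sum_j c j (A i) = 0 by rewrite big1 // => i _; apply: c0.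
rewrite !big_split /= !sumrN h1 h2.
by rewrite sumr_const card_ord -big_distrr /= -[linstat A *+ N]mulr_natl /linstat; ring.
Qed.

Hypothesis N_gt0 : (0 < N)%N.

(** The increment changes sign under its own swap while the law is invariant, so the sum of d_ij
    G(A') has the opposite expectation to that of d_ij G(A), which the regression identity evaluates
    as -2N E[W G]. *)
Lemma exchangeable_pair (G : asg -> R) : (forall z, \sum_i c i z = 0) ->
  Ex (fun A => linstat A * G A) =
  (4 * N%:R)^-1 * Ex (fun A => \sum_i \sum_j swap_diff i j A * (G (swap i j A) - G A)).
Proof.
move=> c0.
have N0 : (N%:R : R) != 0 by rewrite pnatr_eq0 -lt0n.
have e1 : Ex (fun A => \sum_i \sum_j swap_diff i j A * G (swap i j A)) =
          - Ex (fun A => \sum_i \sum_j swap_diff i j A * G A).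
  rewrite !Ex_sum -sumrN; apply: eq_bigr => i _.
  rewrite !Ex_sum -sumrN; apply: eq_bigr => j _.
  rewrite -ExN -(Ex_swap Nz i j (fun A => - (swap_diff i j A * G A))) /=.
  by apply: eq_Ex => A _; rewrite swap_diff_swap mulNr opprK.
have e2 : Ex (fun A => \sum_i \sum_j swap_diff i j A * G A) =
          - (2 * N%:R) * Ex (fun A => linstat A * G A).
  rewrite -ExZ; apply: eq_Ex => A _.
  rewrite mulrA -sum_swap_diff // big_distrl /=; apply: eq_bigr => i _.
  by rewrite big_distrl.
rewrite [X in _ = _ * X](eq_Ex (G := fun A => \sum_i \sum_j swap_diff i j A * G (swap i j A)
   - \sum_i \sum_j swap_diff i j A * G A)); last first.
  move=> A _; rewrite -sumrB; apply: eq_bigr => i _.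
  by rewrite -sumrB; apply: eq_bigr => j _; rewrite mulrBr.
by rewrite ExB e1 e2; field.
Qed.

Lemma Ex_linstat_sq : (forall z, \sum_i c i z = 0) ->
  Ex (fun A => linstat A ^+ 2) = Ex swap_var.
Proof.
move=> c0; rewrite (eq_Ex (G := fun A => linstat A * linstat A)) //.
rewrite exchangeable_pair // -ExZ; apply: eq_Ex => A _.
congr (_ * _); apply: eq_bigr => i _; apply: eq_bigr => j _.
by rewrite linstat_swap addrAC subrr add0r.
Qed.

Variable k : R.
Hypothesis c_le : forall i z, `|c i z| <= k.

Lemma swap_diff_le i j A : `|swap_diff i j A| <= 4 * k.
Proof.
rewrite /swap_diff.
have h1 := c_le i (A j); have h2 := c_le j (A i).
have h3 := c_le i (A i); have h4 := c_le j (A j).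
move: h1 h2 h3 h4; rewrite !ler_norml => /andP[? ?] /andP[? ?] /andP[? ?] /andP[? ?].
by apply/andP; split; lra.
Qed.

Lemma swap_diff_sq_le i j A : swap_diff i j A ^+ 2 <= 16 * k ^+ 2.
Proof.
have := swap_diff_le i j A; rewrite ler_norml => /andP[h1 h2].
by nra.
Qed.

Lemma linstat_swap_lip : swap_lip Nz (4 * k) linstat.
Proof.
move=> A i j _; rewrite linstat_swap addrAC subrr add0r.
exact: swap_diff_le.
Qed.

Lemma swap_var_ge0 A : 0 <= swap_var A.
Proof.
rewrite mulr_ge0 ?invr_ge0 ?mulr_ge0 ?ler0n //.
by apply: sumr_ge0 => i _; apply: sumr_ge0 => j _; rewrite sqr_ge0.
Qed.

Lemma swap_var_le A : swap_var A <= 4 * N%:R * k ^+ 2.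
Proof.
have N0 : (0 : R) < N%:R by rewrite ltr0n.
rewrite /swap_var ler_pdivrMl ?mulr_gt0 //.
have -> : 4 * N%:R * (4 * N%:R * k ^+ 2) = \sum_(i < N) \sum_(j < N) (16 * k ^+ 2).
  rewrite sumr_const card_ord sumr_const card_ord -mulrnA -[RHS]mulr_natl natrM; ring.
by apply: ler_sum => i _; apply: ler_sum => j _; apply: swap_diff_sq_le.
Qed.

Lemma swap_var_swap_lip : swap_lip Nz (16 * k ^+ 2) swap_var.
Proof.
move=> A i j _.
have N0 : (0 : R) < N%:R by rewrite ltr0n.
rewrite /swap_var -mulrBr normrM ger0_norm ?invr_ge0 ?mulr_ge0 ?ler0n //.
rewrite ler_pdivrMl ?mulr_gt0 // -sumrB.
(* Only increments with an index in {i, j} change, each square by at most 16 k^2. [P x + P y]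
   dominates the indicator of these pairs and sums to 4N, which the normalization cancels. *)
pose P (x : 'I_N) : R := (x == i)%:R + (x == j)%:R.
have P0 x : 0 <= P x by rewrite addr_ge0.
have sumP : \sum_x P x = 2.
  rewrite big_split /= (bigD1 i) //= eqxx big1 ?addr0; last first.
    by move=> x /negbTE ->.
  rewrite (bigD1 j) //= eqxx big1 ?addr0 -?natrD //.
  by move=> x /negbTE ->.
have key x y : `|swap_diff x y (swap i j A) ^+ 2 - swap_diff x y A ^+ 2|
      <= 16 * k ^+ 2 * (P x + P y).
  have [H|] := boolP [|| x == i, x == j, y == i | y == j].
    apply: le_trans (_ : 16 * k ^+ 2 <= _).
      have h1 := swap_diff_sq_le x y A; have h2 := swap_diff_sq_le x y (swap i j A).
      have h3 := sqr_ge0 (swap_diff x y A).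
      have h4 := sqr_ge0 (swap_diff x y (swap i j A)).
      by rewrite ler_norml; apply/andP; split; lra.
    have hP : 1 <= P x + P y.
      have p (q : bool) : (0 : R) <= q%:R by exact: ler0n.
      have p1 := p (x == i); have p2 := p (x == j).
      have p3 := p (y == i); have p4 := p (y == j).
      have q1 (q : bool) : q -> (1 : R) <= q%:R by move=> ->.
      by rewrite /P; case/or4P: H => /q1 H; lra.
    by have := sqr_ge0 k; nra.
  rewrite !negb_or => /and4P[xi xj yi yj].
  rewrite [X in X ^+ 2 - _](_ : _ = swap_diff x y A); last first.
    by rewrite /swap_diff !ffunE !tpermD // eq_sym.
  have h1 := sqr_ge0 k; have h2 := P0 x; have h3 := P0 y.
  by rewrite subrr normr0; apply: mulr_ge0; lra.
apply: (le_trans (ler_norm_sum _ _ _)).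
apply: le_trans (_ : \sum_(x < N) \sum_(y < N) 16 * k ^+ 2 * (P x + P y) <= _).
  apply: ler_sum => x _; rewrite -sumrB.
  by apply: (le_trans (ler_norm_sum _ _ _)); apply: ler_sum.
rewrite (eq_bigr (fun x => 16 * k ^+ 2 * (N%:R * P x + 2))); last first.
  move=> x _; rewrite -big_distrr /= big_split /= sumP sumr_const card_ord.
  by rewrite -[P x *+ N]mulr_natl.
rewrite -big_distrr /= big_split /= -big_distrr /= sumP sumr_const card_ord.
by rewrite -[2 *+ N]mulr_natl le_eqVlt; apply/orP; left; apply/eqP; ring.
Qed.

End ExchangeablePair.

(** * Linear statistics and exchangeable pairs *)

Section LinearStatistic.
Context {R : realType} {K N : nat} (Nz : trt K -> nat).
Local Notation asg := {ffun 'I_N -> trt K}.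
Local Notation Omega := (@assignments K N Nz).
Local Notation Ex := (@Ex R K N Nz).
Hypothesis Nz_sum : (\sum_(z : trt K) Nz z)%N = N.
Hypothesis N_gt0 : (0 < N)%N.
Variable c : 'I_N -> trt K -> R.
Hypothesis c0 : forall z, \sum_i c i z = 0.
Local Notation W := (linstat c).
Local Notation V := (swap_var c).

Lemma Ex_linstat : Ex W = 0.
Proof.
rewrite -[LHS](@eq_Ex R K N Nz (fun A => W A * 1)); last by move=> A _; rewrite mulr1.
rewrite exchangeable_pair // (@eq_Ex R K N Nz _ (fun=> 0)); last first.
  by move=> A _; rewrite big1 // => i _; rewrite big1 // => j _; rewrite subrr mulr0.
by rewrite (Ex_cst Nz_sum) mulr0.
Qed.

(** Apply the pair identity to G = exp(s W) and bound the difference of exponentials by the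
    trapezoid rule; swap invariance then identifies the two endpoint terms. *)
Lemma Ex_linstat_expR_le s : 0 <= s ->
  Ex (fun A => W A * expR (s * W A)) <= s * Ex (fun A => V A * expR (s * W A)).
Proof.
move=> s0; rewrite exchangeable_pair //.
have N0 : (0 : R) < N%:R by rewrite ltr0n.
rewrite ler_pdivrMl ?mulr_gt0 //.
pose d i j := swap_diff c i j.
apply: le_trans (_ : Ex (fun A => \sum_i \sum_j s / 2 *
    (d i j A ^+ 2 * expR (s * W (swap i j A)) + d i j A ^+ 2 * expR (s * W A))) <= _).
  apply: le_Ex => A _; apply: ler_sum => i _; apply: ler_sum => j _.
  rewrite linstat_swap -/(d i j A) [s * (_ + d _ _ _)]mulrDr.
  have [->|sn0] := eqVneq s 0; first by rewrite !mul0r addr0 subrr mulr0.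
  have sp : 0 < s by rewrite lt_def sn0.
  have := expR_diff_le (s * W A) (s * d i j A) => H.
  by rewrite -(ler_pM2l sp); lra.
rewrite Ex_sum (eq_bigr (fun i => s * \sum_j Ex (fun A => d i j A ^+ 2 * expR (s * W A)))); last first.
  move=> i _; rewrite Ex_sum big_distrr /=; apply: eq_bigr => j _.
  rewrite ExZ ExD -[X in X + _](Ex_swap Nz i j) /=.
  rewrite (@eq_Ex R K N Nz _ (fun A => d i j A ^+ 2 * expR (s * W A))); last first.
    by move=> A _; rewrite swapK /d swap_diff_swap sqrrN.
  by field.
rewrite -big_distrr /= mulrCA ler_wpM2l //.
rewrite -ExZ le_eqVlt; apply/orP; left; apply/eqP.
under eq_bigr do rewrite -Ex_sum.
rewrite -Ex_sum; apply: eq_Ex => A _; rewrite /swap_var.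
rewrite !mulrA mulfV ?mul1r ?gt_eqF ?mulr_gt0 // big_distrl /=.
by apply: eq_bigr => i _; rewrite big_distrl.
Qed.

Variable k : R.
Hypothesis c_le : forall i z, `|c i z| <= k.
Hypothesis k_gt0 : 0 < k.
Hypothesis W2_le1 : Ex (fun A => W A ^+ 2) <= 1.

(** Lets an additive error z in the differential inequality be absorbed as z m(s). *)
Lemma Ex_expR_ge1 s : 1 <= Ex (fun A => expR (s * W A)).
Proof.
apply: le_trans (_ : Ex (fun A => 1 + s * W A) <= _).
  by rewrite ExD ExZ Ex_linstat mulr0 addr0 (Ex_cst Nz_sum).
by apply: le_Ex => A _; exact: expR_ge1Dx.
Qed.

(* exponential tilting: replaces the random conditional variance V by its mean
   up to [z], at the cost of an exponentially small term *)
Lemma Ex_swap_var_expR_le s z : 0 <= s -> 0 < z ->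
  Ex (fun A => V A * expR (s * W A)) <= (1 + z) * Ex (fun A => expR (s * W A)) +
   4 * N%:R * k ^+ 2 * expR (256 * N%:R * s ^+ 2 * k ^+ 2 - z ^+ 2 / (128 * 128 * N%:R * k ^+ 4)).
Proof.
move=> s0 z0.
have N0 : (0 : R) < N%:R by rewrite ltr0n.
have den0 : 0 < 64 * 128 * N%:R * k ^+ 4 by rewrite !mulr_gt0 ?exprn_gt0.
have V1 : Ex V <= 1 by rewrite -Ex_linstat_sq.
have V0 : 0 <= Ex V by apply: Ex_ge0 => A _; exact: swap_var_ge0.
(* The Lipschitz constant of [F] gives an exponent at most 4096 N be^2 k^4 + 256 N s^2 k^2, from
   which be z is subtracted; this [be] is the optimum and leaves - be z / 2. *)
pose be := z / (64 * 128 * N%:R * k ^+ 4).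
have be0 : 0 < be by rewrite divr_gt0.
pose F A := be * V A + s * W A.
have Fl : swap_lip Nz (be * (16 * k ^+ 2) + s * (4 * k)) F.
  move=> A i j HA; rewrite /F.
  rewrite (_ : _ - _ = be * (V (swap i j A) - V A) + s * (W (swap i j A) - W A)); last by ring.
  apply: (le_trans (ler_normD _ _)); rewrite (normrM be) (normrM s) (gtr0_norm be0) (ger0_norm s0).
  apply: lerD; rewrite ler_wpM2l //; first exact: ltW.
    by apply: (@swap_var_swap_lip R K N Nz) => //.
  by apply: (@linstat_swap_lip R K N Nz) => //.
have EF : Ex F = be * Ex V by rewrite ExD !ExZ Ex_linstat mulr0 addr0.
have M := swap_lip_mgf Nz_sum 1 Fl; rewrite EF in M.
have pt A : V A * expR (s * W A) <= (1 + z) * expR (s * W A) +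
    4 * N%:R * k ^+ 2 * expR (- (be * z)) * expR (1 * (F A - be * Ex V)).
  have e0 := expR_gt0 (s * W A).
  have -> : 1 * (F A - be * Ex V) = be * (V A - Ex V) + s * W A by rewrite /F; ring.
  rewrite -[4 * _ * _ * _ * _]mulrA -expRD.
  have -> : - (be * z) + (be * (V A - Ex V) + s * W A) = be * (V A - Ex V - z) + s * W A by ring.
  rewrite expRD [_ * (_ * expR _)]mulrA -mulrDl ler_pM2r //.
  have [Vs|Vl] := leP (V A - Ex V) z.
    apply: le_trans (_ : 1 + z <= _); first by lra.
    by rewrite lerDl mulr_ge0 ?expR_ge0 // !mulr_ge0 ?sqr_ge0 // ltW.
  have h1 : 1 <= expR (be * (V A - Ex V - z)).
    by rewrite -expR0 ler_expR; apply: mulr_ge0; [exact: ltW | rewrite subr_ge0 ltW].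
  have h2 : V A <= 4 * N%:R * k ^+ 2 by apply: swap_var_le.
  have h3 : 0 <= 4 * N%:R * k ^+ 2 by rewrite !mulr_ge0 ?sqr_ge0 // ltW.
  have h4 := ler_wpM2l h3 h1; rewrite mulr1 in h4.
  by apply: (le_trans h2); apply: (le_trans h4); rewrite lerDr; lra.
apply: (le_trans (le_Ex (fun A _ => pt A))).
rewrite ExD ExZ ExZ lerD2l -mulrA ler_wpM2l //.
  by rewrite !mulr_ge0 ?sqr_ge0 // ltW.
apply: (le_trans (ler_wpM2l (expR_ge0 _) M)).
rewrite -expRD ler_expR.
have h : (be * (16 * k ^+ 2) + s * (4 * k)) ^+ 2 <= 2 * (be * (16 * k ^+ 2)) ^+ 2 + 2 * (s * (4 * k)) ^+ 2.
  by have := sqr_ge0 (be * (16 * k ^+ 2) - s * (4 * k)); lra.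
rewrite mul1r; have := ler_wpM2l (ltW N0) h.
have -> : z ^+ 2 / (128 * 128 * N%:R * k ^+ 4) = be * z / 2.
  by rewrite /be; field; rewrite !gt_eqF.
have : 64 * 64 * N%:R * be ^+ 2 * k ^+ 4 = be * z / 2.
  by rewrite /be; field; rewrite !gt_eqF.
by lra.
Qed.

(** Gronwall for m'(s) <= s (1 + 2z) m(s), m(0) = 1. One z comes from the tilted bound on V, the
    other from its additive error, absorbed through m >= 1. That error increases with s, so the
    hypothesis at the endpoint t covers all of [0, t]. *)
Lemma linstat_mgf_le z t : 0 < z -> 0 <= t ->
  4 * N%:R * k ^+ 2 * expR (256 * N%:R * t ^+ 2 * k ^+ 2 - z ^+ 2 / (128 * 128 * N%:R * k ^+ 4)) <= z ->
  Ex (fun A => expR (t * W A)) <= expR (t ^+ 2 / 2 * (1 + 2 * z)).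
Proof.
move=> z0 t0 H.
have N0 : (0 : R) < N%:R by rewrite ltr0n.
pose m s := Ex (fun A => expR (s * W A)).
pose dm s := Ex (fun A => expR (s * W A) * W A).
have md s : is_derive s (1 : R) m (dm s).
  have H1 A : is_derive s (1 : R) (fun s => expR (s * W A)) (expR (s * W A) * W A).
    apply: (is_derive_eq (is_derive1_expR (is_derive1_mul (is_derive1_id s) (is_derive1_cst s (W A))))).
    ring.
  have := is_derive1_mul (is_derive1_cst s (#|Omega|%:R^-1))
     (@is_derive1_sum R _ (index_enum _) (fun A => A \in Omega) _ _ s H1).
  by move/is_derive_eq; apply; rewrite mul0r add0r.
pose q s : R := - (s * s * ((1 + 2 * z) / 2)).
pose dq s : R := - (s * (1 + 2 * z)).
have qd s : is_derive s (1 : R) q (dq s).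
  have h := is_derive1_opp (is_derive1_mul (is_derive1_mul (is_derive1_id s) (is_derive1_id s)) (is_derive1_cst s ((1 + 2 * z) / 2))).
  by apply: (is_derive_eq h); rewrite /dq; field.
have fd s := is_derive1_opp (is_derive1_mul (md s) (is_derive1_expR (qd s))).
have D : (forall s, 0 <= s <= t -> 0 <= - (dm s * expR (q s) + m s * (expR (q s) * dq s))) ->
    - (m 0 * expR (q 0)) <= - (m t * expR (q t)) := derive_ge0_le fd t0.
have q0 : q 0 = 0 by rewrite /q !mul0r oppr0.
have m0 : m 0 = 1.
  by rewrite /m (@eq_Ex R K N Nz _ (fun=> 1)) ?(Ex_cst Nz_sum) // => A _; rewrite mul0r expR0.
rewrite m0 q0 expR0 mulr1 lerN2 in D.
have : m t * expR (q t) <= 1.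
  apply: D => s /andP[s0 st].
  have e0 := expR_gt0 (q s).
  suff h : dm s <= s * (1 + 2 * z) * m s.
    by have := ler_wpM2r (ltW e0) h; rewrite /dq; lra.
  have -> : dm s = Ex (fun A => W A * expR (s * W A)).
    by apply: eq_Ex => A _; rewrite mulrC.
  apply: (le_trans (Ex_linstat_expR_le s0)); rewrite -mulrA ler_wpM2l //.
  apply: (le_trans (Ex_swap_var_expR_le s0 z0)).
  have m1 := Ex_expR_ge1 s; rewrite -/(m s) in m1 *.
  have h : 4 * N%:R * k ^+ 2 * expR (256 * N%:R * s ^+ 2 * k ^+ 2 - z ^+ 2 / (128 * 128 * N%:R * k ^+ 4)) <= z.
    have p : 0 <= 256 * N%:R * k ^+ 2 by rewrite !mulr_ge0 ?sqr_ge0 // ltW.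
    have st2 : s ^+ 2 <= t ^+ 2 by rewrite lerXn2r ?nnegrE // (le_trans s0).
    apply: le_trans H; apply: ler_wpM2l; first by rewrite !mulr_ge0 ?sqr_ge0 // ltW.
    by rewrite ler_expR lerD2r; have := ler_wpM2l p st2; lra.
  by have := ler_wpM2l (ltW z0) m1; lra.
have e0 := expR_gt0 (q t).
rewrite -(ler_pdivlMr _ _ e0) mul1r -expRN /q opprK => h.
by apply: (le_trans h); rewrite ler_expR le_eqVlt; apply/orP; left; apply/eqP; field.
Qed.

(* Stein's identity for the exchangeable pair (A, swap i j A) *)
Lemma stein_bound (f df : R -> R) (B L : R) :
  (forall x y, `|f y - f x - (y - x) * df x| <= L * (y - x) ^+ 2) ->
  (forall x, `|df x| <= B) -> Ex (fun A => W A ^+ 2) = 1 ->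
  `|Ex (fun A => df (W A) - W A * f (W A))|
     <= B * Ex (fun A => `|V A - Ex V|) + L * (4 * k).
Proof.
move=> fL dfB W21.
have N0 : (0 : R) < N%:R by rewrite ltr0n.
have L0 : 0 <= L by have := le_trans (normr_ge0 _) (fL 0 1); rewrite subr0 expr1n mulr1.
have V1 : Ex V = 1 by rewrite -Ex_linstat_sq.
pose r A i j := f (W A + swap_diff c i j A) - f (W A) - swap_diff c i j A * df (W A).
have rL A i j : `|swap_diff c i j A * r A i j| <= L * (4 * k) * swap_diff c i j A ^+ 2.
  have h := fL (W A) (W A + swap_diff c i j A).
  have e : W A + swap_diff c i j A - W A = swap_diff c i j A by ring.
  rewrite e in h; rewrite normrM mulrC -mulrA [4 * k * _]mulrC mulrA.
  by apply: ler_pM => //; apply: (swap_diff_le c_le).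
have e : Ex (fun A => W A * f (W A)) = Ex (fun A => V A * df (W A)) +
    (4 * N%:R)^-1 * Ex (fun A => \sum_i \sum_j swap_diff c i j A * r A i j).
  rewrite exchangeable_pair // -!ExZ -ExD; apply: eq_Ex => A _.
  rewrite /swap_var -[_^-1 * _ * _]mulrA -mulrDr; congr (_ * _).
  rewrite big_distrl -big_split /=; apply: eq_bigr => i _.
  rewrite big_distrl -big_split /=; apply: eq_bigr => j _.
  by rewrite linstat_swap /r; ring.
rewrite ExB e opprD addrA -ExB.
apply: (le_trans (ler_normB _ _)); apply: lerD.
  apply: (le_trans (ler_norm_Ex _ _)); rewrite -ExZ; apply: le_Ex => A _.
  rewrite (_ : _ - _ = df (W A) * (1 - V A)); last by ring.
  by rewrite normrM V1 distrC ler_wpM2r.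
rewrite normrM ger0_norm ?invr_ge0 ?mulr_ge0 ?ler0n //.
rewrite ler_pdivrMl ?mulr_gt0 //.
apply: (le_trans (ler_norm_Ex _ _)).
apply: (@le_trans _ _ (Ex (fun A => L * (4 * k) * (4 * N%:R * V A)))); last first.
  by rewrite (ExZ _ (L * (4 * k))) (ExZ _ (4 * N%:R)) V1; lra.
apply: le_Ex => A _.
rewrite /swap_var mulVKf ?gt_eqF ?mulr_gt0 // big_distrr /=.
apply: (le_trans (ler_norm_sum _ _ _)); apply: ler_sum => i _.
rewrite big_distrr /=.
by apply: (le_trans (ler_norm_sum _ _ _)); apply: ler_sum.
Qed.

End LinearStatistic.

(** * Moments of the estimators *)

Section Moments.
Context {R : realType} {K N : nat} (Nz : trt K -> nat).
Local Notation asg := {ffun 'I_N -> trt K}.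
Local Notation Omega := (@assignments K N Nz).
Local Notation Ex := (@Ex R K N Nz).
Hypothesis Nz_sum : (\sum_(z : trt K) Nz z)%N = N.
Hypothesis N_gt1 : (1 < N)%N.

Let N0 : (0 : R) < N%:R. Proof. by rewrite ltr0n ltnW. Qed.
Let N1 : (0 : R) < N%:R - 1. Proof. by rewrite subr_gt0 ltr1n. Qed.

Lemma sum_indicator (A : asg) z : A \in Omega -> \sum_i ((A i == z)%:R : R) = (Nz z)%:R.
Proof.
move=> /assignmentsP /(_ z) <-; rewrite -sum1_card natr_sum [RHS]big_mkcond /=.
by apply: eq_bigr => i _; rewrite inE; case: eqP.
Qed.

Lemma Ex_indicator i z : Ex (fun A => (A i == z)%:R) = (Nz z)%:R / N%:R.
Proof.
have sym j : Ex (fun A => (A j == z)%:R) = Ex (fun A => (A i == z)%:R).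
  rewrite -(Ex_swap Nz i j (fun A => (A i == z)%:R)).
  by apply: eq_Ex => A _; rewrite ffunE tpermL.
have := Ex_sum Nz (index_enum 'I_N) xpredT (fun j A => ((A j == z)%:R : R)).
rewrite (eq_Ex (G := fun=> (Nz z)%:R)); last by move=> A; exact: sum_indicator.
rewrite (Ex_cst Nz_sum) (eq_bigr _ (fun j _ => sym j)) sumr_const card_ord => ->.
by rewrite -[_ *+ N]mulr_natr mulfK // gt_eqF.
Qed.

Lemma Ex_indicator2 i j z z' : i != j ->
  Ex (fun A => (A i == z)%:R * (A j == z')%:R) =
  (Nz z)%:R * ((Nz z')%:R - (z == z')%:R) / (N%:R * (N%:R - 1)).
Proof.
move=> ij.
pose p l : R := Ex (fun A => (A i == z)%:R * (A l == z')%:R).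
have sym l : l != i -> p l = p j.
  move=> li; rewrite /p -(Ex_swap Nz j l (fun A => (A i == z)%:R * (A j == z')%:R)).
  by apply: eq_Ex => A _; rewrite !ffunE tpermL tpermD // eq_sym.
have e1 : \sum_(l | l != i) p l = (N%:R - 1) * p j.
  rewrite (eq_bigr _ sym) sumr_const cardC1 card_ord -[_ *+ _]mulr_natl.
  by congr (_ * _); rewrite -[in RHS](prednK (ltnW N_gt1)) -natr1 addrK.
have e2 : \sum_(l | l != i) p l = Ex (fun A => (A i == z)%:R * ((Nz z')%:R - (z == z')%:R)).
  rewrite -Ex_sum; apply: eq_Ex => A HA; rewrite -big_distrr /=.
  have [Ai|_] := eqVneq (A i) z; last by rewrite !mul0r.
  by rewrite -(sum_indicator z' HA) [in RHS](bigD1 i) //= Ai addrAC subrr add0r.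
have N0' : N%:R != 0 :> R by rewrite gt_eqF.
have N1' : N%:R - 1 != 0 :> R by rewrite gt_eqF.
move: e2; rewrite e1 ExZr Ex_indicator -/(p j) => e2.
apply: (mulfI N1'); rewrite e2; field.
by rewrite N1' N0'.
Qed.

Lemma linstatE (c : 'I_N -> trt K -> R) A :
  linstat c A = \sum_i \sum_z (A i == z)%:R * c i z.
Proof.
apply: eq_bigr => i _; rewrite (bigD1 (A i)) //= eqxx mul1r big1 ?addr0 //.
by move=> z /negbTE; rewrite eq_sym => ->; rewrite mul0r.
Qed.

Lemma Ex_linstat_mean (c : 'I_N -> trt K -> R) :
  Ex (linstat c) = \sum_z (Nz z)%:R / N%:R * \sum_i c i z.
Proof.
rewrite (eq_Ex (fun A _ => linstatE c A)) Ex_sum.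
under eq_bigr do rewrite Ex_sum.
rewrite exchange_big /=.
apply: eq_bigr => z _; rewrite big_distrr /=; apply: eq_bigr => i _.
by rewrite ExZr Ex_indicator.
Qed.

Lemma Ex_linstat_sqE (c : 'I_N -> trt K -> R) : (forall z, \sum_i c i z = 0) ->
  Ex (fun A => linstat c A ^+ 2) = \sum_z (Nz z)%:R / N%:R * (\sum_i c i z ^+ 2)
   - \sum_z \sum_z' (Nz z)%:R * ((Nz z')%:R - (z == z')%:R) / (N%:R * (N%:R - 1))
      * (\sum_i c i z * c i z').
Proof.
move=> c0.
pose d i (A : asg) : R := \sum_z (A i == z)%:R * c i z.
have dE i A : d i A = c i (A i).
  rewrite /d (bigD1 (A i)) //= eqxx mul1r big1 ?addr0 //.
  by move=> z /negbTE; rewrite eq_sym => ->; rewrite mul0r.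
have e0 A : linstat c A ^+ 2 = linstat (fun i z => c i z ^+ 2) A
     + \sum_i \sum_(j | j != i) c i (A i) * c j (A j).
  rewrite /linstat expr2 big_distrl -big_split /=; apply: eq_bigr => i _.
  by rewrite big_distrr /= (bigD1 i) //= expr2.
rewrite (eq_Ex (fun A _ => e0 A)) ExD Ex_linstat_mean; congr (_ + _).
have e1 i j : j != i -> Ex (fun A => c i (A i) * c j (A j)) =
   \sum_z \sum_z' (Nz z)%:R * ((Nz z')%:R - (z == z')%:R) / (N%:R * (N%:R - 1)) * (c i z * c j z').
  move=> ji; rewrite (eq_Ex (G := fun A => \sum_z \sum_z' c i z * c j z' * ((A i == z)%:R * (A j == z')%:R))); last first.
    move=> A _; rewrite -!dE /d big_distrl /=; apply: eq_bigr => z _.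
    by rewrite big_distrr /=; apply: eq_bigr => z' _; ring.
  rewrite Ex_sum; apply: eq_bigr => z _; rewrite Ex_sum; apply: eq_bigr => z' _.
  by rewrite ExZ Ex_indicator2 1?eq_sym // mulrC.
rewrite Ex_sum (eq_bigr (fun i => \sum_(j | j != i) \sum_z \sum_z' (Nz z)%:R * ((Nz z')%:R - (z == z')%:R) / (N%:R * (N%:R - 1)) * (c i z * c j z'))); last first.
  by move=> i _; rewrite Ex_sum; apply: eq_bigr => j ji; rewrite e1.
rewrite -sumrN.
under eq_bigr do rewrite exchange_big /=.
rewrite exchange_big /=; apply: eq_bigr => z _.
rewrite -sumrN.
under eq_bigr do rewrite exchange_big /=.
rewrite exchange_big /=; apply: eq_bigr => z' _.
rewrite -mulrN; under eq_bigr do rewrite -big_distrr /=.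
rewrite -big_distrr /=; congr (_ * _).
rewrite -sumrN; apply: eq_bigr => i _.
rewrite -big_distrr /= -mulrN; congr (_ * _).
(* Centering turns the sum over j != i into minus the term at i, so the double sum over units
   becomes a single one. *)
have e2 : c i z' + \sum_(j | j != i) c j z' = 0 by have := c0 z'; rewrite (bigD1 i).
by apply/eqP; rewrite -subr_eq0 opprK addrC e2.
Qed.

End Moments.

Section Estimators.
Context {R : realType} {K N : nat} (Nz : trt K -> nat) (Y : 'I_N -> trt K -> R).
Local Notation asg := {ffun 'I_N -> trt K}.
Local Notation Omega := (@assignments K N Nz).
Local Notation Ex := (@Ex R K N Nz).
Hypothesis Nz_sum : (\sum_(z : trt K) Nz z)%N = N.
Hypothesis N_gt1 : (1 < N)%N.
Hypothesis Nz_gt1 : forall z, (1 < Nz z)%N.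

Let N0 : (0 : R) < N%:R. Proof. by rewrite ltr0n ltnW. Qed.
Let N1 : (0 : R) < N%:R - 1. Proof. by rewrite subr_gt0 ltr1n. Qed.
Let Nz0 z : (0 : R) < (Nz z)%:R. Proof. by rewrite ltr0n ltnW. Qed.
Let Nz1 z : (0 : R) < (Nz z)%:R - 1. Proof. by rewrite subr_gt0 ltr1n. Qed.

Definition resid i z : R := Y i z - Ybar Y z.

Lemma sum_resid z : \sum_i resid i z = 0.
Proof.
rewrite big_split /= sumrN sumr_const card_ord -[_ *+ N]mulr_natl /Ybar.
by rewrite mulrA mulfV ?mul1r ?subrr // gt_eqF.
Qed.

Lemma SmatE z z' : \sum_i resid i z * resid i z' = (N%:R - 1) * Smat Y z z'.
Proof. by rewrite /Smat mulrA mulfV ?mul1r // gt_eqF. Qed.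

Definition coefs (u : trt K -> R) i z : R := u z / (Nz z)%:R * resid i z.

Lemma sum_coefs u z : \sum_i coefs u i z = 0.
Proof. by rewrite -big_distrr /= sum_resid mulr0. Qed.

Lemma linstat_coefs u A : A \in Omega ->
  linstat (coefs u) A = dotv u (Yhat Y Nz A) - dotv u (Ybar Y).
Proof.
move=> HA; rewrite linstatE exchange_big /= /dotv -sumrB; apply: eq_bigr => z _.
rewrite /Yhat [in RHS]big_mkcond /=.
transitivity (u z / (Nz z)%:R * \sum_i ((A i == z)%:R * Y i z - (A i == z)%:R * Ybar Y z)).
  by rewrite big_distrr /=; apply: eq_bigr => i _; rewrite /coefs /resid; ring.
rewrite sumrB -big_distrl /= (sum_indicator z HA).
rewrite (eq_bigr (fun i => if A i == z then Y i z else 0)); last first.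
  by move=> i _; case: eqP => _; rewrite ?mul1r ?mul0r.
by field; rewrite gt_eqF.
Qed.

(** Neyman's formula: the second moments of the centered arm means give V = D - S/N. *)
Lemma Ex_linstat_coefs_sq u : Ex (fun A => linstat (coefs u) A ^+ 2) = qform (Vmat Y Nz) u.
Proof.
rewrite (Ex_linstat_sqE Nz_sum N_gt1) ?[RHS]/qform; last exact: sum_coefs.
rewrite -sumrB; apply: eq_bigr => z _.
have e2 z' : \sum_i coefs u i z * coefs u i z' =
    u z / (Nz z)%:R * (u z' / (Nz z')%:R) * ((N%:R - 1) * Smat Y z z').
  by rewrite -SmatE big_distrr /=; apply: eq_bigr => i _; rewrite /coefs; ring.
have e1 : \sum_i coefs u i z ^+ 2 = (u z / (Nz z)%:R) ^+ 2 * ((N%:R - 1) * Smat Y z z).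
  by rewrite -SmatE big_distrr /=; apply: eq_bigr => i _; rewrite /coefs; ring.
have N0' : N%:R != 0 :> R by rewrite gt_eqF.
have N1' : N%:R - 1 != 0 :> R by rewrite gt_eqF.
have Nz0' z' : (Nz z')%:R != 0 :> R by rewrite gt_eqF.
rewrite e1 (bigD1 z) //= [in RHS](bigD1 z) //= opprD addrA; congr (_ + _).
  rewrite e2 /Vmat /Dmat eqxx /=; field.
  by rewrite N0' N1' Nz0'.
rewrite -sumrN; apply: eq_bigr => z' zz'.
rewrite e2 /Vmat /Dmat [z == z']eq_sym (negbTE zz') /=; field.
by rewrite N0' N1' !Nz0'.
Qed.

(** Recentering at the population mean leaves two sums that are linear in the arm indicators, whose
    change under a swap is easy to bound. *)
Lemma ShatE A z : A \in Omega -> Shat Y Nz A z = ((Nz z)%:R - 1)^-1 *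
  (\sum_i (A i == z)%:R * resid i z ^+ 2
    - (Nz z)%:R^-1 * (\sum_i (A i == z)%:R * resid i z) ^+ 2).
Proof.
move=> HA; rewrite /Shat; congr (_ * _).
have Nz0' : (Nz z)%:R != 0 :> R by rewrite gt_eqF.
set s := \sum_i (A i == z)%:R * resid i z.
have sE : s = (Nz z)%:R * (Yhat Y Nz A z - Ybar Y z).
  rewrite /Yhat [in RHS]big_mkcond /= mulrBr mulVKf // -(sum_indicator z HA) big_distrl -sumrB.
  by apply: eq_bigr => i _; rewrite /resid /=; case: (A i == z); rewrite ?mul1r ?mul0r ?subrr.
have dE : Yhat Y Nz A z - Ybar Y z = (Nz z)%:R^-1 * s by rewrite sE mulKf.
transitivity (\sum_i (A i == z)%:R * (resid i z - (Nz z)%:R^-1 * s) ^+ 2).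
  rewrite big_mkcond /=; apply: eq_bigr => i _; rewrite -dE /resid.
  by case: eqP => _; rewrite ?mul1r ?mul0r //; congr (_ ^+ 2); ring.
transitivity (\sum_i ((A i == z)%:R * resid i z ^+ 2 - 2 * ((Nz z)%:R^-1 * s) * ((A i == z)%:R * resid i z)
    + ((Nz z)%:R^-1 * s) ^+ 2 * (A i == z)%:R)).
  by apply: eq_bigr => i _; ring.
rewrite !big_split /= sumrN -!big_distrr /= -/s (sum_indicator z HA).
by field.
Qed.

Lemma Ex_Shat z : Ex (fun A => Shat Y Nz A z) = Smat Y z z.
Proof.
have N0' : N%:R != 0 :> R by rewrite gt_eqF.
have Nz0' : (Nz z)%:R != 0 :> R by rewrite gt_eqF.
have Nz1' : (Nz z)%:R - 1 != 0 :> R by rewrite gt_eqF.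
rewrite (eq_Ex (fun A HA => ShatE z HA)) ExZ ExB ExZ.
have -> : Ex (fun A => \sum_i (A i == z)%:R * resid i z ^+ 2) =
    (Nz z)%:R / N%:R * ((N%:R - 1) * Smat Y z z).
  rewrite Ex_sum -SmatE big_distrr /=; apply: eq_bigr => i _.
  by rewrite ExZr (Ex_indicator Nz_sum).
have -> : Ex (fun A => (\sum_i (A i == z)%:R * resid i z) ^+ 2) =
    (Nz z)%:R ^+ 2 * Vmat Y Nz z z.
  (* With these weights the linear statistic is the total residual of arm z, so its second moment is
     read off from Neyman's formula. *)
  pose u z' : R := (Nz z)%:R * (z' == z)%:R.
  transitivity (Ex (fun A => linstat (coefs u) A ^+ 2)).
    apply: eq_Ex => A _; congr (_ ^+ 2); rewrite linstatE; apply: eq_bigr => i _.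
    rewrite (bigD1 z) //= big1 ?addr0; last first.
      by move=> z' zz'; rewrite /coefs /u (negbTE zz') mulr0 !mul0r mulr0.
    by rewrite /coefs /u eqxx mulr1 mulfV // mul1r.
  rewrite Ex_linstat_coefs_sq /qform (bigD1 z) //= [X in _ + X]big1 ?addr0; last first.
    by move=> z' zz'; rewrite big1 // => z'' _; rewrite /u (negbTE zz') mulr0 !mul0r.
  rewrite (bigD1 z) //= big1 ?addr0; last first.
    by move=> z' zz'; rewrite /u (negbTE zz') !mulr0.
  by rewrite /u eqxx /=; ring.
rewrite /Vmat /Dmat eqxx /=; field.
by rewrite Nz1' N0' Nz0'.
Qed.

Variable k : R.
Hypothesis resid_le : forall i z, `|resid i z| <= k.

Let k0 (i : 'I_N) (z : trt K) : 0 <= k. Proof. exact: le_trans (resid_le i z). Qed.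

Lemma Shat_swap_other (A : asg) i j z : A i != z -> A j != z ->
  Shat Y Nz (swap i j A) z = Shat Y Nz A z.
Proof.
move=> /negbTE Ai /negbTE Aj.
have e l : (swap i j A l == z) = (A l == z).
  by rewrite ffunE; case: tpermP => [->|->|//]; rewrite Ai Aj.
rewrite /Shat /Yhat (eq_bigl _ _ e); congr (_ * _).
by apply: eq_big => [//|l _]; rewrite (eq_bigl _ _ e).
Qed.

(** The indicators change only at i and j: the sum of squares moves by at most 2 k^2 and the squared
    sum divided by N(z) by at most 8 k^2. Since N(z) >= 2, 10 k^2 / (N(z) - 1) <= 20 k^2 / N(z). *)
Lemma Shat_swap_le (A : asg) i j z : A \in Omega ->
  `|Shat Y Nz (swap i j A) z - Shat Y Nz A z| <= 20 * k ^+ 2 / (Nz z)%:R.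
Proof.
move=> HA; have HB : swap i j A \in Omega by rewrite swap_in.
have kk := k0 i z.
rewrite !ShatE //.
pose d l : R := (swap i j A l == z)%:R - (A l == z)%:R.
have dl l : l != i -> l != j -> d l = 0.
  by move=> li lj; rewrite /d ffunE tpermD 1?eq_sym // subrr.
have d1 l : `|d l| <= 1.
  by rewrite /d; do 2 case: (_ == z); rewrite ?subrr ?subr0 ?sub0r ?normrN ?normr0 ?normr1.
have sumd (w : 'I_N -> R) (b : R) : (forall l, `|w l| <= b) -> 0 <= b ->
    `|\sum_l d l * w l| <= 2 * b.
  move=> wb b0; have dw l : `|d l * w l| <= b.
    by rewrite normrM -[b]mul1r; apply: ler_pM.
  rewrite (bigD1 i) //=; apply: (le_trans (ler_normD _ _)).
  have [E|ij] := eqVneq j i.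
    rewrite big1 ?normr0 ?addr0; first by apply: (le_trans (dw i)); lra.
    by move=> l li; rewrite dl ?mul0r // E.
  rewrite (bigD1 j) //= big1 ?addr0; first by have := dw i; have := dw j; lra.
  by move=> l /andP[li lj]; rewrite dl // mul0r.
have dsum w : \sum_l (swap i j A l == z)%:R * w l = \sum_l (A l == z)%:R * w l + \sum_l d l * w l.
  by rewrite -big_split /=; apply: eq_bigr => l _; rewrite /d; ring.
rewrite -mulrBr !dsum.
set s := \sum_l (A l == z)%:R * resid l z.
set e1 := \sum_l d l * resid l z ^+ 2; set e2 := \sum_l d l * resid l z.
have e1b : `|e1| <= 2 * k ^+ 2.
  apply: sumd; last exact: sqr_ge0.
  by move=> l; rewrite normrX lerXn2r ?nnegrE.
have e2b : `|e2| <= 2 * k by apply: sumd.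
have sb : `|s| <= (Nz z)%:R * k.
  rewrite -(sum_indicator z HA) big_distrl /=.
  apply: (le_trans (ler_norm_sum _ _ _)); apply: ler_sum => l _.
  by rewrite normrM ger0_norm // ler_wpM2l.
have m0 := Nz0 z; have m1 := Nz1 z; set m := (Nz z)%:R in sb m0 m1 *.
have m2 : 2 <= m by rewrite ler_nat.
have -> : \sum_l (A l == z)%:R * resid l z ^+ 2 + e1 - m^-1 * (s + e2) ^+ 2
   - (\sum_l (A l == z)%:R * resid l z ^+ 2 - m^-1 * s ^+ 2)
   = e1 - m^-1 * (e2 * (2 * s + e2)) by ring.
have h1 : `|m^-1 * (e2 * (2 * s + e2))| <= 8 * k ^+ 2.
  have mi : `|m^-1| = m^-1 by rewrite ger0_norm // invr_ge0 ltW.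
  rewrite normrM mi ler_pdivrMl // normrM.
  have h : `|2 * s + e2| <= 4 * m * k.
    apply: (le_trans (ler_normD _ _)); rewrite normrM ger0_norm //.
    by have := ler_wpM2r kk m2; lra.
  have := ler_pM (normr_ge0 _) (normr_ge0 _) e2b h; lra.
have mi : `|(m - 1)^-1| = (m - 1)^-1 by rewrite ger0_norm // invr_ge0 ltW.
rewrite normrM mi ler_pdivrMl //.
apply: (le_trans (ler_normB _ _)).
apply: (@le_trans _ _ (10 * k ^+ 2)); first by lra.
rewrite [leRHS](_ : _ = ((m - 1) * (20 * k ^+ 2)) / m); last by ring.
by rewrite ler_pdivlMr //; have := sqr_ge0 k; nra.
Qed.

(** A swap touches at most the two arms of the swapped units, hence twice the constant of one
    arm. *)
Lemma wShat_swap_le (w : trt K -> R) (b : R) : (forall z, `|w z| / (Nz z)%:R <= b) ->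
  swap_lip Nz (40 * k ^+ 2 * b) (fun A => \sum_z w z * Shat Y Nz A z).
Proof.
move=> wb A i j HA; rewrite -sumrB.
pose D z := w z * Shat Y Nz (swap i j A) z - w z * Shat Y Nz A z.
have kk := k0 i (A i).
have Db z : `|D z| <= 20 * k ^+ 2 * b.
  rewrite /D -mulrBr normrM.
  have h := Shat_swap_le i j z HA.
  apply: (le_trans (ler_wpM2l (normr_ge0 _) h)).
  have k2 : 0 <= 20 * k ^+ 2 by rewrite mulr_ge0 ?sqr_ge0.
  by have := ler_wpM2l k2 (wb z); lra.
have b0 : 0 <= 20 * k ^+ 2 * b := le_trans (normr_ge0 _) (Db (A i)).
have D0 z : z != A i -> z != A j -> D z = 0.
  by move=> zi zj; rewrite /D Shat_swap_other 1?eq_sym // subrr.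
rewrite -/(D _) (bigD1 (A i)) //=; apply: (le_trans (ler_normD _ _)).
have [E|ij] := eqVneq (A j) (A i).
  rewrite big1 ?normr0 ?addr0; first by have := Db (A i); rewrite /D; lra.
  by move=> z zi; apply: D0 => //; rewrite E.
rewrite (bigD1 (A j)) //= big1 ?addr0; first by have := Db (A i); have := Db (A j); rewrite /D; lra.
by move=> z /andP[zi zj]; apply: D0.
Qed.

End Estimators.

(** * The Gaussian distribution function *)

Section Gaussian.
Context {R : realType}.
Local Notation mu := (@lebesgue_measure R).
Implicit Types (x y t : R) (w : R -> R).

Definition phi x : R := normal_pdf 0 1 x.

Lemma phiE x : phi x = normal_peak 1 * expR (- (x ^+ 2 / 2)).
Proof.
rewrite /phi normal_pdfE ?oner_neq0 //; congr (_ * _).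
by rewrite /normal_fun subr0 expr1n mulNr.
Qed.

Lemma peak_gt0 : 0 < normal_peak 1 :> R.
Proof. exact: normal_peak_gt0 (oner_neq0 _). Qed.

Lemma phi_gt0 x : 0 < phi x.
Proof. by rewrite phiE mulr_gt0 ?expR_gt0 ?peak_gt0. Qed.

Lemma phi_derive x : is_derive x (1 : R) phi (- x * phi x).
Proof.
have -> : phi = fun y => normal_peak 1 * expR (- (y * y * 2^-1)).
  by apply/funext => y; rewrite phiE expr2.
have h := is_derive1_mul (is_derive1_cst x (normal_peak 1)) (is_derive1_expR (is_derive1_opp
  (is_derive1_mul (is_derive1_mul (is_derive1_id x) (is_derive1_id x)) (is_derive1_cst x 2^-1)))).
by apply: (is_derive_eq h); field.
Qed.

Lemma phi_continuous : continuous phi.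
Proof. exact: is_derive1_continuous phi_derive. Qed.

Lemma phiN x : phi (- x) = phi x.
Proof. by rewrite !phiE sqrrN. Qed.

(** Common form of [Phi], for w = 1, and of the integral of a smoothed indicator that enters the
    solution of Stein's equation. *)
Definition gauss_int w x : R := (\int[mu]_(y in `]-oo, x]%classic) (w y * phi y))%R.

Lemma integrable_wphi w (D : set R) : measurable D -> continuous w ->
  (forall y, 0 <= w y <= 1) ->
  mu.-integrable D (EFin \o (fun y => w y * phi y)).
Proof.
move=> mD cw w01.
have mf : measurable_fun setT (fun y => w y * phi y).
  by apply: measurable_funM; apply: continuous_measurable_fun => //; exact: phi_continuous.
apply: (@le_integrable _ _ _ mu D mD _ (fun y => (phi y)%:E)).
- by apply/measurable_EFinP; exact: measurable_funTS.
- move=> y _ /=; have /andP[w0 w1] := w01 y; have p := phi_gt0 y.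
  by rewrite lee_fin normrM (ger0_norm w0) ler_piMl.
- by apply: (@integrableS _ _ _ mu setT D) => //; exact: integrable_normal_pdf.
Qed.

Lemma gauss_int_derive w x : continuous w -> (forall y, 0 <= w y <= 1) ->
  is_derive x (1 : R) (gauss_int w) (w x * phi x).
Proof.
move=> cw w01.
have [||||d e] := @continuous_FTC1 R (fun y => w y * phi y) -oo%O x (x + 1).
- by rewrite ltrDl.
- exact: integrable_wphi.
- by rewrite ltNyr.
- by apply: cvgM; [exact: cw | exact: phi_continuous].
by apply: DeriveDef; [exact: d | rewrite -e derive1E].
Qed.

Lemma gauss_int_ge0 w x : (forall y, 0 <= w y <= 1) -> 0 <= gauss_int w x.
Proof.
move=> w01; apply: Rintegral_ge0 => y _; rewrite mulr_ge0 ?(ltW (phi_gt0 _)) //.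
by have /andP[] := w01 y.
Qed.

Lemma PhiE : Phi = gauss_int (fun=> 1).
Proof.
apply/funext => x; rewrite /Phi /gauss_int /normal_prob /Rintegral.
by congr fine; apply: eq_integral => y _; rewrite mul1r.
Qed.

Lemma gauss_int_le_Phi w x : continuous w -> (forall y, 0 <= w y <= 1) ->
  gauss_int w x <= Phi x.
Proof.
move=> cw w01; rewrite PhiE; apply: le_Rintegral => //.
- exact: integrable_wphi.
- apply: integrable_wphi => //; first by move=> y; exact: cst_continuous.
  by move=> y; rewrite ler01 lexx.
- move=> y _; rewrite ler_wpM2r ?(ltW (phi_gt0 _)) //.
  by have /andP[] := w01 y.
Qed.

Lemma gauss_int_eq_Phi w x : (forall y, y <= x -> w y = 1) -> gauss_int w x = Phi x.
Proof.
move=> w1; rewrite PhiE; apply: eq_Rintegral => y.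
by rewrite inE /= in_itv /= => yx; rewrite w1.
Qed.

Lemma Phi_derive x : is_derive x (1 : R) Phi (phi x).
Proof.
rewrite PhiE -[phi x]mul1r; apply: gauss_int_derive.
  by move=> y; exact: cst_continuous.
by move=> y; rewrite ler01 lexx.
Qed.

Lemma Phi_ge0 x : 0 <= Phi x.
Proof. by rewrite PhiE; apply: gauss_int_ge0 => y; rewrite ler01 lexx. Qed.

Lemma Phi_le1 x : Phi x <= 1.
Proof.
rewrite /Phi -lee_fin fineK; last exact: fin_num_measure.
exact: probability_le1.
Qed.

(** The identity as a random variable under the standard normal law: its distribution function is
    [Phi], which makes the limits at both infinities available. *)
Let idTR : measurableTypeR R -> R := idfun.
#[local] HB.instance Definition _ :=
  @isMeasurableFun.Build _ _ _ _ idTR (@measurable_id _ _ setT).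

Lemma Phi_Ny eps : 0 < eps -> exists a, forall x, x <= a -> Phi x <= eps.
Proof.
move=> e0.
have /fine_cvgP[_] := @cvg_cdfNy0 _ _ R _ (idTR : {RV (normal_prob (0:R) 1) >-> R}).
move=> /cvgrPdist_le /(_ eps e0) [a [_ H]].
exists (a - 1) => x xa; have h : x < a -> `|0 - Phi x| <= eps := H x.
by move: h; rewrite sub0r normrN ger0_norm ?Phi_ge0 //; apply; lra.
Qed.

Lemma Phi_y eps : 0 < eps -> exists a, forall x, a <= x -> 1 - eps <= Phi x.
Proof.
move=> e0.
have /fine_cvgP[_] := @cvg_cdfy1 _ _ R _ (idTR : {RV (normal_prob (0:R) 1) >-> R}).
move=> /cvgrPdist_le /(_ eps e0) [a [_ H]].
exists (a + 1) => x xa; have h : a < x -> `|1 - Phi x| <= eps := H x.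
by move: h; rewrite ger0_norm ?subr_ge0 ?Phi_le1 // => h; have := h ltac:(lra); lra.
Qed.

(** By symmetry of the density the sum Phi(y) + Phi(-y) has derivative 0; the limits at infinity
    identify the constant as 1. *)
Lemma PhiN x : Phi (- x) = 1 - Phi x.
Proof.
pose s y := Phi y + Phi (- y).
have sd y : is_derive y (1 : R) s 0.
  have h := is_derive1_comp (Phi_derive (- y)) (is_derive1_opp (is_derive1_id y)).
  by apply: (is_derive_eq (is_derive1_add (Phi_derive y) h)); rewrite phiN mulrN1 subrr.
suff : s x = 1 by rewrite /s; lra.
have cst y : s x = s y by exact: is_derive_0_is_cst.
apply/eqP; rewrite eq_le; apply/andP; split; apply/ler_addgt0Pr => e e0.
  have [a H] := Phi_Ny e0.
  rewrite (cst (- a)) /s opprK addrC [leRHS]addrC.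
  by apply: lerD; [exact: H | exact: Phi_le1].
have [a H] := Phi_y e0.
rewrite (cst a) /s.
by have := H a (lexx a); have := Phi_ge0 (- a); lra.
Qed.

End Gaussian.

(** * Gaussian tails and iterated antiderivatives of the density *)

Section Mills.
Context {R : realType}.
Implicit Types (x y t : R).

(** From (y + 1)^2 >= 0 the density is at most [normal_peak 1] times e^(1/2 + y); integrate from
    -oo, where [Phi] vanishes. *)
Lemma Phi_le_expR x : Phi x <= expR (2^-1 + x) * normal_peak 1.
Proof.
pose f y : R := expR (2^-1 + y) * normal_peak 1 + - Phi y.
have fd y : is_derive y (1 : R) f (expR (2^-1 + y) * normal_peak 1 - phi y).
  have h := is_derive1_mul (is_derive1_expR (is_derive1_add (is_derive1_cst y 2^-1) (is_derive1_id y))) (is_derive1_cst y (normal_peak 1)).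
  by apply: (is_derive_eq (is_derive1_add h (is_derive1_opp (Phi_derive y)))); ring.
rewrite -subr_ge0 -[_ - _]/(f x) -lerN2 oppr0.
apply/ler_addgt0Pr => e e0; rewrite add0r.
have [a H] := Phi_Ny e0.
have mn : minr a x <= x by rewrite ge_min lexx orbT.
have := derive_ge0_le fd mn => D.
have {}D : f (minr a x) <= f x.
  apply: D => y _; rewrite subr_ge0 phiE mulrC ler_wpM2r ?(ltW peak_gt0) //.
  by rewrite ler_expR; have := sqr_ge0 (y + 1); lra.
have h1 : Phi (minr a x) <= e by apply: H; rewrite ge_min lexx.
have h2 : 0 <= expR (2^-1 + minr a x) * normal_peak 1 by rewrite mulr_ge0 ?expR_ge0 ?(ltW peak_gt0).
by move: D; rewrite {1}/f; lra.
Qed.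

Lemma expR_ge_quart y : 0 <= y -> y ^+ 4 / 24 <= expR y.
Proof.
move=> y0; have := @expR_ge1Dxn R y 3 y0.
by rewrite (_ : 4`! = 24)%N //; lra.
Qed.

Lemma Phi_quart_le y : 0 < y -> y ^+ 4 * Phi (- y) <= 24 * (expR 2^-1 * normal_peak 1).
Proof.
move=> y0; have h := Phi_le_expR (- y); rewrite expRD mulrAC in h.
have C0 : 0 <= expR 2^-1 * normal_peak 1 :> R by rewrite mulr_ge0 ?expR_ge0 ?(ltW peak_gt0).
have q := expR_ge_quart (ltW y0).
have e1 : expR y * expR (- y) = 1 by rewrite expRN mulfV ?gt_eqF ?expR_gt0.
have y4 : 0 <= y ^+ 4 by rewrite exprn_ge0 // ltW.
have h1 := ler_wpM2l y4 h.
apply: (le_trans h1).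
have e0 := expR_gt0 (- y).
have h2 : y ^+ 4 * expR (- y) <= 24.
  have := ler_wpM2r (ltW e0) q; rewrite e1; lra.
have := ler_wpM2l C0 h2; lra.
Qed.

(* Both functions are iterated antiderivatives of [phi] vanishing at -oo *)
Definition mills1 x : R := x * Phi x + phi x.
Definition mills2 x : R := (1 + x ^+ 2) * Phi x + x * phi x.

Lemma mills1_derive x : is_derive x (1 : R) mills1 (Phi x).
Proof.
have h := is_derive1_add (is_derive1_mul (is_derive1_id x) (Phi_derive x)) (phi_derive x).
by apply: (is_derive_eq h); ring.
Qed.

Lemma mills2_derive x : is_derive x (1 : R) mills2 (2 * mills1 x).
Proof.
have -> : mills2 = fun y => (1 + y * y) * Phi y + y * phi y.
  by apply/funext => y; rewrite /mills2 expr2.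
have h := is_derive1_add (is_derive1_mul (is_derive1_add (is_derive1_cst x 1)
   (is_derive1_mul (is_derive1_id x) (is_derive1_id x))) (Phi_derive x))
   (is_derive1_mul (is_derive1_id x) (phi_derive x)).
by apply: (is_derive_eq h); rewrite /mills1; ring.
Qed.

(** It is nondecreasing, its derivative being [Phi], and its negative part tends to 0 at -oo; [y] is
    taken so large that y Phi(-y) <= e. *)
Lemma mills1_ge0 x : 0 <= mills1 x.
Proof.
rewrite -lerN2 oppr0; apply/ler_addgt0Pr => e e0; rewrite add0r.
pose C : R := 24 * (expR 2^-1 * normal_peak 1).
have C0 : 0 <= C by rewrite !mulr_ge0 ?expR_ge0 ?(ltW peak_gt0).
pose y := maxr (maxr 1 (- x)) (C / e).
have y1 : 1 <= y by rewrite !le_max lexx.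
have yx : - y <= x by rewrite lerNl !le_max lexx orbT.
have yC : C / e <= y by rewrite !le_max lexx orbT.
have D : mills1 (- y) <= mills1 x.
  by apply: (derive_ge0_le mills1_derive yx) => z _; exact: Phi_ge0.
have q := @Phi_quart_le y (lt_le_trans ltr01 y1); rewrite -/C in q.
have p := phi_gt0 (- y).
suff : y * Phi (- y) <= e by move: D; rewrite {1}/mills1; lra.
have y0 : 0 < y ^+ 3 by rewrite exprn_gt0 // (lt_le_trans ltr01).
rewrite -(ler_pM2l y0); apply: (@le_trans _ _ C); first by lra.
rewrite ler_pdivrMr // in yC; apply: (le_trans yC); rewrite ler_pM2r //.
by have := ler_eXn2l; rewrite -[leLHS]expr1 ler_weXn2l.
Qed.

Lemma mills2_ge0 x : 0 <= mills2 x.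
Proof.
rewrite -lerN2 oppr0; apply/ler_addgt0Pr => e e0; rewrite add0r.
pose P : R := normal_peak 1.
have P0 : 0 < P := peak_gt0.
pose y := maxr (maxr 1 (- x)) (8 * P / e).
have y1 : 1 <= y by rewrite !le_max lexx.
have yx : - y <= x by rewrite lerNl !le_max lexx orbT.
have yC : 8 * P / e <= y by rewrite !le_max lexx orbT.
have D : mills2 (- y) <= mills2 x.
  by apply: (derive_ge0_le mills2_derive yx) => z _; have := mills1_ge0 z; lra.
have p := Phi_ge0 (- y).
suff : y * phi y <= e.
  move: D; rewrite {1}/mills2 phiN sqrrN.
  by have := mulr_ge0 (sqr_ge0 y) p; lra.
have y0 : 0 < y by apply: lt_le_trans y1.
have h : phi y * (y ^+ 2) <= 8 * P.
  rewrite phiE -/P.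
  have e1 : expR (y ^+ 2 / 2) * expR (- (y ^+ 2 / 2)) = 1 by rewrite expRN mulfV ?gt_eqF ?expR_gt0.
  have e2 := expR_ge1Dx (y ^+ 2 / 2).
  have e3 := expR_gt0 (- (y ^+ 2 / 2)).
  have h := ler_wpM2r (ltW e3) e2; rewrite e1 in h.
  have h' : y ^+ 2 * expR (- (y ^+ 2 / 2)) <= 8 by lra.
  by have := ler_wpM2l (ltW P0) h'; lra.
rewrite -(ler_pM2l y0); apply: (@le_trans _ _ (8 * P)); first by lra.
by rewrite ler_pdivrMr // in yC.
Qed.

End Mills.

(** * Stein's equation for a smoothed indicator *)

Section SteinEquation.
Local Open Scope classical_set_scope.
Local Open Scope ring_scope.
Context {R : realType}.
Implicit Types (x y : R).

(** The reciprocal of the density [phi]. *)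
Definition psi x : R := (normal_peak 1)^-1 * expR (x ^+ 2 / 2).

Lemma psi_gt0 x : 0 < psi x.
Proof. by apply: mulr_gt0; [rewrite invr_gt0; exact: peak_gt0 | exact: expR_gt0]. Qed.

Lemma phi_psi x : phi x * psi x = 1.
Proof.
rewrite phiE /psi mulrACA mulfV ?gt_eqF ?peak_gt0 // mul1r.
by rewrite expRN mulVf ?gt_eqF ?expR_gt0.
Qed.

Lemma psiN x : psi (- x) = psi x. Proof. by rewrite /psi sqrrN. Qed.

Lemma psi_derive x : is_derive x (1 : R) psi (x * psi x).
Proof.
have -> : psi = fun y => (normal_peak 1)^-1 * expR (y * y * 2^-1).
  by apply/funext => y; rewrite /psi expr2.
have h := is_derive1_mul (is_derive1_cst x (normal_peak 1)^-1) (is_derive1_expR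
  (is_derive1_mul (is_derive1_mul (is_derive1_id x) (is_derive1_id x)) (is_derive1_cst x 2^-1))).
by apply: (is_derive_eq h); field; rewrite gt_eqF ?peak_gt0.
Qed.

Lemma psi_le x B : `|x| <= B -> psi x <= psi B.
Proof.
move=> xB; rewrite ler_wpM2l ?invr_ge0 ?(ltW peak_gt0) // ler_expR ler_wpM2r //.
rewrite -[leLHS]real_normK ?num_real // lerXn2r ?nnegrE //.
exact: le_trans (normr_ge0 _) xB.
Qed.

(** Mills' ratio Phi / phi, taken on the left tail. Its derivative is 1 + x [mills x], which equals
    [mills1] / [phi]. *)
Definition mills x : R := Phi x * psi x.

Lemma mills_derive_bounds x : x <= 0 -> 0 <= 1 + x * mills x <= 1.
Proof.
move=> x0; have p := psi_gt0 x; have m := mills1_ge0 x.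
have q : 0 <= mills x by rewrite mulr_ge0 ?Phi_ge0 // ltW.
have -> : 1 + x * mills x = mills1 x * psi x by rewrite mulrDl phi_psi /mills; ring.
rewrite mulr_ge0 ?(ltW p) //= mulrDl phi_psi -mulrA -/(mills x); nra.
Qed.

Lemma mills_le x : x <= 0 -> mills x <= psi 0.
Proof.
move=> x0.
have md y : is_derive y (1 : R) mills (mills1 y * psi y).
  apply: (is_derive_eq (is_derive1_mul (Phi_derive y) (psi_derive y))).
  by rewrite /mills1; ring.
have : mills x <= mills 0.
  apply: (derive_ge0_le md x0) => y _.
  by rewrite mulr_ge0 ?mills1_ge0 // ltW // psi_gt0.
move/le_trans; apply; rewrite /mills ler_piMl ?(ltW (psi_gt0 _)) //.
exact: Phi_le1.
Qed.

(** The middle term is the second derivative of Mills' ratio. It equals [mills2] / [phi], hence the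
    sign; the upper bound follows from those on the ratio and its first derivative. *)
Lemma mills_derive2_bounds x : x <= 0 -> 0 <= mills x + x * (1 + x * mills x) <= psi 0.
Proof.
move=> x0; have p := psi_gt0 x; have m := mills2_ge0 x.
have /andP[h1 h2] := mills_derive_bounds x0.
have h3 := mills_le x0.
apply/andP; split; last by nra.
have -> : mills x + x * (1 + x * mills x) = mills2 x * psi x.
  by rewrite [RHS]mulrDl -[x * phi x * _]mulrA phi_psi /mills; ring.
by rewrite mulr_ge0 // ltW.
Qed.

(** Equal to 1 up to t, to 0 from t + e on, and affine in between. A Lipschitz substitute for the
    indicator makes the derivative of the Stein solution Lipschitz. *)
Definition ramp (t e x : R) : R := minr 1 (maxr 0 ((t + e - x) / e)).

Lemma ramp01 t e x : 0 <= ramp t e x <= 1.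
Proof. by rewrite /ramp le_min ler01 le_max lexx ge_min lexx. Qed.

Lemma ramp_left t e x : 0 < e -> x <= t -> ramp t e x = 1.
Proof.
move=> e0 xt; rewrite /ramp min_l // le_max; apply/orP; right.
by rewrite ler_pdivlMr //; lra.
Qed.

Lemma ramp_right t e x : 0 < e -> t + e <= x -> ramp t e x = 0.
Proof.
move=> e0 xt; rewrite /ramp max_l ?min_r // ler_pdivrMr // mul0r; lra.
Qed.

Lemma ramp_lip t e x y : 0 < e -> `|ramp t e y - ramp t e x| <= e^-1 * `|y - x|.
Proof.
move=> e0.
have ei : 0 < e^-1 by rewrite invr_gt0.
wlog xy : x y / x <= y.
  by move=> H; have [/H//|/ltW/H] := leP x y; rewrite distrC [`|x - y|]distrC.
have h : (t + e - y) / e <= (t + e - x) / e by rewrite ler_pM2r //; lra.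
rewrite [`|y - x|]ger0_norm ?subr_ge0 //.
have -> : e^-1 * (y - x) = (t + e - x) / e - (t + e - y) / e by rewrite -mulrBl mulrC; congr (_ * _); lra.
rewrite /ramp; move: ((t + e - y) / e) ((t + e - x) / e) h => b a ba.
rewrite ler_norml !minEle !maxEle; clear -ba.
by case: (leP 0 a) => ?; case: (leP 0 b) => ?; do 2 (try case: (leP 1 _) => ?);
  apply/andP; split; lra.
Qed.

Lemma ramp_continuous t e : 0 < e -> continuous (ramp t e).
Proof.
move=> e0 x; apply/cvgrPdist_le => eps eps0.
near=> y.
apply: (le_trans (ramp_lip _ _ _ e0)).
rewrite mulrC ler_pdivrMr //; near: y.
have H : (fun y => y) @ x --> x by exact: cvg_id.
exact: (@cvgr_dist_le _ _ _ _ _ _ _ H _ (mulr_gt0 eps0 e0)).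
Unshelve. all: by end_near. Qed.

End SteinEquation.

Section SteinSolution.
Context {R : realType}.
Implicit Types (x y : R).

(** The solution is (H - c Phi) / phi with H the integral of the ramp against the density and c its
    total mass. On both tails it is a multiple of Mills' ratio, which controls it uniformly; in the
    remaining bounded interval crude bounds suffice, as [B] and [L] may depend on t and e. *)
Theorem stein_solution (t e : R) : 0 < e ->
  exists (f df : R -> R) (c B L : R),
    [/\ Phi t <= c <= Phi (t + e),
        forall x, df x - x * f x = ramp t e x - c,
        forall x, `|df x| <= B &
        forall x y, `|f y - f x - (y - x) * df x| <= L * (y - x) ^+ 2].
Proof.
move=> e0.
pose w := ramp t e; pose H := gauss_int w.
have cw : continuous w by exact: ramp_continuous.
have w01 x : 0 <= w x <= 1 by exact: ramp01.
have Hd x : is_derive x (1 : R) H (w x * phi x) by exact: gauss_int_derive.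
have Hl x : x <= t -> H x = Phi x.
  by move=> xt; apply: gauss_int_eq_Phi => y yx; apply: ramp_left => //; apply: le_trans xt.
pose c := H (t + e).
have Hr x : t + e <= x -> H x = c.
  move=> xt; apply/eqP; rewrite -subr_eq0; apply/eqP.
  have [s /andP[s1 _] ->] := mean_value Hd xt.
  by rewrite /w ramp_right // !mul0r.
have H0 x : 0 <= H x by exact: gauss_int_ge0.
have H1 x : H x <= 1 by apply: le_trans (Phi_le1 x); exact: gauss_int_le_Phi.
have c0 : 0 <= c := H0 _.
have c1 : c <= 1 := H1 _.
pose f x := (H x + - (c * Phi x)) * psi x.
pose df x := x * f x + w x - c.
have fd x : is_derive x (1 : R) f (df x).
  have h := is_derive1_mul (is_derive1_add (Hd x) (is_derive1_opp (is_derive1_mul (is_derive1_cst x c) (Phi_derive x)))) (psi_derive x).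
  apply: (is_derive_eq h).
  transitivity (x * f x + (w x - c) * (phi x * psi x)); first by rewrite /f; ring.
  by rewrite phi_psi mulr1 /df addrA.
(* Beyond [D] in absolute value the ramp is constant; within it the reciprocal density is at most
   [M]. *)
pose D : R := `|t| + e; pose M := psi D.
have D0 : 0 <= D by rewrite addr_ge0 // ltW.
have M0 : 0 < M := psi_gt0 _.
have Dr x : D < x -> t + e <= x by rewrite /D; have := ler_norm t; lra.
have Dl x : x < - D -> x <= t by rewrite /D; have := ler_normr t; have := lerNnormlW (lexx `|t|); lra.
have fl x : x < - D -> f x = (1 - c) * mills x.
  by move=> /Dl xt; rewrite /f Hl // /mills; ring.
have fr x : D < x -> f x = c * mills (- x).
  by move=> /Dr xt; rewrite /f Hr // /mills PhiN psiN; ring.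
have dfl x : x < - D -> df x = (1 - c) * (1 + x * mills x).
  by move=> xD; rewrite /df fl // /w ramp_left ?Dl //; ring.
have dfr x : D < x -> df x = - c * (1 + (- x) * mills (- x)).
  by move=> xD; rewrite /df fr // /w ramp_right ?Dr //; ring.
have fM x : `|x| <= D -> `|f x| <= M.
  move=> xD; rewrite normrM (gtr0_norm (psi_gt0 _)) -[leRHS]mul1r.
  apply: ler_pM => //; [exact/ltW/psi_gt0| |exact: psi_le].
  have a := H0 x; have b := H1 x; have p0 := Phi_ge0 x; have p1 := Phi_le1 x.
  by rewrite ler_norml; apply/andP; split; nra.
have cases x : [\/ x < - D, `|x| <= D | D < x].
  have [xD|xD] := ltP x (- D); first by constructor 1.
  have [xD'|xD'] := leP x D; last by constructor 3.
  by constructor 2; rewrite ler_norml xD.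
pose B := D * M + 1.
have dfB x : `|df x| <= B.
  have DM : 0 <= D * M by rewrite mulr_ge0 // ltW.
  case: (cases x) => xD.
  - have /andP[h1 h2] := @mills_derive_bounds R x ltac:(lra).
    by rewrite dfl // ler_norml /B; apply/andP; split; nra.
  - have h1 := fM _ xD; have /andP[w0 w1] := w01 x.
    have h2 : `|x * f x| <= D * M by rewrite normrM; apply: ler_pM.
    move: h2; rewrite /df /B !ler_norml => /andP[? ?].
    by apply/andP; split; lra.
  - have /andP[h1 h2] := @mills_derive_bounds R (- x) ltac:(lra).
    by rewrite dfr // ler_norml /B; apply/andP; split; nra.
pose L1 := M + D * B.
have B0 : 0 <= B := le_trans (normr_ge0 _) (dfB 0).
have p0M : psi 0 <= M by apply: psi_le; rewrite normr0.
have DB : 0 <= D * B by rewrite mulr_ge0.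
(* Since f' = x f + w - c and w is Lipschitz, f' is Lipschitz once x f has a bounded derivative; on
   the tails that derivative is a multiple of the second derivative of Mills' ratio. *)
pose q x := x * f x; pose dq x := f x + x * df x.
have qd x : is_derive x (1 : R) q (dq x).
  apply: (is_derive_eq (is_derive1_mul (is_derive1_id x) (fd x))).
  by rewrite /dq; ring.
have dqL x : `|dq x| <= L1.
  rewrite /dq; case: (cases x) => xD.
  - have /andP[h1 h2] := @mills_derive2_bounds R x ltac:(lra).
    have -> : f x + x * df x = (1 - c) * (mills x + x * (1 + x * mills x)).
      by rewrite fl // dfl //; ring.
    by rewrite ler_norml /L1; apply/andP; split; nra.
  - apply: (le_trans (ler_normD _ _)); apply: lerD; first exact: fM.
    by rewrite normrM; apply: ler_pM.
  - have /andP[h1 h2] := @mills_derive2_bounds R (- x) ltac:(lra).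
    have -> : f x + x * df x = c * (mills (- x) + (- x) * (1 + (- x) * mills (- x))).
      by rewrite fr // dfr //; ring.
    by rewrite ler_norml /L1; apply/andP; split; nra.
pose L := L1 + e^-1.
have qlip x y : x <= y -> `|q y - q x| <= L1 * (y - x).
  move=> xy; have [s _ ->] := mean_value qd xy.
  by rewrite normrM [`|y - x|]ger0_norm ?subr_ge0 // ler_wpM2r ?subr_ge0.
have dflip x y : `|df y - df x| <= L * `|y - x|.
  rewrite /df (_ : _ - _ = (q y - q x) + (w y - w x)); last by rewrite /q; ring.
  apply: (le_trans (ler_normD _ _)); rewrite mulrDl; apply: lerD; last exact: ramp_lip.
  have [xy|/ltW yx] := leP x y; first by rewrite [`|y - x|]ger0_norm ?subr_ge0 ?qlip.
  by rewrite distrC [`|y - x|]distrC [`|x - y|]ger0_norm ?subr_ge0 ?qlip.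
have L0 : 0 <= L by have := le_trans (normr_ge0 _) (dflip 0 1); rewrite subr0 normr1 mulr1.
exists f, df, c, B, L; split => //.
- apply/andP; split; last exact: gauss_int_le_Phi.
  rewrite -(Hl t) //; apply: (derive_ge0_le Hd); first by rewrite lerDl ltW.
  by move=> s _; have /andP[w0 _] := w01 s; rewrite mulr_ge0 // ltW // phi_gt0.
- by move=> x; rewrite /df -/w; ring.
- move=> x y.
  suff [s Es sxy] : exists2 s, f y - f x = df s * (y - x) & `|s - x| <= `|y - x|.
    rewrite Es (_ : _ - _ = (df s - df x) * (y - x)); last by ring.
    rewrite normrM -[(y - x) ^+ 2]real_normK ?num_real // expr2 mulrA ler_wpM2r //.
    by apply: (le_trans (dflip _ _)); rewrite ler_wpM2l.
  have [xy|/ltW yx] := leP x y.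
    have [s /andP[s1 s2] Es] := mean_value fd xy; exists s => //.
    by rewrite !ger0_norm ?subr_ge0 // lerD2r.
  have [s /andP[s1 s2] Es] := mean_value fd yx; exists s.
    by rewrite -opprB Es; ring.
  by rewrite !ler0_norm ?subr_le0 // lerN2 lerD2r.
Qed.

End SteinSolution.

(** * Central limit theorem for linear statistics *)

Section CLT.
Context {R : realType}.

Lemma phi_le x : phi x <= normal_peak 1 :> R.
Proof.
rewrite phiE -[leRHS]mulr1 ler_wpM2l ?(ltW peak_gt0) //.
by rewrite -expR0 ler_expR oppr_le0 mulr_ge0 ?sqr_ge0.
Qed.

Lemma Phi_lip (x y : R) : x <= y -> Phi y <= Phi x + normal_peak 1 * (y - x).
Proof.
move=> xy; have [s _ E] := mean_value Phi_derive xy.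
by have := ler_wpM2r (_ : 0 <= y - x) (phi_le s); rewrite subr_ge0 => /(_ xy); lra.
Qed.

(** Uses |x| <= eta + x^2 / eta together with the variance bound for the Lipschitz constant 16 k^2,
    whence the factor 256. *)
Lemma swap_var_mean_dev (K N : nat) (Nz : trt K -> nat) (c : 'I_N -> trt K -> R) (k eta : R) :
  (\sum_(z : trt K) Nz z)%N = N -> (0 < N)%N -> 0 < k -> (forall i z, `|c i z| <= k) -> 0 < eta ->
  Ex Nz (fun A => `|swap_var c A - Ex Nz (swap_var c)|) <= eta + 192 * 256 * N%:R * k ^+ 4 / eta.
Proof.
move=> Nz_sum N0 k0 ck eta0.
have lip := @swap_var_swap_lip R K N Nz c N0 k ck.
have b0 : 0 < 16 * k ^+ 2 by rewrite mulr_gt0 // exprn_gt0.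
have v := swap_lip_var Nz_sum N0 b0 lip.
apply: (@le_trans _ _ (Ex Nz (fun A => eta + eta^-1 * (swap_var c A - Ex Nz (swap_var c)) ^+ 2))).
  apply: le_Ex => A _; set x := swap_var c A - _.
  have : 0 <= (`|x| - eta) ^+ 2 by exact: sqr_ge0.
  have e1 : `|x| ^+ 2 = x ^+ 2 by rewrite real_normK ?num_real.
  have e2 := normr_ge0 x.
  move=> h; rewrite -(ler_pM2l eta0) mulrDr mulVKf ?gt_eqF //; rewrite sqrrB e1 in h; nra.
rewrite ExD ExZ (Ex_cst Nz_sum) lerD2l mulrC ler_pM2r ?invr_gt0 //.
apply: (le_trans v); rewrite le_eqVlt; apply/orP; left; apply/eqP; ring.
Qed.

(** Ramps starting at t and at t - e sandwich the indicator. The threshold [d] depends on t and eps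
    alone, so the bound applies along a sequence of designs of varying dimension. *)
Lemma clt_linstat (t eps : R) : 0 < eps -> exists2 d : R, 0 < d &
  forall (K N : nat) (Nz : trt K -> nat) (c : 'I_N -> trt K -> R) (k : R),
  (\sum_(z : trt K) Nz z)%N = N -> (0 < N)%N -> 0 < k -> (forall i z, `|c i z| <= k) ->
  (forall z, \sum_i c i z = 0) -> Ex Nz (fun A => linstat c A ^+ 2) = 1 ->
  N%:R * k ^+ 4 <= d ->
  `|prob Nz (fun A => linstat c A <= t) - Phi t| <= eps.
Proof.
move=> eps0.
pose P : R := normal_peak 1; have P0 : 0 < P := peak_gt0.
(* The slope of [Phi] is at most [P], so a shift by e costs at most eps / 2. The other half is split
   equally between the deviation of V, through [eta], and the Taylor remainder, through [l]. *)
pose e := eps / (2 * P).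
have e0 : 0 < e by rewrite divr_gt0 // mulr_gt0.
have eP : P * e = eps / 2 by rewrite /e; field; rewrite gt_eqF.
have [f1 [d1 [c1 [B1 [L1 [/andP[_ c1le] st1 dB1 r1]]]]]] := @stein_solution R t e e0.
have [f2 [d2 [c2 [B2 [L2 [/andP[c2ge _] st2 dB2 r2]]]]]] := @stein_solution R (t - e) e e0.
have Bp (B : R) (h : R -> R) : (forall x, `|h x| <= B) -> 0 <= B.
  by move=> H; exact: le_trans (normr_ge0 _) (H 0).
have Lp (L : R) (f h : R -> R) : (forall x y, `|f y - f x - (y - x) * h x| <= L * (y - x) ^+ 2) -> 0 <= L.
  by move=> H; have := le_trans (normr_ge0 _) (H 0 1); rewrite subr0 expr1n mulr1.
pose B := B1 + B2 + 1; pose L := L1 + L2 + 1.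
have B1p := Bp _ _ dB1; have B2p := Bp _ _ dB2.
have L1p := Lp _ _ _ r1; have L2p := Lp _ _ _ r2.
have [BB1 BB2] : B1 <= B /\ B2 <= B by rewrite /B; clear -B1p B2p; split; lra.
have [LL1 LL2] : L1 <= L /\ L2 <= L by rewrite /L; clear -L1p L2p; split; lra.
have B0 : 0 < B by rewrite /B; clear -B1p B2p; lra.
have L0 : 0 < L by rewrite /L; clear -L1p L2p; lra.
pose eta := eps / (8 * B).
have eta0 : 0 < eta by rewrite divr_gt0 // mulr_gt0.
pose l := eps / (16 * L).
have l0 : 0 < l by rewrite divr_gt0 // mulr_gt0.
have [C p192 CE] : exists2 C : R, 0 < C & 192 * 256 = C.
  by exists (192 * 256); first by apply: mulr_gt0; rewrite ltr0n.
pose m1 := eta ^+ 2 / C; pose m2 := l ^+ 2 / 4.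
have m10 : 0 < m1 by rewrite divr_gt0 // exprn_gt0.
have m20 : 0 < m2 by rewrite divr_gt0 // exprn_gt0.
exists (minr m1 m2); first by rewrite lt_min m10.
move=> K N Nz c k Nz_sum N0 k0 ck c0 W1; rewrite le_min => /andP[h1 h2].
have NR : (0 : R) < N%:R by rewrite ltr0n.
pose E := Ex Nz (fun A => `|swap_var c A - Ex Nz (swap_var c)|).
have E0 : 0 <= E by apply: Ex_ge0 => A _.
have Ele : E <= 2 * eta.
  apply: (le_trans (swap_var_mean_dev Nz_sum N0 k0 ck eta0)).
  rewrite CE; suff : C * N%:R * k ^+ 4 / eta <= eta by lra.
  rewrite ler_pdivrMr // -expr2; rewrite /m1 ler_pdivlMr // in h1; lra.
have V1 : Ex Nz (swap_var c) = 1 by rewrite -Ex_linstat_sq.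
(* Normalization gives 1 = E V <= 4 N k^2, so k^2 <= 4 N k^4: the single smallness hypothesis also
   makes k small. *)
have kl : k <= l.
  have v4 : 1 <= 4 * N%:R * k ^+ 2.
    rewrite -[leLHS]V1 -[leRHS](Ex_cst Nz_sum); apply: le_Ex => A _; exact: (swap_var_le N0 ck).
  have k2 : 0 < k ^+ 2 by rewrite exprn_gt0.
  have : k ^+ 2 <= l ^+ 2 by have := ler_wpM2r (ltW k2) v4; rewrite /m2 in h2; lra.
  have kn : k \in Num.nneg by rewrite nnegrE ltW.
  have ln : l \in Num.nneg by rewrite nnegrE ltW.
  by rewrite ler_pXn2r.
have err (f h : R -> R) (B' L' : R) : B' <= B -> L' <= L -> 0 <= L' ->
    (forall x, `|h x| <= B') ->
    (forall x y, `|f y - f x - (y - x) * h x| <= L' * (y - x) ^+ 2) ->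
    `|Ex Nz (fun A => h (linstat c A) - linstat c A * f (linstat c A))| <= eps / 2.
  move=> BB LL L'0 hB hr; apply: (le_trans (stein_bound N0 c0 ck hr hB W1)).
  rewrite -/E.
  have a1 : B' * E <= B * (2 * eta) by apply: ler_pM => //; exact: Bp hB.
  have a2 : L' * (4 * k) <= L * (4 * l) by apply: ler_pM => //; [rewrite mulr_ge0 // ltW | rewrite ler_pM2l].
  have a3 : B * (2 * eta) = eps / 4 by rewrite /eta; field; rewrite gt_eqF.
  have a4 : L * (4 * l) = eps / 4 by rewrite /l; field; rewrite gt_eqF.
  by clear -a1 a2 a3 a4; lra.
have r1E := err f1 d1 B1 L1 BB1 LL1 L1p dB1 r1.
have r2E := err f2 d2 B2 L2 BB2 LL2 L2p dB2 r2.
have rampE (f h : R -> R) s c' : (forall x, h x - x * f x = ramp s e x - c') ->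
    Ex Nz (fun A => ramp s e (linstat c A)) =
    Ex Nz (fun A => h (linstat c A) - linstat c A * f (linstat c A)) + c'.
  move=> H; rewrite -[X in _ + X](Ex_cst Nz_sum) -ExD; apply: eq_Ex => A _.
  by rewrite H subrK.
have up : prob Nz (fun A => linstat c A <= t) <= Ex Nz (fun A => ramp t e (linstat c A)).
  rewrite prob_Ex; apply: le_Ex => A _; have [h|h] := leP (linstat c A) t.
    by rewrite ramp_left.
  by have /andP[] := ramp01 t e (linstat c A).
have lo : Ex Nz (fun A => ramp (t - e) e (linstat c A)) <= prob Nz (fun A => linstat c A <= t).
  rewrite prob_Ex; apply: le_Ex => A _; have [h|h] := leP (linstat c A) t.
    by have /andP[] := ramp01 (t - e) e (linstat c A).
  by rewrite ramp_right // subrK ltW.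
rewrite (rampE _ _ _ _ st1) in up; rewrite (rampE _ _ _ _ st2) in lo.
have te : t <= t + e by rewrite lerDl ltW.
have te' : t - e <= t by rewrite gerBl ltW.
have g1 := Phi_lip te; have g2 := Phi_lip te'.
rewrite -/P in g1 g2.
have g1' : P * (t + e - t) = eps / 2 by rewrite -eP; ring.
have g2' : P * (t - (t - e)) = eps / 2 by rewrite -eP; ring.
move: r1E r2E; rewrite !ler_norml => /andP[u1 u2] /andP[u3 u4].
clear -g1 g2 g1' g2' u1 u2 u3 u4 up lo c1le c2ge.
by apply/andP; split; lra.
Qed.
End CLT.

(** * Condition number and Rayleigh quotient *)

Section MinEigenvalue.
Context {R : realType} {n : nat}.
Implicit Types (A B M : 'M[R]_n) (u v w : 'rV[R]_n).

Local Notation form A u v := ((u *m A *m v^T) 0 0).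
Local Notation norm2 u := ((u *m u^T) 0 0).

Lemma norm2E u : norm2 u = \sum_j u 0 j ^+ 2.
Proof. by rewrite mxE; apply: eq_bigr => j _; rewrite mxE expr2. Qed.

Lemma formE A u v : form A u v = \sum_i \sum_j u 0 i * A i j * v 0 j.
Proof.
rewrite mxE exchange_big /=; apply: eq_bigr => j _.
by rewrite !mxE big_distrl.
Qed.

Lemma form_subl A u w v (t : R) : form A (u - t *: w) v = form A u v - t * form A w v.
Proof.
rewrite !formE big_distrr /= -sumrB; apply: eq_bigr => i _.
rewrite big_distrr /= -sumrB; apply: eq_bigr => j _.
by rewrite !mxE; ring.
Qed.

Lemma norm2_ge0 u : 0 <= norm2 u.
Proof. by rewrite norm2E sumr_ge0 // => j _; rewrite sqr_ge0. Qed.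

Lemma norm2_gt0 u : u != 0 -> 0 < norm2 u.
Proof.
move=> u0; rewrite lt_def norm2_ge0 andbT; apply: contraNneq u0 => /eqP.
rewrite norm2E psumr_eq0; last by move=> j _; exact: sqr_ge0.
move=> /allP H; apply/eqP/rowP => j; rewrite mxE.
by have := H j; rewrite mem_index_enum sqrf_eq0 => /(_ isT)/eqP.
Qed.

Lemma form_bound A : exists2 C, 0 <= C & forall u, `|form A u u| <= C * norm2 u.
Proof.
exists (\sum_i \sum_j `|A i j|).
  by apply: sumr_ge0 => i _; exact: sumr_ge0.
move=> u; rewrite formE big_distrl /=.
apply: (le_trans (ler_norm_sum _ _ _)); apply: ler_sum => i _; rewrite big_distrl /=.
apply: (le_trans (ler_norm_sum _ _ _)); apply: ler_sum => j _.
rewrite mulrAC mulrC normrM ler_wpM2l //.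
have le2 k : u 0 k ^+ 2 <= norm2 u.
  by rewrite norm2E (bigD1 k) //= lerDl sumr_ge0 // => l _; rewrite sqr_ge0.
have := le2 i; have := le2 j.
have := sqr_ge0 (u 0 i - u 0 j); have := sqr_ge0 (u 0 i + u 0 j).
by rewrite ler_norml => h1 h2 h3 h4; apply/andP; split; nra.
Qed.

(* The best lower bound b of the Rayleigh quotient is an eigenvalue, since
   A - b I is positive semidefinite and an invertible positive semidefinite
   form would be bounded below by a positive multiple of the norm. *)
Lemma min_eigenvalue A : A^T = A -> (0 < n)%N ->
  exists b, (exists2 v : 'rV[R]_n, v != 0 & v *m A = b *: v) /\
    forall u, b * norm2 u <= form A u u.
Proof.
move=> symA n0.
pose S : set R := [set b | forall u, b * norm2 u <= form A u u]%classic.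
have [C C0 CA] := form_bound A.
have S0 : S (- C).
  move=> u; have := CA u; rewrite ler_norml => /andP[h _].
  by rewrite mulNr.
pose e : 'rV[R]_n := delta_mx 0 (Ordinal n0).
have e0 : e != 0.
  by apply/eqP => /rowP /(_ (Ordinal n0)); rewrite !mxE !eqxx => /eqP; rewrite oner_eq0.
have Sub u : u != 0 -> ubound S (form A u u / norm2 u).
  by move=> u0 b /(_ u) Sb; rewrite ler_pdivlMr ?norm2_gt0.
have hS : has_sup S by split; [exists (- C) | exists (form A e e / norm2 e); exact: Sub].
pose b := sup S.
have bS u : b * norm2 u <= form A u u.
  have [->|u0] := eqVneq u 0; first by rewrite !mul0mx !mxE mulr0.
  by rewrite -ler_pdivlMr ?norm2_gt0 //; apply: ge_sup; [exists (- C) | exact: Sub].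
exists b; split => //.
pose M := A - b%:M.
have symM : M^T = M by rewrite /M linearB /= symA tr_scalar_mx.
have formM u v : form M u v = form A u v - b * (u *m v^T) 0 0.
  by rewrite /M mulmxBr mulmxBl mxE; congr (_ + _); rewrite mxE mul_mx_scalar -scalemxAl mxE.
have psd u : 0 <= form M u u by rewrite formM subr_ge0.
have [dM|dM] := eqVneq (\det M) 0.
  have [v v0 vM] : exists2 v : 'rV_n, v != 0 & v *m M = 0 by apply/det0P; rewrite dM.
  exists v => //; move: vM; rewrite /M mulmxBr mul_mx_scalar => /eqP.
  by rewrite subr_eq0 => /eqP.
have uM : M \in unitmx by rewrite unitmxE unitfE.
have [CM CM0 HM] := form_bound M.
have [CB CB0 HB] := form_bound (invmx M *m (invmx M)^T).
have form_sym u v : form M u v = form M v u.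
  have -> : form M v u = (v *m M *m u^T)^T 0 0 by rewrite [RHS]mxE.
  by rewrite !trmx_mul trmxK symM mulmxA.
have CM1 : 0 < CM + 1 by lra.
(* Cauchy-Schwarz for the semidefinite form: evaluate it at u - t (u M) with t = (CM + 1)^-1. *)
have key u : norm2 (u *m M) <= (CM + 1) * form M u u.
  set w := u *m M.
  have wu : form M w u = norm2 w by rewrite form_sym.
  have [w0|w0] := eqVneq w 0.
    by rewrite w0 !mul0mx !mxE mulr0.
  have nw := norm2_gt0 w0.
  have disc t : 0 <= form M u u - 2 * t * norm2 w + t ^+ 2 * form M w w.
    have := psd (u - t *: w).
    rewrite form_subl (form_sym u) (form_sym w) !form_subl wu form_sym wu; lra.
  have ww : form M w w <= (CM + 1) * norm2 w.
    by have := HM w; rewrite ler_norml => /andP[_ h]; lra.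
  have h := disc (CM + 1)^-1.
  have t0 : 0 < (CM + 1)^-1 by rewrite invr_gt0.
  have h2 := ler_wpM2l (sqr_ge0 (CM + 1)^-1) ww.
  have e2 : (CM + 1)^-1 ^+ 2 * ((CM + 1) * norm2 w) = (CM + 1)^-1 * norm2 w.
    by field; rewrite gt_eqF.
  rewrite e2 in h2; rewrite -ler_pdivrMl //; lra.
(* Invertibility bounds u by u M, and [key] bounds u M by the form, so b + d would be a larger
   admissible lower bound. *)
pose d := (CB * (CM + 1) + 1)^-1.
have d0 : 0 < d by rewrite invr_gt0 ltr_wpDl // mulr_ge0 // ltW.
have Sd : S (b + d).
  move=> u; have := key u; set w := u *m M => kw.
  have uw : u = w *m invmx M by rewrite mulmxK.
  have nu : norm2 u <= CB * norm2 w.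
    have E : norm2 (w *m invmx M) = form (invmx M *m (invmx M)^T) w w.
      by rewrite trmx_mul !mulmxA.
    by rewrite -uw in E; rewrite E; have := HB w; rewrite ler_norml => /andP[_].
  have nu2 : norm2 u <= (CB * (CM + 1) + 1) * form M u u.
    by have := ler_wpM2l CB0 kw; have := psd u; lra.
  have : d * norm2 u <= form M u u by rewrite /d ler_pdivrMl // -invr_gt0.
  by rewrite formM; lra.
have : b + d <= b by apply: ub_le_sup => //; case: hS.
by rewrite gerDl leNgt d0.
Qed.

End MinEigenvalue.

Section Rayleigh.
Context {R : realType} {K : nat}.

Lemma trt_card_gt0 : (0 < #|{: trt K}|)%N.
Proof. by apply/card_gt0P; exists [ffun=> false]. Qed.

Lemma min_is_eigenvalue (A : trt K -> trt K -> R) : (forall z z', A z z' = A z' z) ->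
  exists2 b, is_eigenvalue A b & forall u, b * (\sum_z u z ^+ 2) <= qform A u.
Proof.
move=> symA.
pose n := #|{: trt K}|; pose e : 'I_n -> trt K := enum_val.
pose M : 'M[R]_n := \matrix_(i, j) A (e i) (e j).
have sumE (F : trt K -> R) : \sum_z F z = \sum_(i < n) F (e i).
  by rewrite -big_enum_val.
have symM : M^T = M by apply/matrixP => i j; rewrite !mxE.
have [b [[v v0 vM] H]] := min_eigenvalue symM trt_card_gt0.
exists b.
  pose r (z : trt K) : 'I_n := enum_rank z.
  have re i : r (e i) = i by exact: enum_valK.
  have er z : e (r z) = z by exact: enum_rankK.
  exists (fun z => v 0 (r z)); split.
    have /rV0Pn[i vi] := v0.
    by exists (e i); rewrite re.
  move=> z; rewrite sumE; move/rowP/(_ (r z)): vM; rewrite !mxE => <-.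
  by apply: eq_bigr => i _; rewrite re mxE er symA mulrC.
move=> u; have := H (\row_i u (e i)).
rewrite formE norm2E sumE /qform sumE.
rewrite (eq_bigr (fun i => u (e i) ^+ 2)); last by move=> i _; rewrite mxE.
move/le_trans; apply; rewrite le_eqVlt; apply/orP; left; apply/eqP.
by apply: eq_bigr => i _; rewrite sumE; apply: eq_bigr => j _; rewrite !mxE.
Qed.

(** Unit diagonal forces some eigenvalue to be at least 1: the negated matrix has Rayleigh quotient
    -1 at a coordinate vector. The ratio bound then gives 1 <= s b for the least eigenvalue b. *)
Lemma condition_number_lb (A : trt K -> trt K -> R) (s : R) : (forall z z', A z z' = A z' z) ->
  (forall z, A z z = 1) -> 0 <= s ->
  (forall a b, is_eigenvalue A a -> is_eigenvalue A b -> a <= s * b) ->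
  forall u, \sum_z u z ^+ 2 <= s * qform A u.
Proof.
move=> symA diagA s0 cond u.
have [b Eb Hb] := min_is_eigenvalue symA.
have [a Ea Ha] := @min_is_eigenvalue (fun z z' => - A z z') (fun z z' => congr1 _ (symA z z')).
have Ea' : is_eigenvalue A (- a).
  have [v [v0 Hv]] := Ea; exists v; split => // z.
  by rewrite mulNr -Hv -sumrN; apply: eq_bigr => z' _; rewrite mulNr opprK.
pose z0 : trt K := [ffun=> false].
have a1 : 1 <= - a.
  have := Ha (fun z => (z == z0)%:R).
  rewrite /qform (bigD1 z0) //= big1 ?addr0; last first.
    by move=> z /negbTE ->; rewrite expr0n.
  rewrite [X in _ <= X -> _](bigD1 z0) //= [X in _ + X]big1 ?addr0; last first.
    by move=> z /negbTE ->; rewrite big1 // => z' _; rewrite !mul0r.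
  rewrite (bigD1 z0) //= big1 ?addr0; last by move=> z /negbTE ->; rewrite mulr0.
  by rewrite eqxx diagA expr1n /=; lra.
have sb : 1 <= s * b := le_trans a1 (cond _ _ Ea' Eb).
have u0 : 0 <= \sum_z u z ^+ 2 by apply: sumr_ge0 => z _; exact: sqr_ge0.
have := ler_wpM2r u0 sb; have := ler_wpM2l s0 (Hb u); lra.
Qed.

End Rayleigh.

(** * Factorial contrasts *)

Section Walsh.
Context {R : realType} {K : nat}.
Local Notation g := (@g R K).
Local Notation Q := (@Q R K).
Implicit Types (S : {set 'I_K}) (z : trt K) (M : {set {set 'I_K}}) (f b : trt K -> R).

Lemma Q_gt0 : 0 < Q. Proof. by rewrite /Q ltr0n expn_gt0. Qed.

Lemma card_trt : #|{: trt K}| = (2 ^ K)%N.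
Proof. by rewrite card_ffun card_bool card_ord. Qed.

Lemma g_sq S z : g S z ^+ 2 = 1.
Proof.
rewrite /g -prodrXl big1 // => k _; case: (z k) => /=; first by rewrite mulr1; ring.
by rewrite mulr0 sub0r sqrrN expr1n.
Qed.

(** The sum over subsets factors as the product of 1 + x_k, and a coordinate where z and z' differ
    contributes the factor 1 - 1. *)
Lemma sum_g_g z z' : \sum_S g S z * g S z' = Q * (z == z')%:R.
Proof.
pose x k : R := (2 * (nat_of_bool (z k))%:R - 1) * (2 * (nat_of_bool (z' k))%:R - 1).
transitivity (\prod_k (x k + 1)).
  rewrite bigA_distr; apply: eq_bigr => S _.
  rewrite /g -big_split /= big_mkcond /=; apply: eq_bigr => k _.
  by case: (k \in S).
have [E|zz'] := eqVneq z z'.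
  rewrite mulr1 (eq_bigr (fun=> 2)); first by rewrite prodr_const card_ord /Q natrX.
  by move=> k _; rewrite /x -E; case: (z k) => /=; ring.
rewrite mulr0; have [k zk] : exists k, z k != z' k.
  apply/existsP; rewrite -negb_forall; apply: contraNN zz' => /forallP H.
  by apply/eqP/ffunP => k; apply/eqP.
rewrite (bigD1 k) //= /x.
by move: zk; case: (z k); case: (z' k) => //= _; rewrite (_ : _ + 1 = 0) ?mul0r //; ring.
Qed.

Definition flip k z : trt K := [ffun l => if l == k then ~~ z l else z l].

Lemma flipK k : involutive (flip k).
Proof. by move=> z; apply/ffunP => l; rewrite !ffunE; case: eqP => // _; rewrite negbK. Qed.

Lemma g_flip S k z : g S (flip k z) = (if k \in S then - g S z else g S z).
Proof.
case: ifPn => kS; last first.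
  apply: eq_bigr => l lS; rewrite ffunE; case: eqP => // E.
  by rewrite -E lS in kS.
rewrite /g (bigD1 k) //= [in RHS](bigD1 k) //= -mulNr; congr (_ * _).
  by rewrite ffunE eqxx; case: (z k) => /=; ring.
by apply: eq_bigr => l /andP[_ /negbTE lk]; rewrite ffunE lk.
Qed.

(** Flipping a coordinate that lies in exactly one of the two sets negates every product. *)
Lemma g_ortho S S' : S != S' -> \sum_z g S z * g S' z = 0.
Proof.
move=> SS'.
have [k kk] : exists k, (k \in S) != (k \in S').
  apply/existsP; rewrite -negb_forall; apply: contraNN SS' => /forallP H.
  by apply/eqP/setP => k; apply/eqP.
have : \sum_z g S z * g S' z = - \sum_z g S z * g S' z.
  rewrite [LHS](reindex_inj (inv_inj (flipK k))) -sumrN; apply: eq_bigr => z _.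
  by rewrite !g_flip; move: kk; case: (k \in S); case: (k \in S') => //= _; ring.
lra.
Qed.

Lemma sqr_sum_le (I : finType) (P : pred I) (x : I -> R) :
  (\sum_(i | P i) x i) ^+ 2 <= #|P|%:R * \sum_(i | P i) x i ^+ 2.
Proof.
have h : 0 <= \sum_(i | P i) \sum_(j | P j) (x i - x j) ^+ 2.
  by apply: sumr_ge0 => i _; apply: sumr_ge0 => j _; exact: sqr_ge0.
suff E : \sum_(i | P i) \sum_(j | P j) (x i - x j) ^+ 2 =
   2 * (#|P|%:R * \sum_(i | P i) x i ^+ 2) - 2 * (\sum_(i | P i) x i) ^+ 2 by lra.
rewrite (eq_bigr (fun i => #|P|%:R * x i ^+ 2 - 2 * (\sum_(j | P j) x j) * x i
    + \sum_(j | P j) x j ^+ 2)).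
  rewrite !big_split /= sumrN -!big_distrr /= sumr_const -[_ *+ _]mulr_natl; ring.
move=> i _; rewrite (eq_bigr (fun j => x i ^+ 2 - 2 * x i * x j + x j ^+ 2)); last by move=> j _; ring.
rewrite !big_split /= sumrN -!big_distrr /= sumr_const -[_ *+ _]mulr_natl; ring.
Qed.

(** Parseval: the columns outside M pair to zero with b, so dropping them from f changes nothing.
    With b = [Ybar] and the true model this makes the restricted weights unbiased for gamma. *)
Lemma dotv_fproj M f b : (forall S, S \notin M -> \sum_z g S z * b z = 0) ->
  dotv (fproj M f) b = dotv f b.
Proof.
move=> H; have Q0 : Q != 0 by rewrite gt_eqF // Q_gt0.
rewrite /dotv /fproj.
transitivity (Q^-1 * \sum_S (\sum_z g S z * f z) * (\sum_z g S z * b z)).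
  rewrite [in RHS](bigID (mem M)) /= [X in _ + X]big1 ?addr0; last first.
    by move=> S SM; rewrite H // mulr0.
  rewrite big_distrr /= (eq_bigr (fun z => \sum_(S in M) Q^-1 * ((\sum_z' g S z' * f z') * (g S z * b z)))); last first.
    by move=> z _; rewrite -mulrA big_distrl big_distrr /=; apply: eq_bigr => S _; ring.
  rewrite exchange_big /=; apply: eq_bigr => S _.
  by rewrite -!big_distrr.
transitivity (Q^-1 * \sum_z \sum_z' f z * b z' * (\sum_S g S z * g S z')).
  congr (_ * _); rewrite (eq_bigr (fun S => \sum_z \sum_z' f z * b z' * (g S z * g S z'))); last first.
    move=> S _; rewrite big_distrl; apply: eq_bigr => z _; rewrite big_distrr /=.
    by apply: eq_bigr => z' _; ring.
  rewrite exchange_big /=; apply: eq_bigr => z _; rewrite exchange_big /=.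
  by apply: eq_bigr => z' _; rewrite -big_distrr.
rewrite big_distrr; apply: eq_bigr => z _ /=.
rewrite (bigD1 z) //= [X in _ + X]big1 ?addr0; last first.
  by move=> z' zz'; rewrite sum_g_g eq_sym (negbTE zz') !mulr0.
by rewrite sum_g_g eqxx mulr1 mulrC mulfK.
Qed.

(** All entries of g_S are 1 or -1, so Cauchy-Schwarz over the columns in M bounds an entry by the
    squared coefficients, which orthogonality turns back into the squared norm. *)
Lemma fproj_delocalized M f z :
  fproj M f z ^+ 2 <= #|M|%:R / Q * \sum_z' fproj M f z' ^+ 2.
Proof.
have Q0 := Q_gt0; have Qn : Q != 0 by rewrite gt_eqF.
have [a aE] : exists a : {set 'I_K} -> R, forall S, \sum_z' g S z' * f z' = a S by eexists.
have pE z' : fproj M f z' = Q^-1 * \sum_(S in M) g S z' * a S.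
  by congr (_ * _); apply: eq_bigr => S _; rewrite aE.
have E : \sum_z' fproj M f z' ^+ 2 = Q^-1 * \sum_(S in M) a S ^+ 2.
  rewrite (eq_bigr (fun z' => \sum_(S in M) \sum_(S' in M) Q^-2 * (a S * a S') * (g S z' * g S' z'))); last first.
    move=> z' _; rewrite pE exprMn [X in _ * X = _]expr2 big_distrl big_distrr /=.
    apply: eq_bigr => S _; rewrite !big_distrr /=; apply: eq_bigr => S' _.
    by field.
  rewrite exchange_big big_distrr /=; apply: eq_bigr => S SM.
  rewrite exchange_big /= (bigD1 S) //= [X in _ + X]big1 ?addr0; last first.
    by move=> S' /andP[_ SS']; rewrite -big_distrr /= g_ortho 1?eq_sym // mulr0.
  rewrite -big_distrr /= (eq_bigr (fun=> 1)); last by move=> z' _; rewrite -expr2 g_sq.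
  rewrite sumr_const card_trt -/Q; field.
  by [].
rewrite E pE exprMn.
have h : (\sum_(S in M) g S z * a S) ^+ 2 <= #|M|%:R * \sum_(S in M) a S ^+ 2.
  apply: (le_trans (@sqr_sum_le _ (mem M) _)).
  rewrite (eq_bigr (fun S => a S ^+ 2)) //.
  by move=> S _; rewrite exprMn g_sq mul1r.
have := ler_wpM2l (sqr_ge0 Q^-1) h.
by move/le_trans; apply; rewrite le_eqVlt; apply/orP; left; apply/eqP; field.
Qed.

End Walsh.

(** * Regular designs *)

Section QuadraticForms.
Context {R : realType} {K N : nat} (Nz : trt K -> nat) (Y : 'I_N -> trt K -> R).

Lemma qform_diag (d u : trt K -> R) :
  qform (fun z z' => if z == z' then d z else 0) u = \sum_z u z ^+ 2 * d z.
Proof.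
apply: eq_bigr => z _; rewrite (bigD1 z) //= big1 ?addr0.
  by rewrite eqxx; ring.
by move=> z' zz'; rewrite eq_sym (negbTE zz') mulr0 mul0r.
Qed.

Lemma qform_Dmat u : qform (Dmat Y Nz) u = \sum_z u z ^+ 2 * ((Nz z)%:R^-1 * Smat Y z z).
Proof. exact: qform_diag. Qed.

Lemma qform_Vhat A u : qform (Vhat Y Nz A) u = \sum_z u z ^+ 2 * ((Nz z)%:R^-1 * Shat Y Nz A z).
Proof. exact: qform_diag. Qed.

Lemma qform_Smat_ge0 u : (1 < N)%N -> 0 <= qform (Smat Y) u.
Proof.
move=> N1.
have -> : qform (Smat Y) u = (N%:R - 1)^-1 * \sum_i (\sum_z u z * resid Y i z) ^+ 2.
  rewrite /qform /Smat.
  rewrite (eq_bigr (fun i => \sum_z \sum_z' (u z * resid Y i z) * (u z' * resid Y i z'))); last first.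
    move=> i _; rewrite expr2 big_distrl /=; apply: eq_bigr => z _.
    by rewrite big_distrr.
  rewrite [in RHS]exchange_big big_distrr /=; apply: eq_bigr => z _.
  rewrite [in RHS]exchange_big big_distrr /=; apply: eq_bigr => z' _.
  have -> : \sum_i (u z * resid Y i z) * (u z' * resid Y i z') =
      u z * u z' * \sum_i (Y i z - Ybar Y z) * (Y i z' - Ybar Y z').
    by rewrite big_distrr; apply: eq_bigr => i _; rewrite /resid /=; ring.
  ring.
have N1' : (0 : R) <= N%:R - 1 by rewrite subr_ge0 ler1n ltnW.
rewrite mulr_ge0 ?invr_ge0 //.
by apply: sumr_ge0 => i _; exact: sqr_ge0.
Qed.

Lemma qform_Vmat_le u : (1 < N)%N -> qform (Vmat Y Nz) u <= qform (Dmat Y Nz) u.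
Proof.
move=> N1.
have -> : qform (Vmat Y Nz) u = qform (Dmat Y Nz) u - N%:R^-1 * qform (Smat Y) u.
  rewrite /qform big_distrr -sumrB; apply: eq_bigr => z _ /=.
  rewrite big_distrr -sumrB; apply: eq_bigr => z' _ /=.
  by rewrite /Vmat; ring.
by rewrite gerBl mulr_ge0 ?invr_ge0 // qform_Smat_ge0.
Qed.

Lemma Smat_sym z z' : Smat Y z z' = Smat Y z' z.
Proof. by rewrite /Smat; congr (_ * _); apply: eq_bigr => i _; rewrite mulrC. Qed.

Lemma Vmat_sym z z' : Vmat Y Nz z z' = Vmat Y Nz z' z.
Proof.
rewrite /Vmat /Dmat (Smat_sym z z'); have [->|/negbTE zz'] := eqVneq z z' => //.
Qed.

End QuadraticForms.

Section RegularDesign.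
Context {R : realType} {K N : nat} (Nz : trt K -> nat) (Y : 'I_N -> trt K -> R).
Local Notation asg := {ffun 'I_N -> trt K}.
Local Notation Omega := (@assignments K N Nz).
Local Notation Ex := (@Ex R K N Nz).
Local Notation Q := (@Q R K).
Hypothesis Nz_sum : (\sum_(z : trt K) Nz z)%N = N.
Hypothesis N_gt1 : (1 < N)%N.
Hypothesis Nz_gt1 : forall z, (1 < Nz z)%N.
Variables (rho M Smin : R).
Hypothesis Smin_gt0 : 0 < Smin.
Hypothesis rho_gt0 : 0 < rho.
Hypothesis Nz_lb : forall z, N%:R <= rho * (Q * (Nz z)%:R).
Hypothesis Nz_ub : forall z, Q * (Nz z)%:R <= rho * N%:R.
Hypothesis Smin_le : forall z, Smin <= Smat Y z z.
Hypothesis resid_le : forall i z, resid Y i z ^+ 2 <= M ^+ 2 * Smin.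

Let N0 : (0 : R) < N%:R. Proof. by rewrite ltr0n ltnW. Qed.
Let Nz0 z : (0 : R) < (Nz z)%:R. Proof. by rewrite ltr0n ltnW. Qed.
Let Q0 : 0 < Q. Proof. exact: Q_gt0. Qed.

Let QNi_ge0 z : 0 <= (Q * (Nz z)%:R)^-1.
Proof. by rewrite invr_ge0 mulr_ge0 // ltW. Qed.
Let rN_ge0 : 0 <= rho / N%:R. Proof. by rewrite divr_ge0 // ltW. Qed.
Let MS_ge0 : 0 <= M ^+ 2 * Smin. Proof. by apply: mulr_ge0; [exact: sqr_ge0 | exact: ltW]. Qed.
Let k2_ge0 : 0 <= rho ^+ 3 * M ^+ 2 / N%:R.
Proof.
apply: divr_ge0; last exact: ltW.
by apply: mulr_ge0; [apply: exprn_ge0; exact: ltW | exact: sqr_ge0].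
Qed.

Lemma inv_Nz_le z : (Q * (Nz z)%:R)^-1 <= rho / N%:R.
Proof.
by rewrite ler_pdivlMr // mulrC ler_pdivrMr ?mulr_gt0 //.
Qed.

Lemma inv_Nz_ge z : (rho * N%:R)^-1 <= (Q * (Nz z)%:R)^-1.
Proof. by rewrite lef_pV2 ?posrE ?mulr_gt0. Qed.

Lemma sum_trt_cst (a : R) : \sum_(z : trt K) a = Q * a.
Proof. by rewrite sumr_const card_trt -mulr_natl. Qed.

(** The variance of an effect estimate with V replaced by the larger D; it is the same for all
    effects since g_S(z)^2 = 1. *)
Definition sig2 : R := Q^-2 * \sum_z (Nz z)%:R^-1 * Smat Y z z.

Lemma sig2E : sig2 = Q^-1 * \sum_z (Q * (Nz z)%:R)^-1 * Smat Y z z.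
Proof.
rewrite /sig2 !big_distrr /=; apply: eq_bigr => z _.
by field; rewrite !gt_eqF.
Qed.

Lemma sig2_lb : Smin / (rho * N%:R) <= sig2.
Proof.
rewrite sig2E ler_pdivlMl // -sum_trt_cst; apply: ler_sum => z _.
rewrite mulrC; apply: ler_pM => //; [by rewrite invr_ge0 mulr_ge0 // ltW | exact: ltW | exact: inv_Nz_ge].
Qed.

Lemma sig2_gt0 : 0 < sig2.
Proof. by apply: lt_le_trans sig2_lb; rewrite divr_gt0 // mulr_gt0. Qed.

Lemma sig2_ub (D : R) : (forall z, Smat Y z z <= D) -> sig2 <= rho * D / N%:R.
Proof.
move=> SD; rewrite sig2E ler_pdivrMl // -sum_trt_cst; apply: ler_sum => z _.
rewrite mulrAC; apply: ler_pM => //; last exact: inv_Nz_le.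
exact: le_trans (ltW Smin_gt0) (Smin_le z).
Qed.

Definition tauw (S : {set 'I_K}) (z : trt K) : R := g S z / (Q * Num.sqrt sig2).

Let sq0 : 0 < Num.sqrt sig2. Proof. by rewrite sqrtr_gt0 sig2_gt0. Qed.

Lemma linstat_tauw S A : A \in Omega ->
  linstat (coefs Nz Y (tauw S)) A = (tauhat Y Nz A S - tau Y S) / Num.sqrt sig2.
Proof.
move=> HA; rewrite linstat_coefs // /tauhat /tau -mulrBr -sumrB -sumrB.
rewrite big_distrr big_distrl /=; apply: eq_bigr => z _.
by rewrite /tauw; field; rewrite !gt_eqF.
Qed.

(** [Smin] cancels between the residual bound M^2 [Smin] and [sig2] >= [Smin] / (rho N), which
    leaves coefficients of order N^(-1/2). *)
Lemma coefs_tauw_le S i z : `|coefs Nz Y (tauw S) i z| <= Num.sqrt (rho ^+ 3 * M ^+ 2 / N%:R).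
Proof.
rewrite -[leLHS]sqrtr_sqr ler_sqrt //.
have -> : coefs Nz Y (tauw S) i z ^+ 2 = ((Q * (Nz z)%:R)^-1) ^+ 2 * (resid Y i z ^+ 2 / sig2).
  rewrite /coefs /tauw !exprMn g_sq !exprVn !exprMn sqr_sqrtr ?(ltW sig2_gt0) //.
  by field; rewrite !gt_eqF ?sig2_gt0.
have h1 : resid Y i z ^+ 2 / sig2 <= M ^+ 2 * (rho * N%:R).
  rewrite ler_pdivrMr ?sig2_gt0 //; apply: (le_trans (resid_le i z)).
  rewrite -[leRHS]mulrA ler_wpM2l ?sqr_ge0 //.
  by have := sig2_lb; rewrite ler_pdivrMr ?mulr_gt0 // mulrC.
have h2 : (Q * (Nz z)%:R)^-1 ^+ 2 <= (rho / N%:R) ^+ 2.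
  by rewrite lerXn2r ?nnegrE ?inv_Nz_le.
apply: (@le_trans _ _ ((rho / N%:R) ^+ 2 * (M ^+ 2 * (rho * N%:R)))).
  by apply: ler_pM => //; [exact: sqr_ge0 | apply: divr_ge0; [exact: sqr_ge0 | exact/ltW/sig2_gt0]].
by rewrite le_eqVlt; apply/orP; left; apply/eqP; field; rewrite gt_eqF.
Qed.

Lemma Ex_tauw_sq_le1 S : Ex (fun A => linstat (coefs Nz Y (tauw S)) A ^+ 2) <= 1.
Proof.
rewrite Ex_linstat_coefs_sq //; apply: (le_trans (qform_Vmat_le _ _ _ N_gt1)).
rewrite qform_Dmat (eq_bigr (fun z => (Q ^- 2 / sig2) * ((Nz z)%:R^-1 * Smat Y z z))); last first.
  move=> z _; rewrite /tauw exprMn g_sq exprVn exprMn sqr_sqrtr ?(ltW sig2_gt0) //.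
  by field; rewrite !gt_eqF ?sig2_gt0.
by rewrite -big_distrr /= mulrAC -/sig2 mulfV ?lexx // gt_eqF // sig2_gt0.
Qed.

(** The ratio [sighat2] / [sig2], which does not depend on the effect. *)
Definition s2ratio (A : asg) : R := \sum_z (Q ^- 2 / (Nz z)%:R / sig2) * Shat Y Nz A z.

Lemma sighat2E A S : sighat2 Y Nz A S = sig2 * s2ratio A.
Proof.
rewrite /sighat2 qform_Vhat /s2ratio !big_distrr /=; apply: eq_bigr => z _.
by rewrite g_sq; field; rewrite !gt_eqF ?sig2_gt0.
Qed.

Lemma Ex_s2ratio : Ex s2ratio = 1.
Proof.
rewrite /s2ratio Ex_sum (eq_bigr (fun z => (Q ^- 2 / sig2) * ((Nz z)%:R^-1 * Smat Y z z))).
  by rewrite -big_distrr /= mulrAC -/sig2 mulfV // gt_eqF // sig2_gt0.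
by move=> z _; rewrite ExZ Ex_Shat //; field; rewrite !gt_eqF ?sig2_gt0.
Qed.

Lemma s2ratio_swap_lip : swap_lip Nz (40 * (rho ^+ 3 * M ^+ 2 / N%:R)) s2ratio.
Proof.
have rl i z : `|resid Y i z| <= Num.sqrt (M ^+ 2 * Smin).
  by rewrite -sqrtr_sqr ler_sqrt ?resid_le.
have wb z : `|Q ^- 2 / (Nz z)%:R / sig2| / (Nz z)%:R <= (rho / N%:R) ^+ 2 / sig2.
  rewrite gtr0_norm; last by rewrite !divr_gt0 ?sig2_gt0 // invr_gt0 exprn_gt0.
  rewrite [leLHS](_ : _ = ((Q * (Nz z)%:R)^-1) ^+ 2 / sig2); last by field; rewrite !gt_eqF ?sig2_gt0.
  rewrite ler_wpM2r ?invr_ge0 ?(ltW sig2_gt0) //.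
  by rewrite lerXn2r ?nnegrE ?inv_Nz_le.
move=> A i j HA; apply: (le_trans (wShat_swap_le Nz_gt1 rl wb i j HA)).
rewrite sqr_sqrtr //.
have h1 : M ^+ 2 * Smin / sig2 <= M ^+ 2 * (rho * N%:R).
  rewrite -[leLHS]mulrA ler_wpM2l ?sqr_ge0 // ler_pdivrMr ?sig2_gt0 //.
  by have := sig2_lb; rewrite ler_pdivrMr ?mulr_gt0 // mulrC.
have := ler_wpM2l (sqr_ge0 (rho / N%:R)) h1.
have -> : (rho / N%:R) ^+ 2 * (M ^+ 2 * (rho * N%:R)) = rho ^+ 3 * M ^+ 2 / N%:R by field; rewrite gt_eqF.
lra.
Qed.

End RegularDesign.

(** * Critical values *)

Section PhiInv.
Context {R : realType}.
Implicit Types p z t : R.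
Local Notation P := (normal_peak (1 : R)).

Lemma Phi_lt_mono (x y : R) : x < y -> Phi x < Phi y.
Proof.
move=> xy; have [s _ E] := mean_value Phi_derive (ltW xy).
by rewrite -subr_gt0 E mulr_gt0 ?phi_gt0 // subr_gt0.
Qed.

Lemma Phi0 : Phi 0 = 1 / 2 :> R.
Proof. by have := @PhiN R 0; rewrite oppr0; lra. Qed.

Lemma Phi_inv_has_inf p : p < 1 -> 1 / 2 <= p -> has_inf [set t : R | p <= Phi t]%classic.
Proof.
move=> p1 p2; split.
  have [a H] := @Phi_y R (1 - p) ltac:(lra).
  by exists a => /=; have := H a (lexx a); lra.
exists 0 => t /= pt; rewrite leNgt; apply/negP => t0.
by have := Phi_lt_mono t0; rewrite Phi0; lra.
Qed.

Lemma Phi_inv_ge0 p : p < 1 -> 1 / 2 <= p -> 0 <= Phi_inv p.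
Proof.
move=> p1 p2; have [hn hb] := Phi_inv_has_inf p1 p2.
apply: lb_le_inf => // t /= pt; rewrite leNgt; apply/negP => t0.
by have := Phi_lt_mono t0; rewrite Phi0; lra.
Qed.

Lemma Phi_inv_le p t : p < 1 -> 1 / 2 <= p -> p <= Phi t -> Phi_inv p <= t.
Proof.
move=> p1 p2 pt; have [hn hb] := Phi_inv_has_inf p1 p2.
exact: ge_inf.
Qed.

Lemma Phi_Phi_inv p : p < 1 -> 1 / 2 <= p -> p <= Phi (Phi_inv p).
Proof.
move=> p1 p2; have hi := Phi_inv_has_inf p1 p2.
have P0 : 0 < P := peak_gt0.
apply/ler_addgt0Pr => e e0.
have e1 : 0 < e / P by rewrite divr_gt0.
have [t /= pt tz] := @inf_adherent _ _ _ e1 hi.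
have zt : Phi_inv p <= t by exact: Phi_inv_le.
have := Phi_lip zt.
have : P * (t - Phi_inv p) <= P * (e / P) by rewrite ler_pM2l //; rewrite /Phi_inv; lra.
rewrite mulrCA mulfV ?gt_eqF // mulr1; lra.
Qed.

(* (z + 1)^2 <= (1 + zeta) z^2 + 1 + zeta^-1 trades the shift by one for the loss of [zeta]. *)
Lemma Phi_inv_lb p zeta : 0 < p -> p <= 1 -> 0 < zeta ->
  - ln p + ln (2 * P) - (1 + zeta^-1) / 2 <= Phi_inv (1 - p / 2) ^+ 2 / 2 * (1 + zeta).
Proof.
move=> p0 p1 z0; set z := Phi_inv _.
have P0 : 0 < P := peak_gt0.
have h1 : 1 - p / 2 < 1 by lra.
have h2 : 1 / 2 <= 1 - p / 2 by lra.
have zz := Phi_Phi_inv h1 h2; rewrite -/z in zz.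
have z_ge0 : 0 <= z by exact: Phi_inv_ge0.
(* The mean value theorem on [z, z + 1] bounds phi(z + 1) by the tail mass beyond z, at most p / 2;
   this is the origin of the shift by one. *)
have [s /andP[s1 s2] E] := @mean_value R Phi phi z (z + 1) Phi_derive ltac:(lra).
have := Phi_le1 (z + 1).
have zs : z + 1 - z = 1 by ring.
rewrite zs mulr1 in E.
have ps : phi (z + 1) <= phi s.
  rewrite !phiE ler_pM2l // ler_expR lerN2 ler_pM2r //.
  by rewrite lerXn2r ?nnegrE //; lra.
move=> h3; have h4 : phi (z + 1) <= p / 2 by lra.
have h5 : P * expR (- ((z + 1) ^+ 2 / 2)) <= p / 2 by rewrite -phiE.
have h6 : expR (- ((z + 1) ^+ 2 / 2)) <= p / (2 * P).
  by rewrite ler_pdivlMr ?mulr_gt0 //; lra.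
have pP : 0 < p / (2 * P) by rewrite divr_gt0 // mulr_gt0.
have h7 : - ((z + 1) ^+ 2 / 2) <= ln p - ln (2 * P).
  rewrite -ln_div ?posrE ?mulr_gt0 // -[leLHS]expRK ler_ln ?posrE ?expR_gt0 //.
have zi : 0 < zeta^-1 by rewrite invr_gt0.
have h8 : (z + 1) ^+ 2 <= (1 + zeta) * z ^+ 2 + (1 + zeta^-1).
  have : 0 <= zeta^-1 * (zeta * z - 1) ^+ 2 by rewrite mulr_ge0 ?sqr_ge0 // ltW.
  have -> : zeta^-1 * (zeta * z - 1) ^+ 2 = zeta * z ^+ 2 - 2 * z + zeta^-1 by field; rewrite gt_eqF.
  lra.
lra.
Qed.

(** The right-hand side is the t solving [normal_peak 1] e^(1/2 - t) = p / 2. Growth linear in - ln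
    p is enough where critical values only have to be polynomial in ln N. *)
Lemma Phi_inv_ub p : 0 < p -> p <= 1 -> Phi_inv (1 - p / 2) <= 2^-1 + ln (2 * P) - ln p.
Proof.
move=> p0 p1; have P0 : 0 < P := peak_gt0.
apply: Phi_inv_le; [lra | lra |].
set t := 2^-1 + ln (2 * P) - ln p.
have h := @Phi_le_expR R (- t); rewrite PhiN in h.
have e : expR (2^-1 + - t) * P = p / 2.
  rewrite (_ : 2^-1 + - t = ln p - ln (2 * P)); last by rewrite /t; ring.
  rewrite expRB !lnK ?posrE ?mulr_gt0 //; field; rewrite gt_eqF //.
lra.
Qed.

End PhiInv.

(** * Screening *)

Section LinstatTail.
Context {R : realType} {K N : nat} (Nz : trt K -> nat).
Hypothesis Nz_sum : (\sum_(z : trt K) Nz z)%N = N.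
Hypothesis N_gt0 : (0 < N)%N.

Lemma linstat_opp (c : 'I_N -> trt K -> R) A :
  linstat (fun i z => - c i z) A = - linstat c A.
Proof. by rewrite /linstat sumrN. Qed.

(** Chernoff with parameter t = x, applied to the statistic and to its opposite: - x^2 + x^2 (1 +
    2z) / 2 is the exponent obtained. *)
Lemma linstat_tail (c : 'I_N -> trt K -> R) (k z x : R) :
  (forall z, \sum_i c i z = 0) -> (forall i z, `|c i z| <= k) -> 0 < k ->
  Ex Nz (fun A => linstat c A ^+ 2) <= 1 -> 0 < z -> 0 <= x ->
  4 * N%:R * k ^+ 2 * expR (256 * N%:R * x ^+ 2 * k ^+ 2 - z ^+ 2 / (128 * 128 * N%:R * k ^+ 4)) <= z ->
  prob Nz (fun A => x <= `|linstat c A|) <= 2 * expR (- (x ^+ 2 / 2 * (1 - 2 * z))).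
Proof.
move=> c0 ck k0 W1 z0 x0 H.
have m1 := linstat_mgf_le Nz_sum N_gt0 c0 ck k0 W1 z0 x0 H.
have m2 : Ex Nz (fun A => expR (x * linstat (fun i z => - c i z) A)) <= expR (x ^+ 2 / 2 * (1 + 2 * z)).
  apply: (linstat_mgf_le Nz_sum N_gt0 _ _ k0 _ z0 x0 H).
  - by move=> t; rewrite sumrN c0 oppr0.
  - by move=> i t; rewrite normrN.
  - by apply: le_trans W1; apply: le_Ex => A _; rewrite linstat_opp sqrrN.
rewrite prob_Ex.
pose w (A : {ffun 'I_N -> trt K}) := expR (- x ^+ 2) * (expR (x * linstat c A) + expR (x * linstat (fun i z => - c i z) A)).
apply: (@le_trans _ _ (Ex Nz w)).
  apply: le_Ex => A _; rewrite /w linstat_opp mulrDr -!expRD.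
  have [h|_] := leP x `|linstat c A|; last by rewrite addr_ge0 ?expR_ge0.
  have [s|s] := leP 0 (linstat c A).
    rewrite ger0_norm // in h.
    apply: (@le_trans _ _ (expR (- x ^+ 2 + x * linstat c A))); last by rewrite lerDl expR_ge0.
    by rewrite -expR0 ler_expR; nra.
  rewrite ltr0_norm // in h.
  apply: (@le_trans _ _ (expR (- x ^+ 2 + x * - linstat c A))); last by rewrite lerDr expR_ge0.
  by rewrite -expR0 ler_expR; nra.
rewrite /w ExZ ExD.
have h : expR (- x ^+ 2) * (expR (x ^+ 2 / 2 * (1 + 2 * z)) + expR (x ^+ 2 / 2 * (1 + 2 * z)))
     = 2 * expR (- (x ^+ 2 / 2 * (1 - 2 * z))).
  transitivity (2 * (expR (- x ^+ 2) * expR (x ^+ 2 / 2 * (1 + 2 * z)))); first by ring.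
  by rewrite -expRD; congr (2 * expR _); field.
rewrite -h ler_wpM2l ?expR_ge0 //; exact: lerD.
Qed.

End LinstatTail.

Section Screening.
Context {R : realType} {K N : nat} (Nz : trt K -> nat) (Y : 'I_N -> trt K -> R).
Local Notation asg := {ffun 'I_N -> trt K}.
Variables (h : heredity) (alpha : nat -> R).
Local Notation Ms := (Mstar Y).
Hypothesis C4 : forall S, S \in Mstar1 Y -> parent_ok h Ms S.

Lemma in_Mstar S : (S \in Ms) = (S == finset.set0) || (S \in Mstar1 Y).
Proof. by rewrite !inE. Qed.

Lemma tau_out S : S \notin Ms -> tau Y S = 0.
Proof.
rewrite in_Mstar inE negb_or => /andP[-> /=]; rewrite negbK => /eqP -> //.
Qed.

(** Parents of a set of size d + 1 have size d, so the candidates see only that level of the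
    model. *)
Lemma eq_cands (M M' : {set {set 'I_K}}) d :
  (forall S : {set 'I_K}, #|S| = d -> (S \in M) = (S \in M')) -> cands h M d.+1 = cands h M' d.+1.
Proof.
move=> MM'; apply/setP => S; rewrite !inE; case: eqP => //= cS.
have sub k : k \in S -> (S :\ k \in M) = (S :\ k \in M').
  move=> kS; apply: MM'; apply/eqP; rewrite -eqSS -cS (cardsD1 k S) kS; exact: eqxx.
rewrite /parent_ok; case: h.
  by apply: eq_existsb => k; case kS: (k \in S) => //=; exact: sub.
by apply: eq_forallb => k; case kS: (k \in S) => //=; exact: sub.
Qed.

(** The critical value computed from the true model: deterministic, and equal to the one in use as
    long as the lower levels are selected correctly. *)
Definition crit d : R :=
  Phi_inv (1 - minr (alpha d / (#|cands h Ms d|)%:R) 1 / 2).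

(** By induction the model after level d is the part of the true one of size at most d. An active
    set that is not a candidate would contradict heredity, and the empty set is present from the
    start. *)
Lemma screen_Mstar A :
  (forall d S, (d < K)%N -> S \in cands h Ms d.+1 ->
     (crit d.+1 <= `|tauhat Y Nz A S / Num.sqrt (sighat2 Y Nz A S)|) = (S \in Ms)) ->
  screen Y Nz A h alpha K = Ms.
Proof.
move=> sel.
suff H d : (d <= K)%N -> screen Y Nz A h alpha d = [set S in Ms | (#|S| <= d)%N].
  rewrite H //; apply/setP => S; rewrite inE.
  by rewrite -[X in (_ <= X)%N]card_ord max_card andbT.
elim: d => [_|d IH dK].
  apply/setP => S; rewrite !inE leqn0 cards_eq0.
  by case: eqP => // _; rewrite andbF.
have {}IH := IH (ltnW dK).
rewrite /= /screen_step IH.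
have -> : cands h [set S in Ms | (#|S| <= d)%N] d.+1 = cands h Ms d.+1.
  by apply: eq_cands => S cS; rewrite inE cS leqnn andbT.
apply/setP => S; rewrite [LHS]inE [X in X || _]inE [X in _ || X]inE [RHS]inE.
rewrite [(#|S| <= d.+1)%N]leq_eqVlt ltnS.
have [cS|cS] := eqVneq #|S| d.+1; last first.
  by rewrite [S \in cands _ _ _]inE (negbTE cS) /= orbF.
rewrite cS ltnn andbF /= andbT.
have [SC|SC] := boolP (S \in cands h Ms d.+1); first by rewrite -(sel _ _ dK SC).
apply/esym/negbTE; apply: contraNN SC; rewrite in_Mstar => /orP[/eqP S0|SM].
  by move: cS; rewrite S0 cards0.
by rewrite inE cS eqxx C4.
Qed.

End Screening.

Section ScreeningError.
Context {R : realType} {K N : nat} (Nz : trt K -> nat) (Y : 'I_N -> trt K -> R).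
Local Notation asg := {ffun 'I_N -> trt K}.
Local Notation Q := (@Q R K).
Hypothesis Nz_sum : (\sum_(z : trt K) Nz z)%N = N.
Hypothesis N_gt1 : (1 < N)%N.
Hypothesis Nz_gt1 : forall z, (1 < Nz z)%N.
Variables (rho M Smin : R).
Hypothesis Smin_gt0 : 0 < Smin.
Hypothesis rho_gt0 : 0 < rho.
Hypothesis M_gt0 : 0 < M.
Hypothesis Nz_lb : forall z, N%:R <= rho * (Q * (Nz z)%:R).
Hypothesis Nz_ub : forall z, Q * (Nz z)%:R <= rho * N%:R.
Hypothesis Smin_le : forall z, Smin <= Smat Y z z.
Hypothesis resid_le : forall i z, resid Y i z ^+ 2 <= M ^+ 2 * Smin.
Variables (h : heredity) (alpha : nat -> R).
Local Notation Ms := (Mstar Y).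
Hypothesis C4 : forall S, S \in Mstar1 Y -> parent_ok h Ms S.

Local Notation kap := (rho ^+ 3 * M ^+ 2).
Local Notation sD := (Num.sqrt (sig2 Nz Y)).
Local Notation W S := (linstat (coefs Nz Y (tauw Nz Y S))).

Let N0 : (0 : R) < N%:R. Proof. by rewrite ltr0n ltnW. Qed.
Let kap0 : 0 < kap. Proof. by rewrite mulr_gt0 ?exprn_gt0. Qed.
Let s0 : 0 < sig2 Nz Y.
Proof. exact: (@sig2_gt0 _ _ _ _ _ N_gt1 Nz_gt1 rho Smin). Qed.
Let sD0 : 0 < sD. Proof. by rewrite sqrtr_gt0. Qed.

Lemma s2ratio_tail zeta : 0 < zeta ->
  prob Nz (fun A => zeta <= `|s2ratio Nz Y A - 1|)
    <= 2 * expR (- (zeta ^+ 2 * N%:R / (32 * (40 * kap) ^+ 2))).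
Proof.
move=> z0.
have lip := @s2ratio_swap_lip _ _ _ _ _ N_gt1 Nz_gt1 _ _ _ Smin_gt0 rho_gt0 Nz_lb Nz_ub Smin_le resid_le.
have E1 : Ex Nz (s2ratio Nz Y) = 1.
  exact: (@Ex_s2ratio _ _ _ _ _ Nz_sum N_gt1 Nz_gt1 rho Smin).
have b0 : 0 < 40 * (kap / N%:R) by rewrite mulr_gt0 // divr_gt0.
have := swap_lip_tail Nz_sum (ltnW N_gt1) b0 z0 lip; rewrite E1.
move/le_trans; apply; rewrite le_eqVlt; apply/orP; left; apply/eqP.
by congr (_ * expR (- _)); field; rewrite !gt_eqF.
Qed.

(** A tail with a crude constant, enough for active effects, where y is a power of N. *)
Lemma W_tail S y : 0 < y ->
  prob Nz (fun A => y <= `|W S A|) <= 2 * expR (- (y ^+ 2 / (512 * kap))).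
Proof.
move=> y0.
have k0 : 0 < Num.sqrt (kap / N%:R) by rewrite sqrtr_gt0 divr_gt0.
have cle := @coefs_tauw_le _ _ _ _ _ N_gt1 Nz_gt1 _ _ _ Smin_gt0 rho_gt0 Nz_lb Nz_ub Smin_le resid_le S.
have lip : swap_lip Nz (4 * Num.sqrt (kap / N%:R)) (W S) := linstat_swap_lip cle.
have E0 : Ex Nz (W S) = 0.
  by apply: (Ex_linstat Nz_sum (ltnW N_gt1)) => z; exact: sum_coefs.
have b0 : 0 < 4 * Num.sqrt (kap / N%:R) by rewrite mulr_gt0.
have := swap_lip_tail Nz_sum (ltnW N_gt1) b0 y0 lip; rewrite E0.
have -> : prob Nz (fun A => y <= `|W S A - 0|) = prob Nz (fun A => y <= `|W S A|) :> R.
  by rewrite !prob_Ex; apply: eq_Ex => A _; rewrite subr0.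
move/le_trans; apply; rewrite le_eqVlt; apply/orP; left; apply/eqP.
rewrite exprMn sqr_sqrtr; last by rewrite ltW // divr_gt0.
by congr (_ * expR (- _)); field; rewrite !gt_eqF.
Qed.

(** Three losses combine: 1 - zeta from studentization, 1 - 2 zeta from the tail bound, 1 + zeta
    from the lower bound on the critical value. They fit in 1 - 4 zeta because (1 - zeta)(1 - 2
    zeta) >= (1 - 4 zeta)(1 + zeta). *)
Lemma W_sharp_tail S zeta p : 0 < zeta -> zeta < 1 / 4 -> 0 < p -> p <= 1 ->
  let z := Phi_inv (1 - p / 2) in
  4 * kap * expR (256 * kap * z ^+ 2 - zeta ^+ 2 * N%:R / (128 * 128 * kap ^+ 2)) <= zeta ->
  prob Nz (fun A => z * Num.sqrt (1 - zeta) <= `|W S A|) <=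
  2 * expR (- ((1 - 4 * zeta) * (- ln p + ln (2 * normal_peak 1) - (1 + zeta^-1) / 2))).
Proof.
move=> ze0 ze1 p0 p1 z H.
have k0 : 0 < Num.sqrt (kap / N%:R) by rewrite sqrtr_gt0 divr_gt0.
have cle := @coefs_tauw_le _ _ _ _ _ N_gt1 Nz_gt1 _ _ _ Smin_gt0 rho_gt0 Nz_lb Nz_ub Smin_le resid_le S.
have W1 := @Ex_tauw_sq_le1 _ _ _ _ _ Nz_sum N_gt1 Nz_gt1 _ _ Smin_gt0 rho_gt0 Nz_ub Smin_le S.
have z_ge0 : 0 <= z by apply: Phi_inv_ge0; lra.
have x0 : 0 <= z * Num.sqrt (1 - zeta) by rewrite mulr_ge0.
have x2 : (z * Num.sqrt (1 - zeta)) ^+ 2 = z ^+ 2 * (1 - zeta).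
  by rewrite exprMn sqr_sqrtr //; lra.
have k2 : Num.sqrt (kap / N%:R) ^+ 2 = kap / N%:R by rewrite sqr_sqrtr // ltW // divr_gt0.
have k4 : Num.sqrt (kap / N%:R) ^+ 4 = (kap / N%:R) ^+ 2 by rewrite -[in RHS]k2 -exprM.
have z2 := sqr_ge0 z.
have c0 t : \sum_i coefs Nz Y (tauw Nz Y S) i t = 0 by exact: sum_coefs.
have T := linstat_tail Nz_sum (ltnW N_gt1) c0 cle k0 W1 ze0 x0.
apply: (le_trans (T _)).
  rewrite k2 k4 x2; apply: le_trans H.
  have -> : 4 * N%:R * (kap / N%:R) = 4 * kap by field; rewrite gt_eqF.
  rewrite ler_pM2l ?mulr_gt0 // ler_expR.
  have -> : zeta ^+ 2 / (128 * 128 * N%:R * (kap / N%:R) ^+ 2) = zeta ^+ 2 * N%:R / (128 * 128 * kap ^+ 2).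
    by field; rewrite !gt_eqF.
  rewrite lerD2r.
  have -> : 256 * N%:R * (z ^+ 2 * (1 - zeta)) * (kap / N%:R) = 256 * kap * (z ^+ 2 * (1 - zeta)).
    by field; rewrite gt_eqF.
  rewrite ler_pM2l; last by rewrite mulr_gt0.
  by rewrite ler_piMr //; lra.
rewrite x2 ler_pM2l // ler_expR lerN2.
have lb := Phi_inv_lb p0 p1 ze0; rewrite -/z in lb.
have c1 : 0 <= 1 - 4 * zeta by lra.
apply: (le_trans (ler_wpM2l c1 lb)).
by have := mulr_ge0 (sqr_ge0 zeta) z2; lra.
Qed.

Let pval d : R := minr (alpha d / (#|cands h Ms d|)%:R) 1.

(** Three failures: of the common denominator, of some inactive candidate, of some active effect. In
    [bad_null] the ordinal starts at 0, so it stands for the level one above it. *)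
Let bad_ratio zeta A := zeta <= `|s2ratio Nz Y A - 1|.
Let bad_null zeta A := [exists dS : 'I_K * {set 'I_K},
  ((dS.2 \in cands h Ms dS.1.+1) && (dS.2 \notin Ms)) &&
  (crit Y h alpha dS.1.+1 * Num.sqrt (1 - zeta) <= `|W dS.2 A|)].
Let bad_active y A := [exists S : {set 'I_K}, (S \in Mstar1 Y) && (y <= `|W S A|)].

(** For an active effect the noise takes at most half of the margin 2 y sD, and the rest beats twice
    the critical value, which covers sqrt(r) <= 2 for the variance ratio r. For an inactive one
    sqrt(r) >= sqrt(1 - zeta). *)
Lemma screening_error_subset zeta y A : A \in @assignments K N Nz -> 0 < zeta -> zeta < 1 ->
  (forall d, (0 < d <= K)%N -> (0 < #|cands h Ms d|)%N -> 0 <= crit Y h alpha d /\ 2 * crit Y h alpha d <= y) ->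
  (forall S, S \in Mstar1 Y -> 2 * y * sD <= `|tau Y S|) ->
  screen Y Nz A h alpha K != Ms -> bad_ratio zeta A || (bad_null zeta A || bad_active y A).
Proof.
move=> HA z0 z1 Hcrit Htau; apply: contraNT; rewrite !negb_or /bad_ratio -ltNge.
move=> /and3P[good_ratio /existsPn good_null /existsPn good_active].
apply/eqP; apply: screen_Mstar => // d S dK SC.
have dK' : (0 < d.+1 <= K)%N by [].
have C0 : (0 < #|cands h Ms d.+1|)%N by apply/card_gt0P; exists S.
have [c0 c2] := Hcrit _ dK' C0.
have WE : tauhat Y Nz A S - tau Y S = sD * W S A.
  by rewrite (linstat_tauw N_gt1 Nz_gt1 Smin_gt0 rho_gt0 Nz_ub Smin_le) // mulrC divfK // gt_eqF.
move: good_ratio; rewrite ltr_norml => /andP[gr1 gr2].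
set r := s2ratio Nz Y A in gr1 gr2.
have r0 : 0 < r by lra.
have sE : Num.sqrt (sighat2 Y Nz A S) = sD * Num.sqrt r.
  rewrite (sighat2E N_gt1 Nz_gt1 Smin_gt0 rho_gt0 Nz_ub Smin_le) sqrtrM // ltW //.
have sr0 : 0 < Num.sqrt r by rewrite sqrtr_gt0.
have den0 : 0 < sD * Num.sqrt r by rewrite mulr_gt0.
rewrite sE normrM normfV (gtr0_norm den0) ler_pdivlMr //.
have [SM|SM] := boolP (S \in Ms).
  have S1 : S \in Mstar1 Y.
    move: SM; rewrite in_Mstar => /orP[/eqP S0|//].
    by move: SC; rewrite S0 inE cards0.
  have gW := good_active S; rewrite S1 /= -ltNge in gW.
  have t := Htau S S1.
  have sr2 : Num.sqrt r <= 2.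
    rewrite -[leRHS]ger0_norm // -sqrtr_sqr ler_sqrt // expr2; lra.
  have h1 : `|tau Y S| <= `|tauhat Y Nz A S| + sD * `|W S A|.
    have -> : tau Y S = tauhat Y Nz A S - sD * W S A by rewrite -WE; ring.
    by apply: (le_trans (ler_normB _ _)); rewrite (normrM sD) (gtr0_norm sD0).
  have h2 : sD * `|W S A| <= sD * y by rewrite ler_pM2l // ltW.
  have h3 : y * sD <= `|tauhat Y Nz A S| by lra.
  apply: le_trans h3; rewrite [leRHS]mulrC mulrCA ler_pM2l //.
  by apply: (@le_trans _ _ (crit Y h alpha d.+1 * 2)); [rewrite ler_wpM2l | lra].
apply/negbTE; rewrite -ltNge.
have gW := good_null (Ordinal dK, S); rewrite /= SC SM /= -ltNge in gW.
have -> : tauhat Y Nz A S = sD * W S A by rewrite -WE (tau_out SM) subr0.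
rewrite normrM (gtr0_norm sD0) mulrCA ltr_pM2l //.
apply: (lt_le_trans gW); apply: ler_wpM2l => //.
by rewrite ler_sqrt; lra.
Qed.

Lemma screening_error zeta y : 0 < zeta -> zeta < 1 / 4 -> 0 < y ->
  (forall d, (0 < d <= K)%N -> 0 < alpha d) ->
  (forall d, (0 < d <= K)%N -> (0 < #|cands h Ms d|)%N -> 2 * crit Y h alpha d <= y /\
     4 * kap * expR (256 * kap * crit Y h alpha d ^+ 2 - zeta ^+ 2 * N%:R / (128 * 128 * kap ^+ 2)) <= zeta) ->
  (forall S, S \in Mstar1 Y -> 2 * y * sD <= `|tau Y S|) ->
  prob Nz (fun A => screen Y Nz A h alpha K != Ms) <=
   2 * expR (- (zeta ^+ 2 * N%:R / (32 * (40 * kap) ^+ 2))) +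
   \sum_(d < K) (#|cands h Ms d.+1|)%:R *
      (2 * expR (- ((1 - 4 * zeta) * (- ln (pval d.+1) + ln (2 * normal_peak 1) - (1 + zeta^-1) / 2)))) +
   Q * (2 * expR (- (y ^+ 2 / (512 * kap)))).
Proof.
move=> z0 z1 y0 Ha Hc Htau.
have pv d : (0 < d <= K)%N -> (0 < #|cands h Ms d|)%N -> 0 < pval d <= 1.
  move=> dK C0; rewrite /pval lt_min ltr01 andbT ge_min lexx orbT andbT.
  by rewrite divr_gt0 ?Ha // ltr0n.
have sub := @prob_le R K N Nz _ _ (fun A HA => @screening_error_subset zeta y A HA z0 _ _ Htau).
apply: (le_trans (sub _ _)); first lra.
  move=> d dK C0; have [h1 h2] := Hc d dK C0; split => //.
  by have /andP[p0 p1] := pv d dK C0; rewrite /crit -/(pval d); apply: Phi_inv_ge0; lra.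
apply: (le_trans (probU _ _ _)); rewrite -addrA; apply: lerD; first exact: s2ratio_tail.
apply: (le_trans (probU _ _ _)); apply: lerD.
  apply: (le_trans (prob_bigU _ _ _)).
  rewrite -(pair_big_dep xpredT (fun (d : 'I_K) S => (S \in cands h Ms d.+1) && (S \notin Ms))
     (fun (d : 'I_K) S => prob Nz (fun A => crit Y h alpha d.+1 * Num.sqrt (1 - zeta) <= `|W S A|))) /=.
  apply: ler_sum => d _.
  have dK : (0 < d.+1 <= K)%N by rewrite /= ltn_ord.
  have [C0|C0] := posnP #|cands h Ms d.+1|.
    rewrite C0 mul0r big_pred0 // => S; apply/negbTE.
    by have /eqP := C0; rewrite cards_eq0 => /eqP ->; rewrite inE.
  have [h1 h2] := Hc d.+1 dK C0.
  have /andP[p0 p1] := pv d.+1 dK C0.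
  rewrite [leRHS]mulr_natl -sumr_const.
  apply: (@le_trans _ _ (\sum_(S in cands h Ms d.+1) prob Nz (fun A => crit Y h alpha d.+1 * Num.sqrt (1 - zeta) <= `|W S A|))).
    rewrite [leRHS](bigID (fun S => S \notin Ms)) /= lerDl.
    by apply: sumr_ge0 => S _; exact: prob_ge0.
  by apply: ler_sum => S _; exact: W_sharp_tail.
apply: (le_trans (prob_bigU _ _ _)).
apply: (@le_trans _ _ (\sum_(S : {set 'I_K}) 2 * expR (- (y ^+ 2 / (512 * kap))))).
  rewrite [leRHS](bigID (fun S => S \in Mstar1 Y)) /=.
  rewrite -[leLHS]addr0; apply: lerD; first by apply: ler_sum => S _; exact: W_tail.
  by apply: sumr_ge0 => S _; rewrite mulr_ge0 ?expR_ge0.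
rewrite sumr_const -[_ *+ _]mulr_natl (_ : #|_| = 2 ^ K)%N //.
by rewrite -cardsT -powersetT card_powerset cardsT card_ord.
Qed.

End ScreeningError.

(** * Uniform asymptotics of the screening error *)

Section Asymptotics.
Context {R : realType}.

(** Read with L = ln N: a squared logarithm is eventually below any positive power of N. The 96 is
    24 from e^y >= y^4 / 24 times 4 from (1 + L)^2 <= 4 L^2. *)
Lemma poly_le_expR (A c eta : R) : 0 < c -> 0 < eta ->
  exists2 L0, 1 <= L0 & forall L, L0 <= L -> A * (1 + L) ^+ 2 <= c * expR (eta * L).
Proof.
move=> c0 e0.
have ce : 0 < c * eta ^+ 4 by rewrite mulr_gt0 ?exprn_gt0.
pose B := `|A| * 96 / (c * eta ^+ 4).
have B0 : 0 <= B by rewrite divr_ge0 ?(ltW ce) // mulr_ge0.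
exists (1 + B); first by rewrite lerDl.
move=> L LB; have L1 : 1 <= L by lra.
have BL : B <= L by lra.
have q := @expR_ge_quart R (eta * L) ltac:(rewrite mulr_ge0 ?ltW //; lra).
apply: (@le_trans _ _ (c * ((eta * L) ^+ 4 / 24))); last by rewrite ler_pM2l.
apply: (@le_trans _ _ (`|A| * (4 * L ^+ 2))).
  apply: (le_trans (ler_wpM2r (sqr_ge0 _) (ler_norm A))).
  by rewrite ler_wpM2l //; nra.
rewrite /B ler_pdivrMr // in BL.
have L2 : 0 <= L ^+ 2 by exact: sqr_ge0.
have h : `|A| * 96 <= L ^+ 2 * (c * eta ^+ 4).
  by apply: (le_trans BL); rewrite ler_wpM2r ?(ltW ce) //; nra.
by have := ler_wpM2l L2 h; rewrite exprMn; lra.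
Qed.

Lemma powR_expR (x a : R) : 0 < x -> x `^ a = expR (a * ln x).
Proof. by move=> x0; rewrite /powR gt_eqF. Qed.

Lemma dimension_le (K : nat) (x : R) : 0 < x -> (2 ^ K)%:R <= x -> K%:R <= 2 * ln x.
Proof.
move=> x0 Kx.
have e2 : expR (1 / 2) <= 2 :> R by have := @expR_le_quad R (1 / 2) ltac:(lra); lra.
have h : expR (K%:R / 2) <= x.
  apply: le_trans Kx; rewrite (_ : K%:R / 2 = K%:R * (1 / 2)); last by lra.
  by rewrite expRM_natl natrX lerXn2r ?nnegrE ?expR_ge0.
have : K%:R / 2 <= ln x by rewrite -[leLHS]expRK ler_ln ?posrE ?expR_gt0.
lra.
Qed.

Lemma neg_ln_pval_ub (a' dl L al C : R) : 0 < a' -> 0 <= dl -> 0 <= L -> 0 < C -> ln C <= L ->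
  a' * expR (- dl * L) <= al -> - ln (minr (al / C) 1) <= `|ln a'| + (1 + dl) * L.
Proof.
move=> a0 dl0 L0 C0 CL h.
have al0 : 0 < al by apply: lt_le_trans h; rewrite mulr_gt0 ?expR_gt0.
have la : ln a' - dl * L <= ln al.
  have e : ln (a' * expR (- dl * L)) = ln a' - dl * L.
    by rewrite lnM ?posrE ?expR_gt0 // expRK mulNr.
  by rewrite -e ler_ln ?posrE // mulr_gt0 ?expR_gt0.
have na := ler_norm (- ln a'); rewrite normrN in na.
rewrite minEle; case: ifP => _; first by rewrite ln_div ?posrE //; lra.
by rewrite ln1 oppr0 addr_ge0 // mulr_ge0 //; lra.
Qed.

Lemma neg_ln_pval_lb (b' dl L al C : R) : 0 < b' -> 0 < C -> 0 < al ->
  al <= b' * expR (- dl * L) -> ln C + dl * L - ln b' <= - ln (minr (al / C) 1).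
Proof.
move=> b0 C0 al0 h.
have la : ln al <= ln b' - dl * L.
  have e : ln (b' * expR (- dl * L)) = ln b' - dl * L.
    by rewrite lnM ?posrE ?expR_gt0 // expRK mulNr.
  by rewrite -e ler_ln ?posrE // mulr_gt0 ?expR_gt0.
have aC : 0 < al / C by rewrite divr_gt0.
have : ln (minr (al / C) 1) <= ln (al / C).
  by rewrite ler_ln ?posrE ?lt_min ?aC ?ltr01 // ge_min lexx.
rewrite ln_div ?posrE //; lra.
Qed.

(** The logarithm lC of the number of candidates enters once through the union bound and once, with
    opposite sign, through the Bonferroni level. What survives is 4 zeta lC, and the calibration of
    zeta charges it, with the loss on dl L, to half of dl L. *)
Lemma null_exponent_le (zeta dl lb cc lC l L : R) : 0 < zeta -> zeta < 1 / 4 ->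
  4 * zeta * (1 + dl) = dl / 2 -> 0 <= lC -> lC <= L -> lC + dl * L - lb <= l ->
  lC - (1 - 4 * zeta) * (l + cc) <= `|lb - cc| - dl / 2 * L.
Proof.
move=> z0 z1 zE lC0 lCL h.
have z4 : 0 <= 1 - 4 * zeta by lra.
have h1 := ler_wpM2l z4 h.
have h2 : (1 - 4 * zeta) * (lb - cc) <= `|lb - cc|.
  apply: (@le_trans _ _ ((1 - 4 * zeta) * `|lb - cc|)); first by rewrite ler_wpM2l // ler_norm.
  by rewrite ler_piMl //; lra.
have h3 : 4 * zeta * lC <= 4 * zeta * L by rewrite ler_wpM2l //; lra.
have h4 : 4 * zeta * L * (1 + dl) = dl / 2 * L by rewrite -zE; ring.
lra.
Qed.

Theorem screening_consistency (h : heredity) (rho M D a dl a' b' dl' eps : R) :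
  0 < rho -> 0 < M -> 0 < D -> 0 < a -> - (1 / 2) < dl -> 0 < a' -> 0 < b' -> 0 < dl' -> 0 < eps ->
  exists L0 : R, forall (K N : nat) (Nz : trt K -> nat) (Y : 'I_N -> trt K -> R)
    (alpha : nat -> R) (Smin : R),
  (\sum_(z : trt K) Nz z)%N = N -> (1 < N)%N -> (forall z, (1 < Nz z)%N) ->
  0 < Smin ->
  (forall z, N%:R <= rho * (Q K * (Nz z)%:R)) ->
  (forall z, Q K * (Nz z)%:R <= rho * N%:R) ->
  (forall z, Smin <= Smat Y z z) -> (forall z, Smat Y z z <= D) ->
  (forall i z, resid Y i z ^+ 2 <= M ^+ 2 * Smin) ->
  (forall S, S \in Mstar1 Y -> parent_ok h (Mstar Y) S) ->
  (forall S, S \in Mstar1 Y -> a * N%:R `^ dl <= `|tau Y S|) ->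
  (forall d, (1 <= d <= K)%N -> a' * N%:R `^ (- dl') <= alpha d <= b' * N%:R `^ (- dl')) ->
  L0 <= ln N%:R ->
  prob Nz (fun A => screen Y Nz A h alpha K != Mstar Y) <= eps.
Proof.
move=> rho0 M0 D0 a0 dl0 a'0 b'0 dl'0 eps0.
have [kap kap0 kapE] : exists2 k, 0 < k & rho ^+ 3 * M ^+ 2 = k.
  by exists (rho ^+ 3 * M ^+ 2); first by rewrite mulr_gt0 ?exprn_gt0.
pose P : R := normal_peak 1; have P0 : 0 < P := peak_gt0.
(* Calibrated so that the losses of the sharp tail consume exactly half of the decay exponent of the
   levels. *)
pose zeta := dl' / (8 * (1 + dl')).
have zden : 0 < 8 * (1 + dl') by lra.
have z0 : 0 < zeta by rewrite divr_gt0.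
have z8 : zeta <= 1 / 8 by rewrite ler_pdivrMr //; lra.
have z1 : zeta < 1 / 4 by lra.
have zE : 4 * zeta * (1 + dl') = dl' / 2 by rewrite /zeta; field; lra.
pose cc := ln (2 * P) - (1 + zeta^-1) / 2.
pose Cb := `|ln b' - cc|.
pose e3 := eps / 3; have e30 : 0 < e3 by rewrite divr_gt0.
pose eta := dl + 1 / 2; have eta0 : 0 < eta by rewrite /eta; lra.
pose rD := Num.sqrt (rho * D).
have rD0 : 0 < rD by rewrite sqrtr_gt0 mulr_gt0.
(* With y = cy N^(dl + 1/2) and a standard error at most rD N^(-1/2), the margin 2 y sD is at most a
   N^dl, the lower bound on active effects. *)
pose cy := a / (2 * rD); have cy0 : 0 < cy by rewrite divr_gt0 // mulr_gt0.
pose C0 := 2^-1 + `|ln (2 * P)| + `|ln a'|.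
have C00 : 0 <= C0 by rewrite /C0; have := normr_ge0 (ln (2 * P)); have := normr_ge0 (ln a'); lra.
pose C1 := C0 + (1 + dl').
have C10 : 0 <= C1 by rewrite /C1; lra.
have [q1 q10 q1E] : exists2 q, 0 < q & 32 * (40 * kap) ^+ 2 = q.
  by exists (32 * (40 * kap) ^+ 2); first by rewrite mulr_gt0 ?exprn_gt0 ?mulr_gt0 ?ltr0n.
have [q2 q20 q2E] : exists2 q, 0 < q & 128 * 128 * kap ^+ 2 = q.
  by exists (128 * 128 * kap ^+ 2); first by rewrite mulr_gt0 ?exprn_gt0 ?mulr_gt0 ?ltr0n.
have [q3 q30 q3E] : exists2 q, 0 < q & 512 * kap = q.
  by exists (512 * kap); first by rewrite mulr_gt0 ?ltr0n.
have [q4 q40 q4E] : exists2 q, 0 < q & 256 * kap = q.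
  by exists (256 * kap); first by rewrite mulr_gt0 ?ltr0n.
pose cA := zeta ^+ 2 / q1; have cA0 : 0 < cA by rewrite divr_gt0 ?exprn_gt0.
pose cE := zeta ^+ 2 / q2; have cE0 : 0 < cE by rewrite divr_gt0 ?exprn_gt0.
pose cC := cy ^+ 2 / q3; have cC0 : 0 < cC by rewrite divr_gt0 ?exprn_gt0.
(* In order: the variance ratio, the inactive candidates, the active effects, the requirement that y
   exceed twice the critical values, and the side condition of the sharp tail. *)
have [LA LA1 HA] := @poly_le_expR `|ln (2 / e3)| cA 1 cA0 ltr01.
have [LB LB1 HB] := @poly_le_expR (4 * expR Cb / e3) 1 (dl' / 2) ltr01 ltac:(lra).
have [LC LC1 HC] := @poly_le_expR (1 + `|ln (2 / e3)|) cC (2 * eta) cC0 ltac:(lra).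
have [LD LD1 HD] := @poly_le_expR (2 * C1) cy eta cy0 eta0.
have [LE LE1 HE] := @poly_le_expR (q4 * C1 ^+ 2 + `|ln (zeta / (4 * kap))|) cE 1 cE0 ltr01.
exists (LA + LB + LC + LD + LE) => K N Nz Y alpha Smin Nz_sum N_gt1 Nz_gt1 Smin0 Nz_lb Nz_ub S_lb S_ub res C4 Htau Ha LL.
set L := ln N%:R in LL.
have N0 : (0 : R) < N%:R by rewrite ltr0n ltnW.
have NE : (N%:R : R) = expR L by rewrite lnK.
have [LLA [LLB [LLC [LLD LLE]]]] : LA <= L /\ LB <= L /\ LC <= L /\ LD <= L /\ LE <= L.
  by clear -LL LA1 LB1 LC1 LD1 LE1; do ! split; lra.
have L1 : 1 <= L by exact: le_trans LLA.
have [sq1 sq2] : 1 <= (1 + L) ^+ 2 /\ 1 + L <= (1 + L) ^+ 2 by clear -L1; split; nra.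
have {}HA := HA L LLA. have {}HB := HB L LLB.
have {}HC := HC L LLC. have {}HD := HD L LLD. have {}HE := HE L LLE.
rewrite mul1r in HA; rewrite mul1r in HE; rewrite mul1r in HB.
pose y := cy * expR (eta * L).
have y0 : 0 < y by rewrite mulr_gt0 ?expR_gt0.
have QN : Q K <= N%:R :> R.
  rewrite -Nz_sum natr_sum -[leLHS]mulr1 -sum_trt_cst; apply: ler_sum => z _.
  by rewrite ler1n ltnW.
have KL : K%:R <= 2 * L by apply: dimension_le.
pose C d := #|cands h (Mstar Y) d|.
have CN d : (C d)%:R <= N%:R :> R.
  apply: le_trans QN; rewrite /Q ler_nat.
  apply: leq_trans (max_card _) _.
  by rewrite -cardsT -powersetT card_powerset cardsT card_ord.
have al0 d : (0 < d <= K)%N -> 0 < alpha d.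
  move=> dK; have /andP[h1 _] := Ha d dK; apply: lt_le_trans h1.
  by rewrite mulr_gt0 // powR_gt0.
pose p d := minr (alpha d / (C d)%:R) 1.
have CL d : (0 < C d)%N -> 0 <= ln ((C d)%:R : R) <= L.
  move=> Cd; apply/andP; split; first by rewrite ln_ge0 ?ler1n.
  by rewrite /L ler_ln ?posrE ?CN // ltr0n.
have L0 : 0 <= L by exact: le_trans L1.
have crit_bd d : (0 < d <= K)%N -> (0 < C d)%N ->
    0 < p d <= 1 /\ 0 <= crit Y h alpha d <= C1 * (1 + L).
  move=> dK Cd; have Cd' : (0 : R) < (C d)%:R by rewrite ltr0n.
  have p01 : 0 < p d <= 1.
    by rewrite lt_min ltr01 andbT ge_min lexx orbT andbT divr_gt0 ?al0.
  have /andP[p0 p1] := p01; split => //.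
  have /andP[h1 _] := Ha d dK; rewrite powR_expR // -/L in h1.
  have /andP[_ cl] := CL d Cd.
  have q := neg_ln_pval_ub a'0 (ltW dl'0) L0 Cd' cl h1; rewrite -/(p d) in q.
  have u := Phi_inv_ub p0 p1; rewrite -/P in u.
  have lp := ler_norm (ln (2 * P)).
  rewrite /crit -/(C d) -/(p d); apply/andP; split.
    by clear -p0 p1; apply: Phi_inv_ge0; lra.
  apply: (le_trans u); clear -q lp L0 C00 dl'0; rewrite /C1.
  have t := mulr_ge0 C00 L0; rewrite /C0 in t *.
  lra.
have sEb : Num.sqrt (sig2 Nz Y) <= rD * expR (- (L / 2)).
  have u := @sig2_ub _ _ _ Nz Y N_gt1 Nz_gt1 rho Smin Smin0 Nz_lb S_lb D S_ub.
  have e : Num.sqrt (rho * D / N%:R) = rD * expR (- (L / 2)).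
    rewrite sqrtrM ?mulr_ge0 ?ltW // NE -expRN; congr (_ * _).
    have -> : - L = - (L / 2) + - (L / 2) by field.
    by rewrite expRD -expr2 sqrtr_sqr ger0_norm ?expR_ge0.
  by rewrite -e ler_sqrt // divr_ge0 ?mulr_ge0 // ltW.
have hcrit d : (0 < d <= K)%N -> (0 < C d)%N -> 2 * crit Y h alpha d <= y /\
    4 * (rho ^+ 3 * M ^+ 2) * expR (256 * (rho ^+ 3 * M ^+ 2) * crit Y h alpha d ^+ 2
       - zeta ^+ 2 * N%:R / (128 * 128 * (rho ^+ 3 * M ^+ 2) ^+ 2)) <= zeta.
  move=> dK Cd; have [_ /andP[c0 c1]] := crit_bd d dK Cd; split.
    rewrite /y; apply: le_trans HD; rewrite -mulrA ler_pM2l //.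
    by apply: (le_trans c1); rewrite ler_wpM2l.
  have -> : zeta ^+ 2 * N%:R / (128 * 128 * (rho ^+ 3 * M ^+ 2) ^+ 2) = cE * N%:R.
    by rewrite kapE q2E mulrAC.
  rewrite kapE q4E.
  have k4 : 0 < 4 * kap by rewrite mulr_gt0.
  have cr2 : crit Y h alpha d ^+ 2 <= C1 ^+ 2 * (1 + L) ^+ 2.
    by rewrite -exprMn lerXn2r ?nnegrE // (le_trans c0).
  have na := ler_norm (- ln (zeta / (4 * kap))); rewrite normrN in na.
  rewrite -ler_pdivlMl //.
  have -> : (4 * kap)^-1 * zeta = expR (ln (zeta / (4 * kap))).
    by rewrite lnK ?posrE ?divr_gt0 // mulrC.
  rewrite ler_expR.
  have t1 := ler_wpM2l (ltW q40) cr2.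
  have t2 := ler_wpM2l (normr_ge0 (ln (zeta / (4 * kap)))) sq1.
  rewrite NE; clear -t1 t2 na HE; lra.
have htau S : S \in Mstar1 Y -> 2 * y * Num.sqrt (sig2 Nz Y) <= `|tau Y S|.
  move=> SM; apply: le_trans (Htau S SM); rewrite powR_expR // -/L.
  have y2 : 0 <= 2 * y by rewrite mulr_ge0 // ltW.
  apply: (le_trans (ler_wpM2l y2 sEb)); rewrite /y /cy.
  have -> : expR (dl * L) = expR (eta * L) * expR (- (L / 2)).
    by rewrite -expRD; congr expR; rewrite /eta; field.
  rewrite le_eqVlt; apply/orP; left; apply/eqP; field.
  by rewrite gt_eqF.
have half_ln (X : R) : ln (2 / e3) <= X -> 2 * expR (- X) <= e3.
  move=> hX; have : expR (- X) <= expR (- ln (2 / e3)) by rewrite ler_expR lerN2.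
  rewrite (expRN (ln _)) lnK ?posrE ?divr_gt0 // invf_div.
  by clear; lra.
have err := screening_error Nz_sum N_gt1 Nz_gt1 Smin0 rho0 M0 Nz_lb Nz_ub S_lb res C4 z0 z1 y0 al0 hcrit htau.
apply: (le_trans err).
have -> : eps = e3 + e3 + e3 by rewrite /e3; clear; field.
apply: lerD; first apply: lerD.
- rewrite kapE q1E [zeta ^+ 2 * _ / _]mulrAC -/cA NE; apply: half_ln; apply: le_trans HA.
  apply: (le_trans (ler_norm _)); rewrite -[leLHS]mulr1.
  by rewrite ler_wpM2l.
- apply: (@le_trans _ _ (\sum_(d < K) 2 * expR (Cb - dl' / 2 * L))).
    apply: ler_sum => d _.
    have dK : (0 < d.+1 <= K)%N by rewrite /= ltn_ord.
    have [C00'|Cd] := posnP (C d.+1); first by rewrite -/(C _) C00' mul0r mulr_ge0 ?expR_ge0.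
    have Cd' : (0 : R) < (C d.+1)%:R by rewrite ltr0n.
    have /andP[cl0 cl] := CL _ Cd.
    have /andP[_ h2] := Ha d.+1 dK; rewrite powR_expR // -/L in h2.
    have lb := neg_ln_pval_lb b'0 Cd' (al0 _ dK) h2.
    have ne := null_exponent_le cc z0 z1 zE cl0 cl lb.
    rewrite -/(C _) mulrCA ler_pM2l // -{1}[(C _)%:R]lnK ?posrE // -expRD ler_expR.
    by rewrite -addrA; exact: ne.
  rewrite sumr_const card_ord -[_ *+ K]mulr_natl.
  have ex0 : 0 <= 2 * expR (Cb - dl' / 2 * L) by rewrite mulr_ge0 ?expR_ge0.
  apply: (le_trans (ler_wpM2r ex0 KL)).
  rewrite expRB.
  have E0 : 0 < expR (dl' / 2 * L) by exact: expR_gt0.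
  have -> : 2 * L * (2 * (expR Cb / expR (dl' / 2 * L))) = (4 * expR Cb * L) / expR (dl' / 2 * L).
    by field; rewrite gt_eqF.
  rewrite ler_pdivrMr //; apply: (@le_trans _ _ (e3 * (4 * expR Cb / e3 * (1 + L) ^+ 2))).
    have -> : e3 * (4 * expR Cb / e3 * (1 + L) ^+ 2) = 4 * expR Cb * (1 + L) ^+ 2.
      by field; rewrite gt_eqF.
    rewrite ler_wpM2l ?mulr_ge0 ?expR_ge0 //; clear -sq2; lra.
  by rewrite ler_pM2l.
- have ex0 : 0 <= 2 * expR (- (y ^+ 2 / (512 * (rho ^+ 3 * M ^+ 2)))) by rewrite mulr_ge0 ?expR_ge0.
  apply: (le_trans (ler_wpM2r ex0 QN)).
  rewrite kapE q3E NE mulrCA -expRD.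
  have -> : L + - (y ^+ 2 / q3) = - (y ^+ 2 / q3 - L) by ring.
  apply: half_ln.
  have -> : y ^+ 2 / q3 = cC * expR (2 * eta * L).
    rewrite /y /cC exprMn (_ : 2 * eta * L = eta * L + eta * L); last by ring.
    by rewrite expRD; ring.
  have t1 := ler_wpM2l (normr_ge0 (ln (2 / e3))) sq1.
  have t2 := ler_norm (ln (2 / e3)).
  clear -HC t1 t2 sq2; lra.
Qed.

End Asymptotics.

(** * The screened estimator *)

Section OneDesign.
Context {R : realType} {K N : nat} (Nz : trt K -> nat) (Y : 'I_N -> trt K -> R).
Local Notation asg := {ffun 'I_N -> trt K}.
Local Notation Omega := (@assignments K N Nz).
Local Notation Q := (@Q R K).
Hypothesis Nz_sum : (\sum_(z : trt K) Nz z)%N = N.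
Hypothesis N_gt1 : (1 < N)%N.
Hypothesis Nz_gt1 : forall z, (1 < Nz z)%N.
Hypothesis K_gt0 : (0 < K)%N.
Variables (rho M Smin : R).
Hypothesis Smin_gt0 : 0 < Smin.
Hypothesis rho_gt0 : 0 < rho.
Hypothesis M_gt0 : 0 < M.
Hypothesis Nz_lb : forall z, N%:R <= rho * (Q * (Nz z)%:R).
Hypothesis Nz_ub : forall z, Q * (Nz z)%:R <= rho * N%:R.
Hypothesis Smin_le : forall z, Smin <= Smat Y z z.
Hypothesis resid_le : forall i z, resid Y i z ^+ 2 <= M ^+ 2 * Smin.

Let N0 : (0 : R) < N%:R. Proof. by rewrite ltr0n ltnW. Qed.
Let Nz0 z : (0 : R) < (Nz z)%:R. Proof. by rewrite ltr0n ltnW. Qed.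
Let Q0 : 0 < Q. Proof. exact: Q_gt0. Qed.
Let S0 z : 0 < Smat Y z z. Proof. exact: lt_le_trans (Smin_le z). Qed.

(** The diagonal entry is D(z,z) (1 - N(z)/N), and the other Q - 1 >= Q/2 arms hold at least N / (2
    rho) units. *)
Lemma Vmat_diag_lb z : (Nz z)%:R^-1 * Smat Y z z / (2 * rho) <= Vmat Y Nz z z.
Proof.
have Q2 : 2 <= Q by rewrite /Q ler_nat -[X in (X <= _)%N]expn1 leq_exp2l.
have h : N%:R / (2 * rho) <= N%:R - (Nz z)%:R :> R.
  have -> : (N%:R : R) - (Nz z)%:R = \sum_(z' | z' != z) (Nz z')%:R.
    by rewrite -[in LHS]Nz_sum natr_sum (bigD1 z) //= addrAC subrr add0r.
  apply: (@le_trans _ _ (\sum_(z' : trt K | z' != z) N%:R / (rho * Q))).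
    rewrite sumr_const cardC1 card_trt -[leRHS]mulr_natl.
    have -> : ((2 ^ K).-1%:R : R) = Q - 1.
      by rewrite /Q -[in RHS](@prednK (2 ^ K)) ?expn_gt0 // -natr1 addrK.
    have -> : (Q - 1) * (N%:R / (rho * Q)) = N%:R / (2 * rho) * (2 * (Q - 1) / Q).
      by field; rewrite !gt_eqF.
    rewrite -[leLHS]mulr1 ler_wpM2l ?divr_ge0 ?mulr_ge0 ?(ltW rho_gt0) ?(ltW N0) //.
    by rewrite ler_pdivlMr //; lra.
  apply: ler_sum => z' _; rewrite ler_pdivrMr ?mulr_gt0 //.
  by have := Nz_lb z'; lra.
have -> : Vmat Y Nz z z = (Nz z)%:R^-1 * Smat Y z z * ((N%:R - (Nz z)%:R) / N%:R).
  by rewrite /Vmat /Dmat eqxx; field; rewrite !gt_eqF.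
have p : 0 <= (Nz z)%:R^-1 * Smat Y z z by rewrite mulr_ge0 ?invr_ge0 // ltW.
by apply: (ler_wpM2l p); rewrite ler_pdivlMr // mulrC.
Qed.

Lemma Vmat_diag_gt0 z : 0 < Vmat Y Nz z z.
Proof.
apply: lt_le_trans (Vmat_diag_lb z).
by apply: divr_gt0; apply: mulr_gt0; rewrite ?invr_gt0.
Qed.

(** Rescaling u by the square roots of the diagonal of V turns the correlation bound into V >=
    diag(V) / s, and diag(V) is comparable to D. *)
Lemma qform_Vmat_lb (s : R) u : 0 <= s ->
  (forall a b, is_eigenvalue (Corr Y Nz) a -> is_eigenvalue (Corr Y Nz) b -> a <= s * b) ->
  \sum_z u z ^+ 2 * ((Nz z)%:R^-1 * Smat Y z z) <= 2 * rho * s * qform (Vmat Y Nz) u.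
Proof.
move=> s0 cond.
pose sq z := Num.sqrt (Vmat Y Nz z z).
have sq0 z : 0 < sq z by rewrite sqrtr_gt0 Vmat_diag_gt0.
have sq2 z : sq z ^+ 2 = Vmat Y Nz z z by rewrite sqr_sqrtr // ltW // Vmat_diag_gt0.
have CE z z' : Corr Y Nz z z' = Vmat Y Nz z z' / (sq z * sq z').
  by rewrite /Corr sqrtrM // ltW // Vmat_diag_gt0.
have symC z z' : Corr Y Nz z z' = Corr Y Nz z' z.
  by rewrite !CE Vmat_sym mulrC [sq z * _]mulrC mulrC.
have diagC z : Corr Y Nz z z = 1.
  by rewrite CE -expr2 sq2 mulfV // gt_eqF // Vmat_diag_gt0.
have := condition_number_lb symC diagC s0 cond (fun z => u z * sq z).
have -> : qform (Corr Y Nz) (fun z => u z * sq z) = qform (Vmat Y Nz) u.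
  apply: eq_bigr => z _; apply: eq_bigr => z' _; rewrite CE.
  by field; rewrite !gt_eqF.
move=> h; rewrite -mulrA -ler_pdivrMl ?mulr_gt0 //.
apply: le_trans h; rewrite big_distrr; apply: ler_sum => z _ /=.
rewrite exprMn sq2 mulrCA ler_wpM2l ?sqr_ge0 //.
by rewrite mulrC Vmat_diag_lb.
Qed.

Variable f : trt K -> R.
Local Notation fs := (fstar Y f).
Local Notation v2 := (vR2 Y Nz f).

Lemma dotv_fstar : dotv fs (Ybar Y) = gamma Y f.
Proof.
apply: dotv_fproj => S SM; have := tau_out SM; rewrite /tau => /eqP.
by rewrite mulf_eq0 invr_eq0 gt_eqF //= => /eqP.
Qed.

Hypothesis v2_gt0 : 0 < v2.

Lemma standardizedE A : A \in Omega ->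
  (dotv fs (Yhat Y Nz A) - gamma Y f) / Num.sqrt v2 =
  linstat (coefs Nz Y (fun z => fs z / Num.sqrt v2)) A.
Proof.
move=> HA; rewrite -dotv_fstar linstat_coefs // /dotv -!sumrB big_distrl /=.
by apply: eq_bigr => z _; field; rewrite gt_eqF // sqrtr_gt0.
Qed.

Lemma Ex_standardized_sq :
  Ex Nz (fun A => linstat (coefs Nz Y (fun z => fs z / Num.sqrt v2)) A ^+ 2) = 1.
Proof.
rewrite Ex_linstat_coefs_sq //.
have -> : qform (Vmat Y Nz) (fun z => fs z / Num.sqrt v2) = v2 / (Num.sqrt v2) ^+ 2.
  rewrite [in RHS]/vR2 /qform big_distrl; apply: eq_bigr => z _ /=.
  rewrite big_distrl; apply: eq_bigr => z' _ /=.
  by field; rewrite gt_eqF // sqrtr_gt0.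
by rewrite sqr_sqrtr ?(ltW v2_gt0) // mulfV // gt_eqF.
Qed.

(** Delocalization bounds an entry of the weights by their norm, and the norm is bounded by v_R^2
    through the comparison of V with D. [Smin] cancels, leaving a squared coefficient of order
    |M^star| / N. *)
Lemma standardized_coef_le (s : R) i z : 0 <= s ->
  (forall a b, is_eigenvalue (Corr Y Nz) a -> is_eigenvalue (Corr Y Nz) b -> a <= s * b) ->
  `|coefs Nz Y (fun z => fs z / Num.sqrt v2) i z|
    <= Num.sqrt (2 * rho ^+ 4 * s * M ^+ 2 * (#|Mstar Y|%:R / N%:R)).
Proof.
move=> s0 cond.
have V := qform_Vmat_lb fs s0 cond; rewrite -[qform _ _]/v2 in V.
have k0 : 0 <= 2 * rho ^+ 4 * s * M ^+ 2 * (#|Mstar Y|%:R / N%:R).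
  have r4 : 0 <= rho ^+ 4 by apply: exprn_ge0; exact: ltW.
  apply: mulr_ge0; last by rewrite divr_ge0 // ltW.
  by apply: mulr_ge0; [do 2 apply: mulr_ge0 => // | exact: sqr_ge0].
rewrite -[leLHS]sqrtr_sqr ler_sqrt //.
have -> : coefs Nz Y (fun z => fs z / Num.sqrt v2) i z ^+ 2 =
    (Q * (Nz z)%:R)^-1 ^+ 2 * (Q ^+ 2 * fs z ^+ 2) * resid Y i z ^+ 2 / v2.
  rewrite /coefs !exprMn !exprVn sqr_sqrtr ?(ltW v2_gt0) // !exprMn.
  by field; rewrite !gt_eqF.
rewrite ler_pdivrMr //.
pose n2 := \sum_z fs z ^+ 2.
have n20 : 0 <= n2 by apply: sumr_ge0 => z' _; exact: sqr_ge0.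
have h1 : Q ^+ 2 * fs z ^+ 2 <= Q * (#|Mstar Y|%:R * n2).
  have := fproj_delocalized (Mstar Y) f z; rewrite -/(fs) -/n2 => d.
  have := ler_wpM2l (sqr_ge0 Q) d; move/le_trans; apply.
  by rewrite le_eqVlt; apply/orP; left; apply/eqP; field; rewrite gt_eqF.
have h2 : (Q * (Nz z)%:R)^-1 ^+ 2 <= (rho / N%:R) ^+ 2.
  rewrite lerXn2r ?nnegrE ?(inv_Nz_le N_gt1 Nz_gt1 Nz_lb) //.
    by rewrite invr_ge0 mulr_ge0 // ltW.
  by rewrite divr_ge0 // ltW.
have h3 : Q * Smin * n2 <= rho * N%:R * (2 * rho * s * v2).
  apply: (@le_trans _ _ (rho * N%:R * \sum_z fs z ^+ 2 * ((Nz z)%:R^-1 * Smat Y z z))).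
    rewrite /n2 !big_distrr; apply: ler_sum => z' _ /=.
    have a1 : Q * Smin <= rho * N%:R * ((Nz z')%:R^-1 * Smat Y z' z').
      have [q0 m0] : 0 <= Q /\ 0 <= Smin by split; exact: ltW.
      by rewrite mulrA; apply: ler_pM => //; rewrite ler_pdivlMr.
    by have := ler_wpM2r (sqr_ge0 (fs z')) a1; lra.
  by rewrite ler_wpM2l // mulr_ge0 // ltW.
have p1 : 0 <= (Q * (Nz z)%:R)^-1 ^+ 2 * (Q ^+ 2 * fs z ^+ 2).
  by apply: mulr_ge0; [exact: sqr_ge0 | apply: mulr_ge0; exact: sqr_ge0].
apply: (le_trans (ler_wpM2l p1 (resid_le i z))).
have p2 : 0 <= M ^+ 2 * Smin by apply: mulr_ge0; [exact: sqr_ge0 | exact: ltW].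
have h12 := ler_pM (sqr_ge0 _) (mulr_ge0 (sqr_ge0 Q) (sqr_ge0 (fs z))) h2 h1.
apply: (le_trans (ler_wpM2r p2 h12)).
have p3 : 0 <= (rho / N%:R) ^+ 2 * #|Mstar Y|%:R * M ^+ 2.
  by apply: mulr_ge0; [apply: mulr_ge0; [exact: sqr_ge0 |] | exact: sqr_ge0].
have := ler_wpM2l p3 h3.
have -> : (rho / N%:R) ^+ 2 * #|Mstar Y|%:R * M ^+ 2 * (rho * N%:R * (2 * rho * s * v2)) =
   2 * rho ^+ 4 * s * M ^+ 2 * (#|Mstar Y|%:R / N%:R) * v2 by field; rewrite gt_eqF.
lra.
Qed.

(** Weights of order 1/Q make the quadratic form swap-Lipschitz with constant of order N^-2, so even
    after multiplication by N its deviations have probability exponentially small in N. *)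
Lemma variance_tail (D C eps : R) : 0 < D -> 0 < C -> 0 < eps ->
  (forall z, Smat Y z z <= D) -> (forall z, `|fs z| <= C / Q) ->
  prob Nz (fun A => eps <= `|N%:R * (qform (Vhat Y Nz A) fs - vRlim2 Y Nz f)|)
   <= 2 * expR (- (eps ^+ 2 / (32 * (40 * (M ^+ 2 * D * C ^+ 2 * rho ^+ 2)) ^+ 2) * N%:R)).
Proof.
move=> D0 C0 eps0 SD fC.
set B := M ^+ 2 * D * C ^+ 2 * rho ^+ 2.
have B0 : 0 < B by do 3 (apply: mulr_gt0; last by rewrite ?exprn_gt0); rewrite exprn_gt0.
pose w z := fs z ^+ 2 / (Nz z)%:R.
pose F (A : asg) := \sum_z w z * Shat Y Nz A z.
have FE A : qform (Vhat Y Nz A) fs = F A.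
  by rewrite qform_Vhat; apply: eq_bigr => z _; rewrite /w; ring.
have EF : Ex Nz F = vRlim2 Y Nz f.
  rewrite /vRlim2 qform_Dmat /F Ex_sum; apply: eq_bigr => z _.
  by rewrite ExZ Ex_Shat // /w; ring.
have rl i z : `|resid Y i z| <= Num.sqrt (M ^+ 2 * D).
  rewrite -sqrtr_sqr ler_sqrt; last by apply: mulr_ge0; [exact: sqr_ge0 | exact: ltW].
  apply: (le_trans (resid_le i z)); rewrite ler_wpM2l ?sqr_ge0 //.
  exact: le_trans (Smin_le z) (SD z).
have wb z : `|w z| / (Nz z)%:R <= C ^+ 2 * (rho / N%:R) ^+ 2.
  rewrite ger0_norm; last by rewrite divr_ge0 ?sqr_ge0 // ltW.
  have h2 : (Q * (Nz z)%:R)^-1 ^+ 2 <= (rho / N%:R) ^+ 2.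
    rewrite lerXn2r ?nnegrE ?(inv_Nz_le N_gt1 Nz_gt1 Nz_lb) //.
      by rewrite invr_ge0 mulr_ge0 // ltW.
    by rewrite divr_ge0 // ltW.
  have h1 : (Q * fs z) ^+ 2 <= C ^+ 2.
    rewrite -[leLHS]real_normK ?num_real // normrM (gtr0_norm Q0) lerXn2r ?nnegrE ?(ltW C0) ?mulr_ge0 ?(ltW Q0) //.
    by have := fC z; rewrite ler_pdivlMr // mulrC.
  have -> : w z / (Nz z)%:R = (Q * fs z) ^+ 2 * (Q * (Nz z)%:R)^-1 ^+ 2.
    by rewrite /w; field; rewrite !gt_eqF.
  by apply: ler_pM => //; exact: sqr_ge0.
have lip := wShat_swap_le Nz_gt1 rl wb.
rewrite sqr_sqrtr in lip; last by apply: mulr_ge0; [exact: sqr_ge0 | exact: ltW].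
have b0 : 0 < 40 * (M ^+ 2 * D) * (C ^+ 2 * (rho / N%:R) ^+ 2).
  have t1 : 0 < M ^+ 2 * D by rewrite mulr_gt0 // exprn_gt0.
  have t2 : 0 < C ^+ 2 * (rho / N%:R) ^+ 2 by rewrite mulr_gt0 // exprn_gt0 // divr_gt0.
  by apply: mulr_gt0 => //; apply: mulr_gt0.
have e0 : 0 < eps / N%:R by rewrite divr_gt0.
have T := swap_lip_tail Nz_sum (ltnW N_gt1) b0 e0 lip.
rewrite EF in T.
have -> : prob Nz (fun A => eps <= `|N%:R * (qform (Vhat Y Nz A) fs - vRlim2 Y Nz f)|) =
   prob Nz (fun A => eps / N%:R <= `|F A - vRlim2 Y Nz f|) :> R.
  rewrite !prob_Ex; apply: eq_Ex => A _; rewrite FE normrM (gtr0_norm N0).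
  by rewrite ler_pdivrMr // mulrC.
apply: (le_trans T); rewrite le_eqVlt; apply/orP; left; apply/eqP.
by congr (_ * expR (- _)); rewrite /B; field; rewrite !gt_eqF.
Qed.

End OneDesign.

Lemma prob_diff_le {R : realType} (K N : nat) (Nz : trt K -> nat)
  (P P' B : pred {ffun 'I_N -> trt K}) :
  (forall A, A \in @assignments K N Nz -> ~~ B A -> P A = P' A) ->
  `|prob Nz P - prob Nz P'| <= prob Nz B :> R.
Proof.
move=> H; rewrite !prob_Ex -ExB; apply: (le_trans (ler_norm_Ex _ _)).
apply: le_Ex => A HA; have := H A HA; case: (B A) => /=.
  by move=> _; case: (P A); case: (P' A); rewrite /= ?subrr ?subr0 ?sub0r ?normrN ?normr0 ?normr1.
by move=> /(_ isT) ->; rewrite subrr normr0.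
Qed.

(** * From the stated conditions to regularity constants *)

Section Regularity.
Context {R : realType} {K N : nat}.

Lemma exists_min (F : trt K -> R) : exists z0, forall z, F z0 <= F z.
Proof.
case: (@Order.TotalTheory.arg_minP _ R (trt K) [ffun=> false] xpredT F isT) => z0 _ H.
by exists z0 => z; exact: H.
Qed.

(** Summing over the arms eliminates N_0 and c(z): each arm size is within a factor cu / cl of N /
    Q. *)
Lemma design_ratio (Nz : trt K -> nat) (cl cu : R) (N0 : nat) (c : trt K -> R) :
  (\sum_(z : trt K) Nz z)%N = N -> 0 < cl ->
  (forall z, (Nz z)%:R = c z * N0%:R /\ cl <= c z <= cu) ->
  forall z, N%:R <= cu / cl * (Q K * (Nz z)%:R) /\ Q K * (Nz z)%:R <= cu / cl * N%:R.
Proof.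
move=> Nz_sum cl0 Hc z.
have N0p : (0 : R) <= N0%:R by exact: ler0n.
have lo z' : cl * N0%:R <= (Nz z')%:R by have [-> /andP[h _]] := Hc z'; rewrite ler_wpM2r.
have up z' : (Nz z')%:R <= cu * N0%:R by have [-> /andP[_ h]] := Hc z'; rewrite ler_wpM2r.
have NE : N%:R = \sum_z' (Nz z')%:R :> R by rewrite -Nz_sum natr_sum.
have Nlo : Q K * (cl * N0%:R) <= N%:R by rewrite NE -sum_trt_cst; apply: ler_sum.
have Nup : N%:R <= Q K * (cu * N0%:R) by rewrite NE -sum_trt_cst; apply: ler_sum.
have Q0 : 0 < Q K :> R := Q_gt0.
have cu0 : 0 < cu by have [_ /andP[h1 h2]] := Hc z; lra.
have r0 : 0 < cu / cl by rewrite divr_gt0.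
split.
  apply: (le_trans Nup); rewrite [leRHS]mulrCA ler_pM2l //.
  apply: le_trans (ler_wpM2l (ltW r0) (lo z)).
  by rewrite le_eqVlt; apply/orP; left; apply/eqP; field; rewrite gt_eqF.
apply: le_trans (ler_wpM2l (ltW r0) Nlo).
rewrite [leRHS]mulrCA ler_pM2l //; apply: (le_trans (up z)).
by rewrite le_eqVlt; apply/orP; left; apply/eqP; field; rewrite gt_eqF.
Qed.

(** Combines x^2 <= 1 + x^4 with N / (N - 1) <= 2. *)
Lemma Smat_diag_ub (Y : 'I_N -> trt K -> R) (Delta : R) z : (1 < N)%N ->
  N%:R^-1 * \sum_(i < N) (Y i z - Ybar Y z) ^+ 4 <= Delta ^+ 4 ->
  Smat Y z z <= 2 * (1 + Delta ^+ 4).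
Proof.
move=> N1 h.
have N0 : (0 : R) < N%:R by rewrite ltr0n ltnW.
have N2 : (2 : R) <= N%:R by rewrite ler_nat.
rewrite ler_pdivrMl // in h.
have s : \sum_(i < N) (Y i z - Ybar Y z) * (Y i z - Ybar Y z) <= N%:R * (1 + Delta ^+ 4).
  apply: (@le_trans _ _ (\sum_(i < N) (1 + (Y i z - Ybar Y z) ^+ 4))).
    apply: ler_sum => i _; set x := Y i z - _.
    by have := sqr_ge0 (x ^+ 2 - 1 / 2); lra.
  by rewrite big_split /= sumr_const card_ord -/(N%:R); lra.
have d4 : 0 <= 1 + Delta ^+ 4.
  by rewrite addr_ge0 //; have := sqr_ge0 (Delta ^+ 2); rewrite -exprM.
rewrite /Smat ler_pdivrMl; last by lra.
apply: (le_trans s); rewrite mulrA ler_wpM2r //; lra.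
Qed.

Lemma card_Mstar (Y : 'I_N -> trt K -> R) : (#|Mstar Y| <= 1 + #|Mstar1 Y|)%N.
Proof. by rewrite /Mstar -/(Mstar1 Y) cardsU1 leq_add2r leq_b1. Qed.

End Regularity.

(** * The limit statements *)

Local Open Scope classical_set_scope.
Local Open Scope ring_scope.

Lemma near_of_eventually (P : nat -> Prop) :
  (exists n0, forall n, (n0 <= n)%N -> P n) -> \forall n \near \oo, P n.
Proof. by move=> [n0 H]; exists n0. Qed.
Theorem theorem2 (R : realType)
  (* the sequence of designs, indexed by n; everything may depend on n *)
  (K : nat -> nat) (Npop : nat -> nat)
  (Y : forall n, 'I_(Npop n) -> trt (K n) -> R)
  (Nz : forall n, trt (K n) -> nat)
  (f : forall n, trt (K n) -> R)
  (alpha : nat -> nat -> R)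
  (h : heredity)
  (* setup *)
  (HK : forall n, (2 <= K n)%N)
  (HN : forall m : nat, exists n0, forall n, (n0 <= n)%N -> (m <= Npop n)%N)
  (HNz2 : forall n z, (2 <= Nz n z)%N)
  (HNzsum : forall n, (\sum_(z : trt (K n)) Nz n z)%N = Npop n)
  (* (C1) *)
  (C1 : exists (cl cu : R) (N0 : nat -> nat) (c : forall n, trt (K n) -> R),
      0 < cl /\ forall n z, (Nz n z)%:R = c n z * (N0 n)%:R /\ cl <= c n z <= cu)
  (* (C2)(i) *)
  (C2i : exists delta : R, -(1/2) < delta <= 0 /\
      exists a b : R, 0 < a /\ 0 < b /\ exists n0, forall n, (n0 <= n)%N ->
        forall S, S \in Mstar1 (Y n) ->
          a * (Npop n)%:R `^ delta <= `|tau (Y n) S| <= b * (Npop n)%:R `^ delta)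
  (* (C2)(ii) *)
  (C2ii : exists delta' : R, 0 < delta' /\
      exists a b : R, 0 < a /\ 0 < b /\ exists n0, forall n, (n0 <= n)%N ->
        forall d, (1 <= d <= K n)%N ->
          a * (Npop n)%:R `^ (- delta') <= alpha n d <= b * (Npop n)%:R `^ (- delta'))
  (* (C2)(iii) *)
  (C2iii : exists delta'' : R, 0 <= delta'' < 1/3 /\
      exists a b : R, 0 < a /\ 0 < b /\ exists n0, forall n, (n0 <= n)%N ->
        a * (Npop n)%:R `^ delta'' <= #|Mstar1 (Y n)|%:R <= b * (Npop n)%:R `^ delta'')
  (* implicit in (C3): the variances S(z,z) are positive *)
  (HSpos : forall n z, 0 < Smat (Y n) z z)
  (* implicit non-degeneracy: the standardization v_R is nonzero *)
  (HvR : forall n, 0 < vR2 (Y n) (Nz n) (f n))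
  (* (C3)(i): condition number of the correlation matrix at most sigma^2 *)
  (C3i : exists sigma : R, forall n a b,
      is_eigenvalue (Corr (Y n) (Nz n)) a -> is_eigenvalue (Corr (Y n) (Nz n)) b ->
      a <= sigma ^+ 2 * b)
  (* (C3)(ii) *)
  (C3ii : exists Delta : R, forall n z,
      (Npop n)%:R^-1 * \sum_(i < Npop n) (Y n i z - Ybar (Y n) z) ^+ 4 <= Delta ^+ 4)
  (* (C3)(iii) *)
  (C3iii : exists M : R, forall n i z z',
      `|Y n i z - Ybar (Y n) z| <= M * Num.sqrt (Smat (Y n) z' z'))
  (* (C4), same heredity type h as the procedure *)
  (C4 : forall n S, S \in Mstar1 (Y n) -> parent_ok h (Mstar (Y n)) S) :
  (* CLT for the screened estimator *)
  (forall t : R,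
     (fun n => prob (Nz n) (fun A =>
        (gammaR_hat (Y n) (Nz n) h (alpha n) (f n) A - gamma (Y n) (f n))
          / Num.sqrt (vR2 (Y n) (Nz n) (f n)) <= t)) @ \oo --> Phi t)
  /\
  (* variance estimation *)
  ((exists C : R, exists n0, forall n, (n0 <= n)%N ->
      forall z, `|fstar (Y n) (f n) z| <= C / Q (K n)) ->
   (forall n, vR2 (Y n) (Nz n) (f n) <= vRlim2 (Y n) (Nz n) (f n)) /\
   (forall eps : R, 0 < eps ->
     (fun n => prob (Nz n) (fun A =>
        eps < `|(Npop n)%:R * (vRhat2 (Y n) (Nz n) h (alpha n) (f n) A
                              - vRlim2 (Y n) (Nz n) (f n))|)) @ \oo --> (0 : R))).
Proof.
have [cl [cu [N0 [c [cl0 Hc]]]]] := C1.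
have N_gt1 n : (1 < Npop n)%N.
  rewrite -(HNzsum n) (bigD1 [ffun=> false]) //=.
  exact: leq_trans (HNz2 n _) (leq_addr _ _).
have Npos n : (0 : R) < (Npop n)%:R by rewrite ltr0n ltnW.
have design n := design_ratio (HNzsum n) cl0 (Hc n).
pose rho := cu / cl.
have cu0 : 0 < cu by have [_ /andP[h1 h2]] := Hc 0%N [ffun=> false]; lra.
have rho0 : 0 < rho by rewrite divr_gt0.
have Nz_lb n z : (Npop n)%:R <= rho * (Q (K n) * (Nz n z)%:R) by have [] := design n z.
have Nz_ub n z : Q (K n) * (Nz n z)%:R <= rho * (Npop n)%:R by have [] := design n z.
have [M0 HM0] := C3iii.
pose M : R := `|M0| + 1.
have Mp : 0 < M by rewrite ltr_wpDl.
have M0M : M0 ^+ 2 <= M ^+ 2.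
  by rewrite -[leLHS]real_normK ?num_real // lerXn2r ?nnegrE ?(ltW Mp) // lerDl.
(* The least arm variance serves as [Smin]; the outlier condition is applied with its second arm
   equal to the minimizing one. *)
have Smin_ex n : exists Smin, [/\ 0 < Smin, forall z, Smin <= Smat (Y n) z z &
    forall i z, resid (Y n) i z ^+ 2 <= M ^+ 2 * Smin].
  have [z0 Hz0] := exists_min (fun z => Smat (Y n) z z).
  exists (Smat (Y n) z0 z0); split => // i z.
  apply: (@le_trans _ _ (M0 ^+ 2 * Smat (Y n) z0 z0)); last by rewrite ler_wpM2r // ltW.
  have h1 := HM0 n i z z0.
  have -> : M0 ^+ 2 * Smat (Y n) z0 z0 = (M0 * Num.sqrt (Smat (Y n) z0 z0)) ^+ 2.
    by rewrite exprMn sqr_sqrtr // ltW.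
  rewrite /resid -[leLHS]real_normK ?num_real // lerXn2r ?nnegrE //.
  exact: le_trans h1.
have [Delta HDelta] := C3ii.
pose D : R := 2 * (1 + Delta ^+ 4).
have D0 : 0 < D.
  rewrite mulr_gt0 // ltr_pwDl //.
  by have := sqr_ge0 (Delta ^+ 2); rewrite -exprM.
have S_ub n z : Smat (Y n) z z <= D by apply: Smat_diag_ub.
have [dl [/andP[dl0 _] [a [b0' [a0 [_ Htau]]]]]] := C2i.
have [dl' [dl'0 [a' [b' [a'0 [b'0 Halpha]]]]]] := C2ii.
have [d2 [/andP[d20 d21] [a2 [b2 [_ [b20 Hcard]]]]]] := C2iii.
have [sig Hsig] := C3i.
(* Adding 1 keeps the constant positive when [sig] is 0, so that the coefficient bound k below is
   positive. *)
pose s : R := sig ^+ 2 + 1.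
have s_gt0 : 0 < s by rewrite ltr_wpDl ?sqr_ge0.
have L_large (B : R) : \forall n \near \oo, B <= ln (Npop n)%:R.
  have [n0 H] := HN (Num.bound (expR B)).
  exists n0 => // n /= nn; rewrite -[leLHS]expRK ler_ln ?posrE ?expR_gt0 //.
  apply: ltW; apply: lt_le_trans (archi_boundP (ltW (expR_gt0 B))) _.
  by rewrite ler_nat; exact: H.
have screen_ok (eps : R) : 0 < eps -> \forall n \near \oo,
    prob (Nz n) (fun A => screen (Y n) (Nz n) A h (alpha n) (K n) != Mstar (Y n)) <= eps.
  move=> eps0.
  have [L0 HL] := screening_consistency h rho0 Mp D0 a0 dl0 a'0 b'0 dl'0 eps0.
  near=> n.
  have [Smin [Smin0 S_lb res]] := Smin_ex n.
  apply: (HL (K n) (Npop n) (Nz n) (Y n) (alpha n) Smin) => //; try exact: C4.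
  - move=> S SM; suff T : forall S, S \in Mstar1 (Y n) ->
        a * (Npop n)%:R `^ dl <= `|tau (Y n) S| <= b0' * (Npop n)%:R `^ dl.
      by have /andP[] := T S SM.
    by near: n; exact: near_of_eventually Htau.
  - by near: n; exact: near_of_eventually Halpha.
  - by near: n; exact: L_large.
split.
- move=> t; apply/cvgrPdist_le => eps eps0.
  have e20 : 0 < eps / 2 by rewrite divr_gt0.
  have [d d0 Hclt] := clt_linstat t e20.
  pose A0 : R := 2 * rho ^+ 4 * s * M ^+ 2.
  have A00 : 0 < A0 by rewrite mulr_gt0 ?exprn_gt0 // mulr_gt0 // mulr_gt0 ?exprn_gt0.
  (* The quantity N k^4 is A0^2 |M^star|^2 / N, at most a constant times N^(2 d2 - 1), so the
     exponent 1 - 2 d2 > 0 makes it vanish. *)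
  have [L1 _ HL1] := @poly_le_expR R (A0 ^+ 2 * (1 + b2) ^+ 2) d (1 - 2 * d2) d0 ltac:(lra).
  near=> n.
  have Sc : prob (Nz n) (fun A => screen (Y n) (Nz n) A h (alpha n) (K n) != Mstar (Y n)) <= eps / 2.
    by near: n; exact: screen_ok.
  pose W A := linstat (coefs (Nz n) (Y n) (fun z => fstar (Y n) (f n) z / Num.sqrt (vR2 (Y n) (Nz n) (f n)))) A.
  pose B A := screen (Y n) (Nz n) A h (alpha n) (K n) != Mstar (Y n); rewrite -/(B _) in Sc.
  have [Smin [Smin0 S_lb res]] := Smin_ex n.
  have W1 := Ex_standardized_sq (HNzsum n) (N_gt1 n) (HNz2 n) (HvR n).
  have K0 : (0 < K n)%N by exact: ltnW (HK n).
  pose q : R := #|Mstar (Y n)|%:R / (Npop n)%:R.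
  have q0 : 0 < q.
    rewrite divr_gt0 // ltr0n; apply/card_gt0P; exists finset.set0.
    by rewrite !inE eqxx.
  pose k := Num.sqrt (A0 * q).
  have k0 : 0 < k by rewrite sqrtr_gt0 mulr_gt0.
  have ck i z : `|coefs (Nz n) (Y n) (fun z => fstar (Y n) (f n) z / Num.sqrt (vR2 (Y n) (Nz n) (f n))) i z| <= k.
    apply: (le_trans (standardized_coef_le (HNzsum n) (N_gt1 n) (HNz2 n) K0 Smin0 rho0 (Nz_lb n) (Nz_ub n) S_lb res (HvR n) i z (sqr_ge0 sig) (Hsig n))).
    rewrite ler_sqrt ?(ltW (mulr_gt0 A00 q0)) // ler_wpM2r ?(ltW q0) // ler_wpM2r ?sqr_ge0 //.
    rewrite ler_wpM2l //; first by rewrite mulr_ge0 // exprn_ge0 // ltW.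
    by rewrite /s lerDl.
  have c0 z : \sum_i coefs (Nz n) (Y n) (fun z => fstar (Y n) (f n) z / Num.sqrt (vR2 (Y n) (Nz n) (f n))) i z = 0.
    by apply: sum_coefs; exact: N_gt1.
  have card_le : #|Mstar (Y n)|%:R <= (1 + b2) * expR (d2 * ln (Npop n)%:R) :> R.
    have Lge0 : 0 <= ln (Npop n)%:R :> R by near: n; exact: L_large.
    have h2 : #|Mstar1 (Y n)|%:R <= b2 * (Npop n)%:R `^ d2 :> R.
      suff T : a2 * (Npop n)%:R `^ d2 <= #|Mstar1 (Y n)|%:R <= b2 * (Npop n)%:R `^ d2 by case/andP: T.
      by near: n; exact: near_of_eventually Hcard.
    rewrite powR_expR // in h2.
    have h1 : #|Mstar (Y n)|%:R <= 1 + #|Mstar1 (Y n)|%:R :> R.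
      by have := card_Mstar (Y n); rewrite -(ler_nat R) natrD.
    have h3 : 1 <= expR (d2 * ln (Npop n)%:R) by rewrite -[leLHS]expR0 ler_expR mulr_ge0.
    lra.
  have Nk : (Npop n)%:R * k ^+ 4 <= d.
    have k4 : k ^+ 4 = (A0 * q) ^+ 2.
      by rewrite -[in RHS](sqr_sqrtr (ltW (mulr_gt0 A00 q0))) -exprM.
    have -> : (Npop n)%:R * k ^+ 4 = A0 ^+ 2 * #|Mstar (Y n)|%:R ^+ 2 / (Npop n)%:R.
      by rewrite k4 /q; field; rewrite gt_eqF.
    have LL1 : L1 <= ln (Npop n)%:R :> R by near: n; exact: L_large.
    have LL0 : 0 <= ln (Npop n)%:R :> R by near: n; exact: L_large.
    have NE : (Npop n)%:R = expR (ln (Npop n)%:R) :> R by rewrite lnK ?posrE.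
    have hq := HL1 _ LL1.
    set L := ln (Npop n)%:R in card_le LL0 NE hq.
    rewrite NE ler_pdivrMr ?expR_gt0 //.
    have c2 : #|Mstar (Y n)|%:R ^+ 2 <= ((1 + b2) * expR (d2 * L)) ^+ 2.
      by rewrite lerXn2r ?nnegrE // (le_trans _ card_le).
    apply: (le_trans (ler_wpM2l (sqr_ge0 A0) c2)).
    have eL : expR L = expR ((1 - 2 * d2) * L) * expR (d2 * L) ^+ 2.
      by rewrite expr2 -!expRD; congr expR; ring.
    rewrite eL [((1 + b2) * _) ^+ 2]exprMn [A0 ^+ 2 * _]mulrA [d * (_ * _)]mulrA.
    rewrite ler_wpM2r ?sqr_ge0 //.
    apply: le_trans hq; rewrite -[leLHS]mulr1; apply: ler_wpM2l.
    - by apply: mulr_ge0; exact: sqr_ge0.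
    - by have := sqr_ge0 L; lra.
  have C := Hclt (K n) (Npop n) (Nz n) _ k (HNzsum n) (ltnW (N_gt1 n)) k0 ck c0 W1 Nk.
  pose G A := (gammaR_hat (Y n) (Nz n) h (alpha n) (f n) A - gamma (Y n) (f n)) / Num.sqrt (vR2 (Y n) (Nz n) (f n)).
  (* On correct selection the screened estimator is the linear statistic, so the two distribution
     functions differ by at most the probability of a selection error. *)
  have Df : `|prob (Nz n) (fun A => G A <= t) - prob (Nz n) (fun A => W A <= t)| <= prob (Nz n) B :> R.
    apply: prob_diff_le => A HA /negPn/eqP E; rewrite /G /gammaR_hat /fMhat E.
    by rewrite -/(fstar (Y n) (f n)) (standardizedE (HNz2 n) (HvR n) HA).
  rewrite -/(G _) distrC.
  rewrite (_ : _ - _ = (prob (Nz n) (fun A => G A <= t) - prob (Nz n) (fun A => W A <= t))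
      + (prob (Nz n) (fun A => W A <= t) - Phi t)); last by ring.
  by apply: (le_trans (ler_normD _ _)); lra.
- move=> [C [n1 HC]]; split; first by move=> n; exact: qform_Vmat_le.
  move=> eps eps0; apply/cvgrPdist_le => e e0.
  have e20 : 0 < e / 2 by rewrite divr_gt0.
  (* The constant in the sup-norm bound comes without a sign; this majorant is positive. *)
  pose C' : R := `|C| + 1; have C'0 : 0 < C' by rewrite ltr_wpDl.
  have [V0 V00 V0E] : exists2 v : R, 0 < v & 32 * (40 * (M ^+ 2 * D * C' ^+ 2 * rho ^+ 2)) ^+ 2 = v.
    eexists; last reflexivity.
    have t1 : 0 < M ^+ 2 * D by rewrite mulr_gt0 // exprn_gt0.
    have t2 : 0 < M ^+ 2 * D * C' ^+ 2 by rewrite mulr_gt0 // exprn_gt0.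
    have t3 : 0 < M ^+ 2 * D * C' ^+ 2 * rho ^+ 2 by rewrite mulr_gt0 // exprn_gt0.
    by apply: mulr_gt0; rewrite ?ltr0n // exprn_gt0 // mulr_gt0 ?ltr0n.
  pose g0 := eps ^+ 2 / V0; have g00 : 0 < g0 by rewrite divr_gt0 // exprn_gt0.
  near=> n.
  have Sc : prob (Nz n) (fun A => screen (Y n) (Nz n) A h (alpha n) (K n) != Mstar (Y n)) <= e / 2.
    by near: n; exact: screen_ok.
  have [Smin [Smin0 S_lb res]] := Smin_ex n.
  pose B A := screen (Y n) (Nz n) A h (alpha n) (K n) != Mstar (Y n); rewrite -/(B _) in Sc.
  pose P A := eps < `|(Npop n)%:R * (vRhat2 (Y n) (Nz n) h (alpha n) (f n) A - vRlim2 (Y n) (Nz n) (f n))|.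
  pose P' A := eps <= `|(Npop n)%:R * (qform (Vhat (Y n) (Nz n) A) (fstar (Y n) (f n)) - vRlim2 (Y n) (Nz n) (f n))|.
  have fC z : `|fstar (Y n) (f n) z| <= C' / Q (K n).
    have T : forall z, `|fstar (Y n) (f n) z| <= C / Q (K n).
      by near: n; exists n1.
    apply: (le_trans (T z)); rewrite ler_pM2r ?invr_gt0 ?Q_gt0 //.
    by rewrite /C'; have := ler_norm C; lra.
  have V := variance_tail (HNzsum n) (N_gt1 n) (HNz2 n) rho0 Mp (Nz_lb n) S_lb res D0 C'0 eps0 (S_ub n) fC.
  rewrite V0E -/g0 in V.
  have gN : 2 * expR (- (g0 * (Npop n)%:R)) <= e / 2.
    have LL : ln (4 / e) / g0 <= expR (ln (Npop n)%:R).
      apply: (@le_trans _ _ (ln (Npop n)%:R)); last first.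
        by apply: le_trans (expR_ge1Dx _); rewrite lerDr.
      by near: n; exact: L_large.
    rewrite lnK ?posrE // ler_pdivrMr // in LL.
    have : expR (- (g0 * (Npop n)%:R)) <= expR (- ln (4 / e)).
      by rewrite ler_expR lerN2 [g0 * _]mulrC.
    rewrite (expRN (ln _)) lnK ?posrE ?divr_gt0 // invf_div; lra.
  have PB : prob (Nz n) P <= prob (Nz n) B + prob (Nz n) P' :> R.
    apply: le_trans (probU _ _ _); apply: prob_le => A HA PA.
    have [BA|/negPn/eqP E] := boolP (B A); first by [].
    by move: PA; rewrite /P /P' /vRhat2 /fMhat E orFb => /ltW.
  rewrite sub0r normrN ger0_norm ?prob_ge0 //.
  rewrite -/(P _); lra.
Unshelve. all: by end_near.
Qed.
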